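(* For all $1 \le p < \infty$, comeagre many $f$ in $A^p$ are universal in the sense of Menshov, i.e. for each measurable function $g:\mathbb{T}\to\mathbb{C}$ a subsequence of the partial sums $(s_n f)$ tends to $g$ almost everywhere on $\mathbb{T}$.
   Context: $\mathbb{D}$ is the open unit disc, $\mathbb{T}$ the unit circle; ''almost everywhere'' on $\mathbb{T}$ refers to (normalized) arc length measure. $m_2$ is the normalized area measure on $\mathbb{D}$. For $1\le p<\infty$, the Bergman space $A^p$ is the Banach space of all functions $f$ holomorphic in $\mathbb{D}$ with $\|f\|_p:=\big(\int_{\mathbb{D}}|f|^p\,dm_2\big)^{1/p}<\infty$. For $f(z)=\sum_{\nu=0}^\infty a_\nu z^\nu$ holomorphic in $\mathbb{D}$, $s_n f(z):=\sum_{\nu=0}^n a_\nu z^\nu$ denotes the $n$-th Taylor partial sum about $0$. A property is satisfied for comeagre many elements of a complete metric space if it is satisfied on a residual (comeagre) subset of the space. *)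

(* Defs.v *)
From HB Require Import structures.
From mathcomp Require Import all_boot all_order all_algebra.
From mathcomp Require Import all_classical all_reals all_analysis.
From mathcomp Require Import measurable_realfun complex ring lra.

Set Implicit Arguments.
Unset Strict Implicit.
Unset Printing Implicit Defensive.

Import Order.TTheory GRing.Theory Num.Theory.
Import numFieldNormedType.Exports.

Local Open Scope classical_set_scope.
Local Open Scope ring_scope.
Local Open Scope complex_scope.

HB.instance Definition _ (R : realType) := NormedModule.copy R[i] R[i]^o.

Section baire_category.
Context {T : topologicalType}.

Definition nowhere_dense (A : set T) := interior (closure A) = set0.

Definition meagre (A : set T) :=
  exists F : nat -> set T,
    (forall n, nowhere_dense (F n)) /\ A `<=` \bigcup_n F n.

Definition comeagre (A : set T) := meagre (~` A).

End baire_category.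

Section plane.
Variable R : realType.

(* The norm of [R[i]] takes its values in [R[i]]; this is the same modulus, as
   a real number. *)
Local Notation normc := (@Normc.normc R).
Local Notation R2 := (measurableTypeR R * measurableTypeR R)%type.

Definition unit_disc : set R[i] := [set z | `|z| < 1].

Definition holomorphic_on (U : set R[i]) (f : R[i] -> R[i]) :=
  forall z, U z -> derivable f z 1.

Definition complex_of (w : R * R) : R[i] := w.1 +i* w.2.

Lemma norm_normc (z : R[i]) : `|z| = (normc z)%:C.
Proof. by []. Qed.

Lemma normc_complex_of (w : R * R) : normc (complex_of w) <= `|w.1| + `|w.2|.
Proof.
rewrite /normc /complex_of /= -[leRHS]ger0_norm; last by rewrite addr_ge0.
rewrite -sqrtr_sqr ler_sqrt ?sqr_ge0//.
rewrite sqrrD !real_normK ?num_real// -addrA lerD2l lerDr.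
by rewrite mulrn_wge0// mulr_ge0.
Qed.

Lemma complex_of_ball (a b : R * R) (e : R) :
  ball a (e / 2) b -> normc (complex_of b - complex_of a) < e.
Proof.
case=> /= h1 h2.
apply: le_lt_trans (normc_complex_of (b - a)) _ => /=.
by rewrite (splitr e) ltrD// distrC.
Qed.

Lemma continuous_complex_of : continuous complex_of.
Proof.
move=> a; apply/cvgrPdist_lt => e e0.
have [r r0 ->] : exists2 r : R, 0 < r & e = r%:C.
  case: e e0 => x y; rewrite ltcE /= => /andP[/eqP -> x0].
  by exists x.
have ab : nbhs a (ball a (r / 2)) by apply: nbhsx_ballx; rewrite divr_gt0.
apply: filterS ab => b /complex_of_ball; rewrite -ltcR => ab.
by rewrite distrC.
Qed.


Lemma open_disc : open (unit_disc : set R[i]).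
Proof.
rewrite openE => z; rewrite /unit_disc /= => z1.
apply/nbhs_ballP; exists (1 - `|z|); rewrite /= ?subr_gt0//.
move=> w; rewrite -ball_normE /= distrC ltrBrDl; apply: le_lt_trans.
by rewrite -{1}(subrKC z w) ler_normD.
Qed.

Lemma holomorphic_continuous (U : set R[i]) (f : R[i] -> R[i]) z :
  holomorphic_on U f -> U z -> {for z, continuous f}.
Proof.
move=> hf Uz; apply: differentiable_continuous.
exact/derivable1_diffP/hf.
Qed.

Lemma open_measurable_prod (U : set (R * R)) : open U -> measurable (U : set R2).
Proof.
move=> oU.
pose box (q : (rat * rat) * (rat * rat)) : set (R * R) :=
  `]ratr q.1.1, ratr q.1.2[%classic `*` `]ratr q.2.1, ratr q.2.2[%classic.
have -> : U = \bigcup_(q in [set q | box q `<=` U]) box q.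
  apply/seteqP; split; last by move=> x [q /= qU]; exact: qU.
  move=> [x y] Uxy.
  have /nbhs_ballP[e /= e0 eU] : nbhs (x, y) U by exact: open_nbhs_nbhs.
  have ball_itv (t : R) : exists q : rat * rat,
      [/\ ratr q.1 < t, t < ratr q.2 &
        forall s : R, ratr q.1 < s < ratr q.2 -> ball t e s].
    have /rat_in_itvoo[q1 q1t] : t - e < t by rewrite ltrBlDr ltrDl.
    have /rat_in_itvoo[q2 q2t] : t < t + e by rewrite ltrDl.
    exists (q1, q2) => /=; move: q1t q2t.
    rewrite !in_itv /= => /andP[a1 a2] /andP[b1 b2]; split => //.
    move=> s /andP[s1 s2]; rewrite /ball /= ltr_norml; apply/andP; split; lra.
  have [p [p1 p2 pb]] := ball_itv x.
  have [q [q1 q2 qb]] := ball_itv y.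
  exists (p, q).
    move=> [s t] [/=]; rewrite !in_itv /= => hs ht.
    by apply: eU; split; [exact: pb|exact: qb].
  by split; rewrite /= in_itv /=; apply/andP.
rewrite bigcup_mkcond; apply: countable_bigcupT_measurable => // q.
by case: ifPn => // _; apply: measurableX.
Qed.

Lemma normc_triangle (x y : R[i]) : normc (x + y) <= normc x + normc y.
Proof. by rewrite -lecR rmorphD; exact: (ler_normD x y). Qed.

Lemma normc_ge0 (x : R[i]) : 0 <= normc x.
Proof. by case: x => a b; rewrite /normc /= sqrtr_ge0. Qed.

Lemma normc_opp (x : R[i]) : normc (- x) = normc x.
Proof. by apply: complexI; exact: (normrN x). Qed.

Lemma open_modulus_gt (f : R[i] -> R[i]) (a : R) : 0 <= a ->
  (forall z, unit_disc z -> {for z, continuous f}) ->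
  (forall z, ~ unit_disc z -> f z = 0) ->
  open [set w : R * R | a < normc (f (complex_of w))].
Proof.
move=> a0 fc f0; rewrite openE => w /= aw.
have Dw : unit_disc (complex_of w).
  by apply: contrapT => /f0 E; move: aw; rewrite E Normc.normc0 ltNge a0.
have cw : (f \o complex_of) @ w --> f (complex_of w).
  by apply: continuous_comp; [exact: continuous_complex_of|exact: fc].
have e0 : 0 < (normc (f (complex_of w)) - a)%:C by rewrite ltcR subr_gt0.
have /cvgrPdist_lt/(_ _ e0) := cw.
apply: filterS => w' /=; rewrite norm_normc ltcR => h.
have := normc_triangle (f (complex_of w) - f (complex_of w')) (f (complex_of w')).
rewrite subrK; lra.
Qed.

Lemma measurable_modulus (f : R[i] -> R[i]) :
  (forall z, unit_disc z -> {for z, continuous f}) ->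
  (forall z, ~ unit_disc z -> f z = 0) ->
  measurable_fun [set: R2] (fun w => normc (f (complex_of w))).
Proof.
move=> fc f0 mT; apply: (measurability _ (RGenOInfty.measurableE R)) => //.
move=> /= _ [_ [a ->] <-]; rewrite setTI preimage_itvoy.
apply: open_measurable_prod.
have [a0|a0] := ltP a 0; last exact: open_modulus_gt.
rewrite (_ : [set _ | _] = setT); first exact: openT.
by apply/seteqP; split => // w _ /=; exact: lt_le_trans a0 (normc_ge0 _).
Qed.

Definition disc_coord : set (R * R) := complex_of @^-1` unit_disc.

Lemma open_disc_coord : open disc_coord.
Proof. exact: (proj1 (continuousP _) continuous_complex_of _ open_disc). Qed.

Lemma measurable_disc_coord : measurable (disc_coord : set R2).
Proof. exact: (open_measurable_prod open_disc_coord). Qed.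

Lemma invr_pi_ge0 : 0 <= (pi : R)^-1.
Proof. by rewrite invr_ge0 pi_ge0. Qed.

(* [mrestr] restricts the planar Lebesgue measure to the unit disc, whose area
   is [pi]. *)
Definition area_measure : {measure set R2 -> \bar R} :=
  mscale (NngNum invr_pi_ge0)
    (mrestr (lebesgue_measure \x lebesgue_measure)%E measurable_disc_coord).

Definition bergman_norm (p : R) (f : R[i] -> R[i]) : \bar R :=
  Lnorm area_measure p%:E (fun w => (normc (f (complex_of w)))%:E).

Lemma area_measure_gt0 (U : set (R * R)) (w : R * R) :
  open U -> U w -> disc_coord w -> (0 < area_measure U)%E.
Proof.
move=> oU Uw Dw.
have /nbhs_ballP[e /= e0 eU] : nbhs w (U `&` disc_coord).
  by apply: open_nbhs_nbhs; split => //; apply: openI => //; exact: open_disc_coord.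
rewrite /area_measure /= /mscale /= mule_gt0 ?lte_fin ?invr_gt0 ?pi_gt0//.
rewrite /mrestr.
pose B : set (R * R) := ball w.1 e `*` ball w.2 e.
have mb (t : R) : measurable (ball t e) by apply: open_measurable; exact: ball_open.
apply: (@lt_le_trans _ _ ((lebesgue_measure \x lebesgue_measure)%E B)).
  have mB (t : R) : (0 < lebesgue_measure (ball t e : set R))%E.
    by rewrite lebesgue_measure_ball ?ltW// lte_fin mulrn_wgt0.
  rewrite product_measure1E; [|exact: mb|exact: mb].
  by apply: mule_gt0; exact: mB.
apply: le_measure; rewrite ?inE.
- by apply: measurableX; exact: mb.
- by apply: measurableI; [exact: open_measurable_prod|exact: measurable_disc_coord].
- by move=> [x y] [/= hx hy]; exact: eU.
Qed.

Lemma bergman_norm_eq0 (p : R) (f : R[i] -> R[i]) : 1 <= p ->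
  (forall z, unit_disc z -> {for z, continuous f}) ->
  (forall z, ~ unit_disc z -> f z = 0) ->
  bergman_norm p f = 0%E -> f = cst 0.
Proof.
move=> p1 fc f0 N0.
have mf := measurable_modulus fc f0.
have p0 : (0 < p%:E)%E by rewrite lte_fin (lt_le_trans ltr01 p1).
have mf' : measurable_fun [set: R2] (fun w => (normc (f (complex_of w)))%:E).
  exact/measurable_EFinP.
have [A [mA A0 fA]] := Lnorm_eq0_eq0 mf' p0 N0.
apply/funext => z; apply: contrapT => fz.
have Dz : unit_disc z by apply: contrapT => /f0.
pose w : R * R := (complex.Re z, complex.Im z).
have wz : complex_of w = z by rewrite /w; case: (z).
pose U : set (R * R) := [set w | 0 < normc (f (complex_of w))].
have oU : open U by exact: open_modulus_gt.
have Uw : U w.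
  rewrite /U /= wz lt_neqAle normc_ge0 andbT eq_sym.
  by apply/eqP => /(@Normc.eq0_normc R).
have Dw : disc_coord w by rewrite /disc_coord /= wz.
have : (area_measure U <= area_measure A)%E.
  apply: le_measure; rewrite ?inE//; first exact: open_measurable_prod.
  move=> u Uu; apply: fA => /= /(_ I) [] E.
  by move: Uu; rewrite /U /= E ltxx.
by rewrite A0 leNgt (area_measure_gt0 oU Uw Dw).
Qed.

Lemma bergman_norm0 (p : R) : 1 <= p -> bergman_norm p (cst 0) = 0%E.
Proof.
move=> p1; rewrite /bergman_norm.
rewrite (_ : (fun w => _) = cst 0%E).
  by rewrite Lnorm0// eqe gt_eqF// (lt_le_trans ltr01 p1).
by apply/funext => w; rewrite Normc.normc0.
Qed.

Lemma bergman_norm_opp (p : R) (f : R[i] -> R[i]) :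
  bergman_norm p (\- f) = bergman_norm p f.
Proof. by apply: eq_Lnorm => w; rewrite normc_opp. Qed.

Lemma bergman_normD (p : R) (f g : R[i] -> R[i]) : 1 <= p ->
  (forall z, unit_disc z -> {for z, continuous f}) ->
  (forall z, ~ unit_disc z -> f z = 0) ->
  (forall z, unit_disc z -> {for z, continuous g}) ->
  (forall z, ~ unit_disc z -> g z = 0) ->
  (bergman_norm p (fun z => f z + g z)%R <= bergman_norm p f + bergman_norm p g)%E.
Proof.
move=> p1 fc f0 gc g0.
have mf := measurable_modulus fc f0.
have mg := measurable_modulus gc g0.
apply: le_trans (minkowski_EFin area_measure mf mg p1).
have p0 : 0 < p by rewrite (lt_le_trans ltr01 p1).
rewrite /bergman_norm unlock.
apply: gt0_ler_poweR; rewrite ?invr_ge0 ?(ltW p0)//=.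
- by rewrite in_itv /= leey andbT; apply: integral_ge0 => w _; rewrite lee_fin powR_ge0.
- by rewrite in_itv /= leey andbT; apply: integral_ge0 => w _; rewrite lee_fin powR_ge0.
have mn (h : R2 -> R) : measurable_fun [set: R2] h ->
    measurable_fun [set: R2] (fun w => `|(h w)%:E| `^ p)%E.
  move=> mh; apply: (measurableT_comp (measurable_poweR p)).
  by apply: measurableT_comp => //; exact/measurable_EFinP.
apply: ge0_le_integral => //.
- apply: mn; apply: (@measurable_modulus (fun z => f z + g z)) => z Dz.
    exact: (continuousD (fc z Dz) (gc z Dz)).
  by rewrite f0// g0// addr0.
- by apply: mn; exact: measurable_funD.
- move=> w _; rewrite lee_fin ge0_ler_powR ?nnegrE ?(ltW p0)//.
  rewrite !ger0_norm ?addr_ge0 ?normc_ge0//; exact: normc_triangle.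
Qed.

(* Elements of A^p are extended by zero outside the disc, so that two of them
   are equal exactly when they agree on the disc.  The proof of [1 <= p] is a
   parameter because the triangle inequality depends on it. *)
Record bergman (p : R) (p1 : 1 <= p) := Bergman {
  bergman_fun :> R[i] -> R[i] ;
  bergman_holomorphic : holomorphic_on unit_disc bergman_fun ;
  bergman_out : forall z, ~ unit_disc z -> bergman_fun z = 0 ;
  bergman_finite : (bergman_norm p bergman_fun < +oo)%E }.

HB.instance Definition _ p (p1 : 1 <= p) := gen_eqMixin (bergman p1).
HB.instance Definition _ p (p1 : 1 <= p) := gen_choiceMixin (bergman p1).

Section bergman_metric.
Context (p : R) (p1 : 1 <= p).
Implicit Types f g h : bergman p1.

Lemma bergman_inj f g : bergman_fun f = bergman_fun g -> f = g.
Proof.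
case: f g => f a b c [g a' b' c'] /= fg; case: g / fg a' b' c' => a' b' c'.
by congr Bergman; exact: Prop_irrelevance.
Qed.

Lemma bergman_continuous f z : unit_disc z -> {for z, continuous f}.
Proof. exact/holomorphic_continuous/bergman_holomorphic. Qed.

Lemma bergmanB_continuous f g z :
  unit_disc z -> {for z, continuous (fun z => f z - g z)}.
Proof.
move=> Dz.
exact: (continuousB (bergman_continuous (f := f) Dz) (bergman_continuous (f := g) Dz)).
Qed.

Lemma bergmanB_out f g z : ~ unit_disc z -> f z - g z = 0.
Proof. by move=> Dz; rewrite !bergman_out// subrr. Qed.

Definition bergman_dist f g : R := fine (bergman_norm p (fun z => f z - g z)).

Lemma bergman_normN (u v : R[i] -> R[i]) :
  bergman_norm p (fun z => u z - v z) = bergman_norm p (fun z => v z - u z).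
Proof. by apply: eq_Lnorm => w; rewrite -normc_opp opprB. Qed.

Lemma bergman_normB_triangle f g h :
  (bergman_norm p (fun z => f z - h z)%R <=
   bergman_norm p (fun z => f z - g z)%R +
   bergman_norm p (fun z => g z - h z)%R)%E.
Proof.
rewrite (_ : (fun z => f z - h z) = (fun z => (f z - g z) + (g z - h z))).
  by apply: bergman_normD => //; solve [exact: bergmanB_continuous | exact: bergmanB_out].
by apply/funext => z; rewrite addrA subrK.
Qed.

Lemma bergman_normB_fin f g : bergman_norm p (fun z => f z - g z) \is a fin_num.
Proof.
rewrite ge0_fin_numE ?Lnorm_ge0//.
apply: le_lt_trans (bergman_normD p1 _ _ _ _) _.
- by move=> z; exact: bergman_continuous.
- by move=> z; exact: bergman_out.
- by move=> z Dz; exact: (continuousN (bergman_continuous (f := g) Dz)).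
- by move=> z Dz; rewrite bergman_out// oppr0.
by rewrite bergman_norm_opp lte_add_pinfty// bergman_finite.
Qed.

Let distxx f : bergman_dist f f = 0.
Proof.
rewrite /bergman_dist (_ : (fun z => _) = cst 0) ?bergman_norm0//.
by apply/funext => z; rewrite subrr.
Qed.

Let dist_positivity f g : bergman_dist f g = 0 -> f = g.
Proof.
move=> fg; apply: bergman_inj; apply/funext => z; apply/eqP.
rewrite -subr_eq0; apply/eqP.
have := @bergman_norm_eq0 p (fun z => f z - g z) p1
  (@bergmanB_continuous f g) (@bergmanB_out f g).
rewrite -(fineK (bergman_normB_fin f g)) -/(bergman_dist f g) fg.
by move=> /(_ erefl) /(congr1 (@^~ z)).
Qed.

Let dist_sym f g : bergman_dist f g = bergman_dist g f.
Proof. by rewrite /bergman_dist bergman_normN. Qed.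

Let dist_triangle g f h :
  bergman_dist f h <= bergman_dist f g + bergman_dist g h.
Proof.
rewrite -lee_fin EFinD !fineK ?bergman_normB_fin//.
exact: bergman_normB_triangle.
Qed.

HB.instance Definition _ := isMetric.Build R (bergman p1)
  distxx dist_positivity dist_sym dist_triangle.

End bergman_metric.

Definition taylor_sum (f : R[i] -> R[i]) (n : nat) (z : R[i]) : R[i] :=
  \sum_(0 <= k < n.+1) derive1n k f 0 / k`!%:R * z ^+ k.

Definition expi (t : R) : R[i] := cos t +i* sin t.

(* [caratheodory_type] carries the sigma-algebra of Lebesgue measurable sets;
   the default one on [R] is the Borel sigma-algebra. *)
Definition circle_measurable (g : R[i] -> R[i]) :=
  let arc := `[0, 2 * pi[%classic
    : set (caratheodory_type ((@wlength R idfun)^*)%mu) in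
  measurable_fun arc (fun t => complex.Re (g (expi t)) : R) /\
  measurable_fun arc (fun t => complex.Im (g (expi t)) : R).

(* [expi] maps [0, 2 pi[ bijectively onto the unit circle and carries Lebesgue
   measure to arc length; a negligible set is one contained in a measurable set
   of measure zero. *)
Definition ae_circle (P : R[i] -> Prop) :=
  {ae lebesgue_measure, forall t : R, t \in `[0, 2 * pi[ -> P (expi t)}.

(* Only the values of [g] on the unit circle matter. *)
Definition menshov_universal (f : R[i] -> R[i]) :=
  forall g : R[i] -> R[i], circle_measurable g ->
  exists k : nat -> nat, {homo k : m n / (m < n)%N >-> (m < n)%N} /\
    ae_circle (fun z => taylor_sum f (k n) z @[n --> \oo] --> g z).

End plane.

(* Main.v *)
Require Import Defs.
From mathcomp Require Import all_boot all_order all_algebra.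
From mathcomp Require Import all_classical all_reals all_analysis.
From mathcomp Require Import measurable_realfun complex ring lra.

(** Universality follows from Baire category and one construction.

    The construction ([small_polynomial]): for every Laurent polynomial on the
    circle and every [e > 0] there is a polynomial whose norm in the disc is
    smaller than [e] and which on the circle differs from the given one by less
    than [e] outside a set of measure less than [e].  It is the product of the
    Laurent polynomial with [1 - s (z ^+ n)], where [s (0) = 1] and [s] is small
    on the circle away from [1] ([peak_polynomial]).  The factor vanishes to
    order [n] at [0], so for large [n] the product is a polynomial whose mass is
    concentrated in a thin annulus at the circle, of small area
    ([bergman_norm_expr_small]).  On the circle it is close to the target
    except near the [n]-th roots of unity, and the length of that exceptional
    set does not depend on [n] ([near_roots_of_unity_small]).

    Consequently, for a fixed Laurent polynomial [L], the functions all of whose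
    partial sums of order at least [m] stay away from [L] in measure form a
    nowhere dense set ([avoiding_nowhere_dense]).  Any function is approximated
    in norm by a polynomial [P] ([polynomials_dense]); adding a small polynomial
    which imitates [L - P] on the circle gives a polynomial near the function,
    equal to its partial sums of high order and close to [L] on the circle.
    The coefficients of a function depend continuously on the function
    ([taylor_coef_continuous]), so the same partial sum remains close to [L] in
    a neighbourhood.

    Countably many [L], those with Gaussian rational coefficients, are dense in
    measure among the measurable functions on the circle
    ([circle_measurable_approximable], [gaussian_laurent_dense]).  A function
    outside the corresponding countably many nowhere dense sets has, for every
    measurable [g], partial sums of increasing orders converging to [g] in
    measure with speed [2 ^- n], and then almost everywhere
    ([ae_cvg_of_close]).

    Density of Laurent polynomials in measure is proved by enlarging the class
    of approximable sets: they form a Boolean algebra, contain the half-lines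
    ([approximable_half_line]) and hence finite unions of intervals, and are
    closed under approximation in outer measure, so they include all measurable
    sets ([caratheodory_approximable]); measurable functions are reached by
    step functions.

    The complex analysis rests on midpoint sums with [2 ^ n] points instead of
    integrals.  Goursat's argument applies to them directly ([goursat]), the
    exponential transports it to annuli ([circle_mean_annulus]), and Cauchy's
    formula and the Taylor expansion follow from the mean value property. *)

Set Implicit Arguments.
Unset Strict Implicit.
Unset Printing Implicit Defensive.

Import Order.TTheory GRing.Theory Num.Theory.
Import numFieldNormedType.Exports.

Local Open Scope classical_set_scope.
Local Open Scope ring_scope.
Local Open Scope complex_scope.

Local Notation N := Normc.normc.

(** * Modulus, limits and derivatives in the complex plane *)

Section modulus.
Variable R : realType.
Implicit Types (x y z w l : R[i]) (r e d : R).

Lemma normcB x y : N (x - y) = N (y - x).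
Proof. by rewrite -normc_opp opprB. Qed.

Lemma normcX x n : N (x ^+ n) = N x ^+ n.
Proof.
by elim: n => [|n ih]; rewrite ?Normc.normc1// !exprS Normc.normcM ih.
Qed.

Lemma normc_eq0 x : (N x == 0) = (x == 0).
Proof. by apply/eqP/eqP => [/Normc.eq0_normc//|->]; exact: Normc.normc0. Qed.

Lemma normc_gt0 x : (0 < N x) = (x != 0).
Proof. by rewrite lt_def normc_ge0 andbT normc_eq0. Qed.

Lemma normc_real r : N r%:C = `|r|.
Proof. by rewrite /N /= expr0n addr0 sqrtr_sqr. Qed.

Lemma normc_nat n : N n%:R = n%:R :> R.
Proof. by rewrite -(rmorph_nat (real_complex R)) normc_real normr_nat. Qed.

Lemma normc_i : N 'i = 1 :> R.
Proof. by rewrite /N /= expr0n expr1n add0r sqrtr1. Qed.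

Lemma sqr_normcE x : N x ^+ 2 = complex.Re x ^+ 2 + complex.Im x ^+ 2.
Proof. by case: x => a b; rewrite /N /= sqr_sqrtr// addr_ge0 ?sqr_ge0. Qed.

Lemma normc_le_ReIm x : N x <= `|complex.Re x| + `|complex.Im x|.
Proof. by case: x => a b; exact: (normc_complex_of (a, b)). Qed.

Lemma normc_Re x : `|complex.Re x| <= N x.
Proof.
by rewrite -(ler_pXn2r (n:=2))// ?nnegrE ?normc_ge0// sqr_normcE real_normK ?num_real// lerDl sqr_ge0.
Qed.

Lemma normc_Im x : `|complex.Im x| <= N x.
Proof.
by rewrite -(ler_pXn2r (n:=2))// ?nnegrE ?normc_ge0// sqr_normcE real_normK ?num_real// lerDr sqr_ge0.
Qed.

Lemma normc_triangleB x y : N (x - y) <= N x + N y.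
Proof. by rewrite -(normc_opp y); exact: normc_triangle. Qed.

Lemma normc_triangleBr x y z : N (x - y) <= N (x - z) + N (z - y).
Proof. by rewrite -{1}(subrKA z); exact: normc_triangle. Qed.

Lemma normc_subl x y : N x - N y <= N (x - y).
Proof. by rewrite lerBlDr -{1}(subrK y x); exact: normc_triangle. Qed.

Lemma normc_sum I (s : seq I) (F : I -> R[i]) :
  N (\sum_(i <- s) F i) <= \sum_(i <- s) N (F i).
Proof.
elim/big_ind2: _ => [|x1 r1 x2 r2 h1 h2|//]; first by rewrite Normc.normc0.
exact: le_trans (normc_triangle _ _) (lerD h1 h2).
Qed.

Lemma unit_discE z : unit_disc z <-> N z < 1.
Proof. by rewrite /unit_disc /= norm_normc -(ltcR (N z)). Qed.

(** The topology of [R[i]] comes from a norm with values in [R[i]]; with this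
    and the next two lemmas all estimates are carried out over [R]. *)
Lemma cvg_normcP {T} {F : set_system T} {FF : Filter F} (f : T -> R[i]) l :
  f @ F --> l <-> forall e, 0 < e -> \forall t \near F, N (f t - l) < e.
Proof.
rewrite cvgrPdistC_lt; split=> H e e0.
  have := H e%:C; rewrite ltcR => /(_ e0).
  by apply: filterS => t; rewrite norm_normc ltcR.
have [r r0 ->] : exists2 r : R, 0 < r & e = r%:C.
  by case: e e0 => x y; rewrite ltcE /= => /andP[/eqP -> x0]; exists x.
by have := H r r0; apply: filterS => t; rewrite norm_normc ltcR.
Qed.

Lemma near_normcP z (P : set R[i]) :
  (\forall w \near z, P w) <->
  exists2 d, 0 < d & forall w, N (w - z) < d -> P w.
Proof.
split=> [/nbhs_ballP[e /= e0 eP]|[d d0 dP]].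
  have [r r0 er] : exists2 r : R, 0 < r & e = r%:C.
    by case: e e0 {eP} => x y; rewrite ltcE /= => /andP[/eqP -> x0]; exists x.
  exists r => // w wr; apply: eP; rewrite -ball_normE /ball_ /= distrC er.
  by rewrite norm_normc ltcR.
apply/nbhs_ballP; exists d%:C; rewrite /= ?ltcR// => w.
rewrite -ball_normE /ball_ /= distrC norm_normc ltcR; exact: dP.
Qed.

Lemma continuous_normcP (f : R[i] -> R[i]) z : {for z, continuous f} <->
  forall e, 0 < e ->
    exists2 d, 0 < d & forall w, N (w - z) < d -> N (f w - f z) < e.
Proof.
have FF : Filter (nbhs z) by exact: nbhs_filter.
have [H1 H2] := @cvg_normcP _ (nbhs z) FF f (f z).
split=> [/H1 H e /H|H]; first by move/near_normcP.
by apply: H2 => e /H Hd; apply/near_normcP.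
Qed.

Lemma cvg_normc_le (u : nat -> R[i]) l a :
  u @ \oo --> l -> (\forall n \near \oo, N (u n) <= a) -> N l <= a.
Proof.
move=> /cvg_normcP ul ua; apply/ler_addgt0Pr => e e0.
have [n [h1 h2]] : exists n, N (u n - l) < e /\ N (u n) <= a.
  by near \oo => n; exists n; split; near: n; [exact: ul|exact: ua].
have := normc_triangleB (u n) (u n - l).
by rewrite opprB addrC subrK => /le_trans; apply; rewrite lerD// ltW.
Unshelve. all: by end_near. Qed.

Section complex_limits.
Context {T : Type} {F : set_system T} {FF : Filter F}.
Implicit Types f g : T -> R[i].

Lemma eq_cvg_complex f g l : f =1 g -> f @ F --> l -> g @ F --> l.
Proof. by move=> /funext ->. Qed.

Lemma cvg_complexD f g l k :
  f @ F --> l -> g @ F --> k -> (fun t => f t + g t) @ F --> l + k.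
Proof.
move=> /cvg_normcP fl /cvg_normcP gk; apply/cvg_normcP => e e0.
have e2 : 0 < e / 2 by rewrite divr_gt0.
apply: filterS2 (fl _ e2) (gk _ e2) => t h1 h2.
rewrite (_ : f t + g t - (l + k) = (f t - l) + (g t - k)); last by ring.
by rewrite (splitr e); apply: le_lt_trans (normc_triangle _ _) (ltrD h1 h2).
Qed.

Lemma cvg_complexZ (c : R[i]) f l : f @ F --> l -> (fun t => c * f t) @ F --> c * l.
Proof.
move=> /cvg_normcP fl; apply/cvg_normcP => e e0.
have c0 : 0 < N c + 1 by rewrite ltr_wpDl ?normc_ge0.
apply: filterS (fl _ (divr_gt0 e0 c0)) => t h.
rewrite -mulrBr Normc.normcM; apply: le_lt_trans (_ : (N c + 1) * N (f t - l) < e).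
  by rewrite ler_wpM2r ?normc_ge0// lerDl.
by rewrite mulrC -ltr_pdivlMr.
Qed.

Lemma cvg_complexZr (c : R[i]) f l :
  f @ F --> l -> (fun t => f t * c) @ F --> l * c.
Proof.
move=> fl; rewrite mulrC; apply: eq_cvg_complex (cvg_complexZ (c := c) fl) => t.
by rewrite mulrC.
Qed.

Lemma cvg_complexB f g l k :
  f @ F --> l -> g @ F --> k -> (fun t => f t - g t) @ F --> l - k.
Proof.
move=> fl gk; have := cvg_complexD fl (cvg_complexZ (c := -1) gk).
rewrite mulN1r (_ : (fun t => _) = (fun t => f t - g t))//.
by apply/funext => t; rewrite mulN1r.
Qed.

Lemma cvg_complex_sum I (s : seq I) (f : I -> T -> R[i]) (l : I -> R[i]) :
  (forall i, f i @ F --> l i) ->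
  (fun t => \sum_(i <- s) f i t) @ F --> \sum_(i <- s) l i.
Proof.
move=> fl; elim: s => [|i s ih].
  rewrite big_nil (_ : (fun t => _) = (fun=> 0)); first exact: cvg_cst.
  by apply/funext => t; rewrite big_nil.
rewrite big_cons (_ : (fun t => _) = (fun t => f i t + \sum_(j <- s) f j t)).
  exact: cvg_complexD (fl i) ih.
by apply/funext => t; rewrite big_cons.
Qed.

End complex_limits.

(** Completeness, for sequences which for every [e] are eventually within [e]
    of a number depending on [e]: limits of approximations are not needed to
    know that the limit exists. *)
Lemma approx_cvg (u : nat -> R[i]) :
  (forall e, 0 < e -> exists l, \forall n \near \oo, N (u n - l) < e) ->
  cvg (u @ \oo).
Proof.
move=> H.
have part (g : R[i] -> R) : (forall x y, `|g x - g y| <= N (x - y)) ->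
    cvg (g \o u @ \oo).
  move=> gle; apply/cauchy_cvgP/cauchy_exP => e e0.
  have [l lu] := H e e0; exists (g l).
  by apply: filterS lu => n; rewrite /ball /= distrC; exact: le_lt_trans.
have /part/cvg_ex[a /cvgrPdist_lt ua] : forall x y : R[i],
    `|complex.Re x - complex.Re y| <= N (x - y).
  by move=> [a b] [c d]; exact: (normc_Re ((a +i* b) - (c +i* d))).
have /part/cvg_ex[b /cvgrPdist_lt ub] : forall x y : R[i],
    `|complex.Im x - complex.Im y| <= N (x - y).
  by move=> [a' b] [c d]; exact: (normc_Im ((a' +i* b) - (c +i* d))).
apply/cvg_ex; exists (a +i* b); apply/cvg_normcP => e e0.
have e2 : 0 < e / 2 by rewrite divr_gt0.
near=> n; apply: le_lt_trans (normc_le_ReIm _) _.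
rewrite (splitr e) ltrD//.
  have : `|a - complex.Re (u n)| < e / 2 by near: n; exact: ua.
  by rewrite distrC /=; case: (u n).
have : `|b - complex.Im (u n)| < e / 2 by near: n; exact: ub.
by rewrite distrC /=; case: (u n).
Unshelve. all: by end_near. Qed.

(** Complex differentiability as the expansion [f w = f z + l (w - z) + o(w - z)]
    with a real error term, which avoids division by [w - z]. *)
Definition cderiv (f : R[i] -> R[i]) z l := forall e, 0 < e ->
  exists2 d, 0 < d & forall w, N (w - z) < d ->
    N (f w - f z - l * (w - z)) <= e * N (w - z).

Lemma cderivP (f : R[i] -> R[i]) z l :
  cderiv f z l <-> ((fun h => h^-1 *: (f (h + z) - f z)) @ 0^' --> l).
Proof.
have E h : h != 0 ->
    N (h^-1 *: (f (h + z) - f z) - l) = N (f (h + z) - f z - l * h) / N h.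
  move=> h0; rewrite -Normc.normcV -Normc.normcM /GRing.scale /=.
  by congr N; rewrite mulrBl mulrC mulfK.
split=> [H|/cvg_normcP H].
  apply/cvg_normcP => e e0.
  have [d d0 dH] := H (e / 2) (divr_gt0 e0 (ltr0Sn _ 1)).
  apply/near_normcP; exists d => // h; rewrite subr0 => hd h0.
  rewrite E// ltr_pdivrMr ?normc_gt0//.
  have := dH (h + z); rewrite addrK => /(_ hd) /le_lt_trans; apply.
  by rewrite ltr_pM2r ?normc_gt0// ltr_pdivrMr// ltr_pMr// ltr1n.
move=> e /H/near_normcP[d d0 dH]; exists d => // w wd.
have [->|wz] := eqVneq w z.
  by rewrite !subrr mulr0 subr0 Normc.normc0 mulr0.
have := dH (w - z); rewrite subr0 subr_eq0 => /(_ wd wz).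
by rewrite E ?subr_eq0// subrK ltr_pdivrMr ?normc_gt0 ?subr_eq0// => /ltW.
Qed.

Lemma derivable_cderiv (f : R[i] -> R[i]) z :
  derivable f z 1 -> cderiv f z (f^`()%classic z).
Proof.
move=> df; apply/cderivP.
have E : (fun h => h^-1 *: (f (h + z) - f z)) =
         (fun h => h^-1 *: ((f \o shift z) (h *: (1 : R[i]^o)) - f z)).
  by apply/funext => h /=; rewrite /GRing.scale /= mulr1.
by rewrite /derive1 E.
Qed.

Lemma cderiv_derivable (f : R[i] -> R[i]) z l :
  cderiv f z l -> derivable f z 1 /\ f^`()%classic z = l.
Proof.
move=> /cderivP fl; split; last exact: cvg_lim.
have E : (fun h => h^-1 *: (f (h + z) - f z)) =
         (fun h => h^-1 *: ((f \o shift z) (h *: (1 : R[i]^o)) - f z)).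
  by apply/funext => h /=; rewrite /GRing.scale /= mulr1.
by rewrite /derivable -E; apply/cvg_ex; exists l.
Qed.

Lemma cderiv_continuous (f : R[i] -> R[i]) z l :
  cderiv f z l -> {for z, continuous f}.
Proof.
move=> /cderiv_derivable[/derivable1_diffP fz _].
exact: differentiable_continuous.
Qed.

Lemma cderiv_eq (f g : R[i] -> R[i]) z l :
  (\forall w \near z, f w = g w) -> cderiv f z l -> cderiv g z l.
Proof.
move=> fg H e /H[d d0 dH].
have gz : f z = g z by exact: nbhs_singleton fg.
have /near_normcP[d' d'0 d'H] := fg.
exists (Order.min d d'); first by rewrite lt_min d0.
by move=> w; rewrite lt_min => /andP[w1 w2]; rewrite -gz -d'H//; exact: dH.
Qed.

Lemma cderiv_cst k z : cderiv (fun=> k) z 0.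
Proof.
move=> e e0; exists 1 => // w _.
by rewrite subrr mul0r subr0 Normc.normc0 mulr_ge0 ?normc_ge0 ?ltW.
Qed.

Lemma cderiv_id z : cderiv id z 1.
Proof.
move=> e e0; exists 1 => // w _.
by rewrite mul1r subrr Normc.normc0 mulr_ge0 ?normc_ge0 ?ltW.
Qed.

Lemma cderivD (f g : R[i] -> R[i]) z l m :
  cderiv f z l -> cderiv g z m -> cderiv (fun w => f w + g w) z (l + m).
Proof.
move=> fl gm e e0; have e2 : 0 < e / 2 by rewrite divr_gt0.
have [d1 d10 d1P] := fl _ e2; have [d2 d20 d2P] := gm _ e2.
exists (Order.min d1 d2); first by rewrite lt_min d10.
move=> w; rewrite lt_min => /andP[/d1P h1 /d2P h2].
have -> : f w + g w - (f z + g z) - (l + m) * (w - z) =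
  (f w - f z - l * (w - z)) + (g w - g z - m * (w - z)) by ring.
rewrite (splitr e) mulrDl.
exact: le_trans (normc_triangle _ _) (lerD h1 h2).
Qed.

Lemma cderivM (f g : R[i] -> R[i]) z l m :
  cderiv f z l -> cderiv g z m ->
  cderiv (fun w => f w * g w) z (l * g z + f z * m).
Proof.
move=> fl gm e e0; pose K := N (g z) + 1 + N l + N (f z).
have K0 : 0 < K by rewrite /K ltr_wpDr ?normc_ge0// ltr_wpDr ?normc_ge0// ltr_wpDl ?normc_ge0.
have [e' [e'0 e'1 e'K]] : exists e', [/\ 0 < e', e' <= 1 & e' * K <= e].
  exists (Order.min 1 (e / K)).
  rewrite lt_min ltr01 divr_gt0// ge_min lexx; split => //.
  by rewrite -ler_pdivlMr// ge_min lexx orbT.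
have [d1 d10 d1P] := fl _ e'0; have [d2 d20 d2P] := gm _ e'0.
have [d3 d30 d3P] := (continuous_normcP _ _).1 (cderiv_continuous gm) _ e'0.
exists (Order.min d1 (Order.min d2 d3)); first by rewrite !lt_min d10 d20.
move=> w; rewrite !lt_min => /and3P[/d1P h1 /d2P h2 /d3P h3].
have -> : f w * g w - f z * g z - (l * g z + f z * m) * (w - z) =
    (f w - f z - l * (w - z)) * g w + l * (w - z) * (g w - g z) +
    f z * (g w - g z - m * (w - z)) by ring.
have gw : N (g w) <= N (g z) + 1.
  rewrite -(subrK (g z) (g w)) addrC; apply: le_trans (normc_triangle _ _) _.
  by rewrite lerD2l (le_trans (ltW h3)).
have wz0 : 0 <= N (w - z) by exact: normc_ge0.
apply: (@le_trans _ _ (e' * K * N (w - z))); last exact: ler_wpM2r.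
have -> : e' * K * N (w - z) = e' * N (w - z) * (N (g z) + 1) +
    N l * N (w - z) * e' + N (f z) * (e' * N (w - z)) by rewrite /K; ring.
apply: le_trans (normc_triangle _ _) _; apply: lerD.
  apply: le_trans (normc_triangle _ _) _; apply: lerD; rewrite !Normc.normcM.
    by apply: ler_pM; rewrite ?normc_ge0.
  by rewrite ler_wpM2l ?mulr_ge0 ?normc_ge0// ltW.
by rewrite Normc.normcM ler_wpM2l ?normc_ge0.
Qed.

Lemma cderiv_inv_sub a z : z != a -> exists l, cderiv (fun w => (w - a)^-1) z l.
Proof.
move=> za; have za0 : z - a != 0 by rewrite subr_eq0.
have nza : 0 < N (z - a) by rewrite normc_gt0.
exists (- (z - a) ^- 2) => e e0.
exists (Order.min (N (z - a) / 2) (e * (N (z - a) ^+ 3 / 2))).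
  by rewrite lt_min !divr_gt0 ?mulr_gt0 ?divr_gt0 ?exprn_gt0.
move=> w; rewrite lt_min => /andP[h1 h2].
have nwa : N (z - a) / 2 <= N (w - a).
  by have := normc_triangleBr z a w; rewrite (normcB z w); lra.
have nwa0 : 0 < N (w - a) by rewrite (lt_le_trans _ nwa)// divr_gt0.
have wa0 : w - a != 0 by rewrite -normc_gt0.
have -> : (w - a)^-1 - (z - a)^-1 - - (z - a) ^- 2 * (w - z) =
   (w - z) * ((w - z) / ((w - a) * (z - a) ^+ 2)).
  by field; rewrite wa0 za0.
rewrite Normc.normcM mulrC ler_wpM2r ?normc_ge0//.
rewrite Normc.normcM Normc.normcV Normc.normcM normcX.
rewrite ler_pdivrMr ?mulr_gt0 ?exprn_gt0//; apply: (le_trans (ltW h2)).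
rewrite ler_pM2l// exprS mulrAC ler_wpM2r ?exprn_ge0 ?normc_ge0//.
Qed.

End modulus.

(** * Midpoint sums and Goursat's theorem *)

Lemma near_mul_expr_lt (R : realType) (L q r : R) : 0 <= q < 1 -> 0 < r ->
  \forall k \near \oo, L * q ^+ k < r.
Proof.
move=> /andP[q0 q1] r0.
have : (fun k => L * q ^+ k) @ \oo --> L * 0.
  by apply: cvgMl_tmp; apply: cvg_expr; rewrite ger0_norm.
by rewrite mulr0 => /cvgr_lt; exact.
Qed.

Section midpoint_means.
Variable R : realType.
Implicit Types (f g : R -> R[i]) (a b c x y : R) (n : nat).

(** The midpoint rule with [2 ^ n] equal subintervals, normalised by the length
    of the interval.  The recursion makes it exactly additive under bisection. *)
Fixpoint midmean n f a b : R[i] :=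
  if n is n'.+1 then
    (midmean n' f a ((a + b) / 2) + midmean n' f ((a + b) / 2) b) / 2
  else f ((a + b) / 2).

Let mid_le a b : a <= b -> a <= (a + b) / 2 <= b.
Proof. by move=> ab; apply/andP; split; lra. Qed.

Lemma eq_midmean n f g a b : a <= b ->
  (forall x, a <= x <= b -> f x = g x) -> midmean n f a b = midmean n g a b.
Proof.
elim: n a b => [|n ih] a b ab fg /=; first exact/fg/mid_le.
have /andP[h1 h2] := mid_le ab.
by rewrite !ih// => x /andP[x1 x2]; apply: fg; apply/andP; split; lra.
Qed.

Lemma midmeanZ n (k : R[i]) f a b :
  midmean n (fun x => k * f x) a b = k * midmean n f a b.
Proof. by elim: n a b => [|n ih] a b //=; rewrite !ih; ring. Qed.

Lemma midmeanB n f g a b :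
  midmean n (fun x => f x - g x) a b = midmean n f a b - midmean n g a b.
Proof. by elim: n a b => [|n ih] a b //=; rewrite !ih; ring. Qed.

Lemma midmean_sum n I (s : seq I) (F : I -> R -> R[i]) a b :
  midmean n (fun x => \sum_(i <- s) F i x) a b =
  \sum_(i <- s) midmean n (F i) a b.
Proof.
elim: n a b => [|n ih] a b //=.
by rewrite !ih -big_split/= mulr_suml.
Qed.

Lemma midmean_cst n (k : R[i]) a b : midmean n (fun=> k) a b = k.
Proof. by elim: n a b => [|n ih] a b //=; rewrite !ih; field. Qed.

Lemma midmean_affine n (k l : R[i]) a b :
  midmean n (fun x => k + l * x%:C) a b = k + l * ((a + b) / 2)%:C.
Proof.
elim: n a b => [|n ih] a b //=; rewrite !ih.
pose m := (a + b) / 2; pose h := (b - a) / 4.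
have -> : (a + (a + b) / 2) / 2 = m - h by rewrite /m /h; lra.
have -> : ((a + b) / 2 + b) / 2 = m + h by rewrite /m /h; lra.
by rewrite (rmorphB _ m h) (rmorphD _ m h) -/m /=; field.
Qed.

Lemma midmean_le n f a b M : a <= b ->
  (forall x, a <= x <= b -> N (f x) <= M) -> N (midmean n f a b) <= M.
Proof.
elim: n a b => [|n ih] a b ab fM /=; first exact/fM/mid_le.
have /andP[h1 h2] := mid_le ab.
rewrite Normc.normcM Normc.normcV normc_nat ler_pdivrMr//.
apply: le_trans (normc_triangle _ _) _.
have -> : M * 2 = M + M by ring.
by apply: lerD; apply: ih => // x /andP[x1 x2]; apply: fM; apply/andP; split; lra.
Qed.

Lemma midmean_comp_affine n f k c a b :
  midmean n (fun x => f (k * x + c)) a b = midmean n f (k * a + c) (k * b + c).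
Proof.
elim: n a b => [|n ih] a b /=; first by congr f; lra.
have -> : (k * a + c + (k * b + c)) / 2 = k * ((a + b) / 2) + c by lra.
by rewrite !ih.
Qed.

End midpoint_means.

Section goursat.
Variable R : realType.
Implicit Types (g : R[i] -> R[i]) (a b c d e : R) (n : nat).

(** The midpoint approximation of the integral of [g] along the boundary of
    the rectangle with opposite corners [a +i* c] and [b +i* d]. *)
Definition rect_sum g n a b c d : R[i] :=
  (b - a)%:C * (midmean n (fun x => g (x +i* c)) a b -
                midmean n (fun x => g (x +i* d)) a b) +
  'i * (d - c)%:C * (midmean n (fun y => g (b +i* y)) c d -
                     midmean n (fun y => g (a +i* y)) c d).

(** The terms along the two inner segments cancel. *)
Lemma rect_sum_split g n a b c d (p := (a + b) / 2) (q := (c + d) / 2) :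
  rect_sum g n.+1 a b c d = rect_sum g n a p c q + rect_sum g n p b c q +
    rect_sum g n a p q d + rect_sum g n p b q d.
Proof.
rewrite /rect_sum /= -/p -/q.
have -> : (p - a)%:C = (b - a)%:C / 2 :> R[i].
  by rewrite /p !rmorphB rmorphM rmorphD fmorphV rmorph_nat /=; field.
have -> : (b - p)%:C = (b - a)%:C / 2 :> R[i].
  by rewrite /p !rmorphB rmorphM rmorphD fmorphV rmorph_nat /=; field.
have -> : (q - c)%:C = (d - c)%:C / 2 :> R[i].
  by rewrite /q !rmorphB rmorphM rmorphD fmorphV rmorph_nat /=; field.
have -> : (d - q)%:C = (d - c)%:C / 2 :> R[i].
  by rewrite /q !rmorphB rmorphM rmorphD fmorphV rmorph_nat /=; field.
by field.
Qed.

Lemma rect_sumB g h n a b c d :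
  rect_sum (fun w => g w - h w) n a b c d =
  rect_sum g n a b c d - rect_sum h n a b c d.
Proof. by rewrite /rect_sum !midmeanB; ring. Qed.

Lemma rect_sum_affine (k l : R[i]) n a b c d :
  rect_sum (fun w => k + l * w) n a b c d = 0.
Proof.
have cE (x y : R) : x +i* y = x%:C + 'i * y%:C by simpc.
have hor (y u v : R) : midmean n (fun x => k + l * (x +i* y)) u v =
    k + l * ('i * y%:C) + l * ((u + v) / 2)%:C.
  rewrite -(midmean_affine n); congr midmean; apply/funext => x.
  by rewrite cE; ring.
have ver (x u v : R) : midmean n (fun y => k + l * (x +i* y)) u v =
    k + l * x%:C + (l * 'i) * ((u + v) / 2)%:C.
  rewrite -(midmean_affine n); congr midmean; apply/funext => y.
  by rewrite cE; ring.
rewrite /rect_sum !hor !ver !rmorphM !rmorphB !rmorphD !fmorphV !rmorph_nat /=.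
by field.
Qed.

Lemma rect_sum_le g n a b c d M : a <= b -> c <= d ->
  (forall x y, a <= x <= b -> c <= y <= d -> N (g (x +i* y)) <= M) ->
  N (rect_sum g n a b c d) <= 2 * M * ((b - a) + (d - c)).
Proof.
move=> ab cd gM.
have aa : a <= a <= b by rewrite lexx ab.
have bb : a <= b <= b by rewrite lexx ab.
have cc : c <= c <= d by rewrite lexx cd.
have dd : c <= d <= d by rewrite lexx cd.
apply: le_trans (normc_triangle _ _) _.
rewrite !Normc.normcM normc_i mul1r !normc_real !ger0_norm ?subr_ge0//.
have -> : 2 * M * (b - a + (d - c)) = (b - a) * (M + M) + (d - c) * (M + M).
  by ring.
apply: lerD; apply: ler_wpM2l; rewrite ?subr_ge0//;
  apply: le_trans (normc_triangleB _ _) _; apply: lerD;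
  by apply: midmean_le => // z hz; apply: gM.
Qed.

Definition subrect (q : (R * R) * (R * R)) (s : bool * bool) :=
  let: ((a, b), (c, d)) := q in
  let p := (a + b) / 2 in let r := (c + d) / 2 in
  ((if s.1 then (p, b) else (a, p)), (if s.2 then (r, d) else (c, r))).

(** Failure of convergence to [0], with [e] recorded because it has to be
    divided by [4] at each quartering. *)
Let big_rect g e (q : (R * R) * (R * R)) := forall n0, exists2 n, (n0 <= n)%N &
  e <= N (rect_sum g n q.1.1 q.1.2 q.2.1 q.2.2).

(** Pigeonhole: the four quarters add up to the rectangle. *)
Lemma big_rect_split g q e : big_rect g e q ->
  exists s, big_rect g (e / 4) (subrect q s).
Proof.
case: q => [[a b] [c d]] H; apply: contrapT => /forallNP H'.
have {}H' s : exists n0, forall n, (n0 <= n)%N ->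
    let: ((a', b'), (c', d')) := subrect ((a, b), (c, d)) s in
    N (rect_sum g n a' b' c' d') < e / 4.
  have /existsNP[n0 n0P] := H' s; exists n0 => n n0n.
  move: n0P; case: subrect => [[a' b'] [c' d']] /= n0P.
  by rewrite ltNge; apply/negP => h; apply: n0P; exists n.
have [n1 h1] := H' (false, false); have [n2 h2] := H' (true, false).
have [n3 h3] := H' (false, true); have [n4 h4] := H' (true, true).
have [[//|n] nn] := H (maxn (maxn n1 n2) (maxn n3 n4)).+1.
rewrite leqNgt in nn * => /=; rewrite -leqNgt ltnS !geq_max in nn.
move: nn => /andP[/andP[/h1 /= {}h1 /h2 /= {}h2] /andP[/h3 /= {}h3 /h4 /= {}h4]].
rewrite /= rect_sum_split leNgt => /negP; apply.
have -> : e = e / 4 + e / 4 + e / 4 + e / 4 by lra.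
by do 3 (apply: le_lt_trans (normc_triangle _ _) _; apply: ltrD => //).
Qed.

(** Goursat's theorem for midpoint sums.  No integral is needed: the sums are
    exactly additive under quartering and exactly zero on affine functions,
    which is all that the classical bisection argument uses. *)
Lemma goursat g a b c d : a <= b -> c <= d ->
  (forall x y, a <= x <= b -> c <= y <= d -> exists l, cderiv g (x +i* y) l) ->
  (fun n => rect_sum g n a b c d) @ \oo --> (0 : R[i]).
Proof.
move=> ab cd gD; apply/cvg_normcP => e e0.
apply: contrapT => Hn.
have B0 : big_rect g e ((a, b), (c, d)).
  move=> n0; apply: contrapT => /forall2NP H; apply: Hn; exists n0 => // n /= n0n.
  by rewrite subr0 ltNge; have [/(_ n0n)//|/negP] := H n.
(* [F] chooses the quarter to keep; [st k] is the rectangle after [k] steps,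
   paired with the lower bound on its sums. *)
have /choice[F FP] : forall x : ((R * R) * (R * R)) * R, exists s,
    big_rect g x.2 x.1 -> big_rect g (x.2 / 4) (subrect x.1 s).
  move=> [q e']; have [/big_rect_split[s hs]|nb] := pselect (big_rect g e' q).
    by exists s.
  by exists (true, true) => /nb.
pose st k := iter k (fun x : ((R * R) * (R * R)) * R => (subrect x.1 (F x), x.2 / 4))
  (((a, b), (c, d)), e).
pose A k := (st k).1.1.1; pose B k := (st k).1.1.2.
pose C k := (st k).1.2.1; pose D k := (st k).1.2.2.
have big k : (st k).2 = e / 4 ^+ k /\ big_rect g (e / 4 ^+ k) (st k).1.
  elim: k => [|k [ih1 ih2]]; first by rewrite expr0 divr1.
  have E : (st k).2 / 4 = e / 4 ^+ k.+1.
    by rewrite ih1 exprSr invfM mulrA.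
  split; first by rewrite -E.
  by rewrite -E; apply: (FP (st k)); rewrite ih1.
have step k : [/\ A k <= A k.+1, B k.+1 <= B k, C k <= C k.+1 & D k.+1 <= D k] /\
    [/\ B k - A k = (b - a) / 2 ^+ k, D k - C k = (d - c) / 2 ^+ k &
        B k.+1 - A k.+1 = (b - a) / 2 ^+ k.+1].
  have len j : B j - A j = (b - a) / 2 ^+ j /\ D j - C j = (d - c) / 2 ^+ j.
    elim: j => [|j]; first by rewrite !expr0 !divr1.
    rewrite /A /B /C /D /= -/(st j).
    case: (st j) => [[[a' b'] [c' d']] e'] /=.
    move=> [h1 h2]; rewrite !exprSr !invfM !mulrA -h1 -h2.
    by case: (F _) => [[] []] /=; split; lra.
  have [h1 h2] := len k; have [h3 _] := len k.+1; split => //.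
  have : A k <= B k.
    by rewrite -subr_ge0 h1 mulr_ge0 ?subr_ge0// invr_ge0 exprn_ge0.
  have : C k <= D k.
    by rewrite -subr_ge0 h2 mulr_ge0 ?subr_ge0// invr_ge0 exprn_ge0.
  rewrite /A /B /C /D /= -/(st k) {h1 h2 h3}.
  case: (st k) => [[[a' b'] [c' d']] e'] /= cd' ab'.
  by case: (F _) => [[] []] /=; split; lra.
have ord k : A k <= B k /\ C k <= D k.
  have [_ [h1 h2 _]] := step k.
  rewrite -subr_ge0 h1 -(subr_ge0 (C k)) h2.
  by split; rewrite mulr_ge0 ?subr_ge0// invr_ge0 exprn_ge0.
have mono (u : nat -> R) : (forall k, u k <= u k.+1) ->
    forall k m, (k <= m)%N -> u k <= u m.
  by move=> h k m; exact: (homo_leq (fun x => lexx x) (fun y x z => @le_trans _ _ y x z) h).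
have nest (u v : nat -> R) : (forall k, u k <= u k.+1) ->
    (forall k, v k.+1 <= v k) -> (forall k, u k <= v k) ->
    exists x, forall k, u k <= x <= v k.
  move=> hu hv uv.
  have uvkm k m : u k <= v m.
    have h1 := mono u hu k (maxn k m) (leq_maxl _ _).
    have hv' i : - v i <= - v i.+1 by rewrite lerN2.
    have := mono (fun i => - v i) hv' m (maxn k m) (leq_maxr _ _).
    rewrite /= lerN2; apply: le_trans; exact: le_trans h1 (uv _).
  have hs : has_sup (range u).
    by split; [exists (u 0%N); exists 0%N|exists (v 0%N) => _ [k _ <-]].
  exists (sup (range u)) => k; apply/andP; split.
    by apply: sup_upper_bound => //; exists k.
  by apply: ge_sup; [exists (u 0%N); exists 0%N|move=> _ [m _ <-]].
have [x xAB] := nest A B (fun k => let: conj (And4 h _ _ _) _ := step k in h)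
  (fun k => let: conj (And4 _ h _ _) _ := step k in h) (fun k => (ord k).1).
have [y yCD] := nest C D (fun k => let: conj (And4 _ _ h _) _ := step k in h)
  (fun k => let: conj (And4 _ _ _ h) _ := step k in h) (fun k => (ord k).2).
have [l gl] : exists l, cderiv g (x +i* y) l by apply: gD; [exact: xAB 0%N|exact: yCD 0%N].
pose L := (b - a) + (d - c) + 1.
have L0 : 0 < L by rewrite /L; move: ab cd; rewrite -subr_ge0 -(subr_ge0 c); lra.
have eta0 : 0 < e / (4 * L ^+ 2) by rewrite divr_gt0// mulr_gt0// exprn_gt0.
have [r r0 rP] := gl _ eta0.
have [k kr] : exists k, L / 2 ^+ k < r.
  have h2 : 0 <= (2^-1 : R) < 1 by rewrite invr_ge0 invf_lt1 ?ltr1n ?ler0n.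
  have [k _ kP] := near_mul_expr_lt L h2 r0.
  by exists k; rewrite -exprVn; exact: (kP k (leqnn k)).
have [_ [hB hD _]] := step k.
have [_ /(_ 0%N)[n _]] := big k.
rewrite -/(A k) -/(B k) -/(C k) -/(D k) => h.
have pk : 0 < 2 ^+ k :> R by rewrite exprn_gt0.
have : N (rect_sum g n (A k) (B k) (C k) (D k)) <=
    2 * (e / (4 * L ^+ 2) * (L / 2 ^+ k)) * ((B k - A k) + (D k - C k)).
  rewrite -(subr0 (rect_sum _ _ _ _ _ _)).
  rewrite -(rect_sum_affine (g (x +i* y) - l * (x +i* y)) l n (A k) (B k) (C k) (D k)).
  rewrite -rect_sumB; apply: rect_sum_le; [exact: (ord k).1|exact: (ord k).2|].
  move=> x' y' hx' hy'.
  have dist : N ((x' +i* y') - (x +i* y)) <= L / 2 ^+ k.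
    apply: le_trans (normc_le_ReIm _) _ => /=.
    have : `|x' - x| <= B k - A k.
      by rewrite ler_norml; have := xAB k; move: hx' => /andP[? ?] /andP[? ?]; apply/andP; split; lra.
    have : `|y' - y| <= D k - C k.
      by rewrite ler_norml; have := yCD k; move: hy' => /andP[? ?] /andP[? ?]; apply/andP; split; lra.
    rewrite hB hD /L !mulrDl mul1r; have : 0 < (2 ^+ k : R)^-1 by rewrite invr_gt0.
    by lra.
  have -> : g (x' +i* y') - (g (x +i* y) - l * (x +i* y) + l * (x' +i* y')) =
      g (x' +i* y') - g (x +i* y) - l * ((x' +i* y') - (x +i* y)) by ring.
  apply: le_trans (rP _ (le_lt_trans dist kr)) _.
  by rewrite ler_pM2l.
apply/negP; rewrite -ltNge; apply: lt_le_trans h.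
rewrite hB hD -mulrDl.
have -> : (4 : R) ^+ k = 2 ^+ k * 2 ^+ k by rewrite -exprMn; congr (_ ^+ _); ring.
have -> : 2 * (e / (4 * L ^+ 2) * (L / 2 ^+ k)) * ((b - a + (d - c)) / 2 ^+ k) =
    e / (2 ^+ k * 2 ^+ k) * ((L - 1) / (2 * L)).
  by rewrite /L; field; rewrite !gt_eqF.
rewrite -[ltRHS]mulr1 ltr_pM2l ?divr_gt0 ?mulr_gt0// ltr_pdivrMr ?mulr_gt0//.
by rewrite mul1r; lra.
Qed.

End goursat.

(** * Means over circles *)

Section circle.
Variable R : realType.
Implicit Types (f g h : R[i] -> R[i]) (t r : R) (w z u : R[i]) (n : nat).

Lemma expiD (s t : R) : expi (s + t) = expi s * expi t.
Proof.
by apply/eqP; rewrite eq_complex /= cosD sinD eqxx addrC eqxx.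
Qed.

Lemma expi0 : expi 0 = 1 :> R[i].
Proof. by rewrite /expi cos0 sin0. Qed.

Lemma expiDpi t : expi (t + pi) = - expi t.
Proof. by rewrite /expi cosDpi sinDpi; simpc. Qed.

Lemma expiD2pi t : expi (t + 2 * pi) = expi t.
Proof.
have -> : 2 * pi = pi + pi :> R by ring.
by rewrite addrA !expiDpi opprK.
Qed.

Lemma normc_expi t : N (expi t) = 1.
Proof. by rewrite /expi /N /= cos2Dsin2 sqrtr1. Qed.

Lemma expi_neq0 t : expi t != 0.
Proof. by rewrite -normc_gt0 normc_expi. Qed.

Lemma continuous_expi : continuous (@expi R).
Proof.
move=> t; apply: (@continuous_comp _ _ _ (fun t => (cos t, sin t)) (@complex_of R)).
  exact: (cvg_pair (@continuous_cos R t) (@continuous_sin R t)).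
exact: continuous_complex_of.
Qed.

Lemma is_derive_expand (F : R -> R) x l : is_derive x (1 : R) F l ->
  forall e, 0 < e -> exists2 d, 0 < d &
    forall y, `|y - x| < d -> `|F y - F x - l * (y - x)| <= e * `|y - x|.
Proof.
move=> [dF lF] e e0.
have : (fun k => k^-1 *: (F (k + x) - F x)) @ 0^' --> l.
  rewrite -lF /derive; set G := (fun k => _ *: (_ - _)); set G' := (fun k => _ *: (_ - _)).
  suff -> : G = G' by exact: dF.
  by apply/funext => y; rewrite /G /G' /= scaler1.
move=> /cvgrPdist_lt/(_ e e0)/nbhs_ballP[d /= d0 dP]; exists d => // y yd.
have [->|yx] := eqVneq y x; first by rewrite !subrr mulr0 subr0 normr0 mulr0.
have := dP (y - x); rewrite /ball /= sub0r normrN => /(_ yd).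
rewrite subr_eq0 subrK => /(_ yx) h.
have -> : F y - F x - l * (y - x) =
    - ((l - (y - x)^-1 *: (F y - F x)) * (y - x)).
  by rewrite /GRing.scale /=; field; rewrite subr_eq0.
by rewrite normrN normrM ler_pM2r ?normr_gt0 ?subr_eq0// ltW.
Qed.

Definition cexp w : R[i] := (expR (complex.Re w))%:C * expi (complex.Im w).

Lemma cexpD w z : cexp (w + z) = cexp w * cexp z.
Proof.
case: w z => [a b] [c d]; rewrite /cexp /= expRD expiD rmorphM /=; ring.
Qed.

Lemma normc_cexp w : N (cexp w) = expR (complex.Re w).
Proof. by rewrite /cexp Normc.normcM normc_expi mulr1 normc_real ger0_norm ?expR_ge0. Qed.

Lemma cderiv_cexp w : cderiv cexp w (cexp w).
Proof.
suff cexp0 : forall e, 0 < e -> exists2 d, 0 < d & forall k, N k < d ->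
    N (cexp k - 1 - k) <= e * N k.
  move=> e e0; have p : 0 < N (cexp w) by rewrite normc_cexp expR_gt0.
  have [d d0 dP] := cexp0 _ (divr_gt0 e0 p); exists d => // z /dP h.
  rewrite -{1}(subrK w z) cexpD.
  have -> : cexp (z - w) * cexp w - cexp w - cexp w * (z - w) =
      cexp w * (cexp (z - w) - 1 - (z - w)) by ring.
  by rewrite Normc.normcM mulrC -ler_pdivlMr// mulrAC.
move=> e e0; have [e' [e'0 e'1 e'8]] : exists e', [/\ 0 < e', e' <= 1 & e' <= e / 16].
  by exists (Order.min (e / 16) 1); rewrite lt_min !ge_min !lexx orbT divr_gt0 /=.
have [d1 d10 d1P] := is_derive_expand (is_derive_expR (0 : R)) e'0.
have [d2 d20 d2P] := is_derive_expand (is_derive_cos (0 : R)) e'0.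
have [d3 d30 d3P] := is_derive_expand (is_derive_sin (0 : R)) e'0.
exists (Order.min e' (Order.min d1 (Order.min d2 d3))).
  by rewrite !lt_min e'0 d10 d20 d30.
move=> [x y]; rewrite !lt_min => /and4P[he' h1 h2 h3].
have hx : `|x| <= N (x +i* y) := normc_Re (x +i* y).
have hy : `|y| <= N (x +i* y) := normc_Im (x +i* y).
have M0 := normc_ge0 (x +i* y).
move: hx hy he' h1 h2 h3 M0; move: (N (x +i* y)) => M hx hy he' h1 h2 h3 M0.
have := d1P x; rewrite !subr0 => /(_ (le_lt_trans hx h1)).
have := d2P y; rewrite !subr0 => /(_ (le_lt_trans hy h2)).
have := d3P y; rewrite !subr0 => /(_ (le_lt_trans hy h3)).
rewrite cos0 sin0 expR0 oppr0 mul0r mul1r oppr0 !addr0 mul1r => s c p.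
have dbl a b : `|a| <= b -> b <= e' * M -> `|a| <= e' * M by exact: le_trans.
have {}s : `|sin y - y| <= e' * M by apply: dbl s _; rewrite ler_pM2l.
have {}c : `|cos y - 1| <= e' * M by apply: dbl c _; rewrite ler_pM2l.
have {}p : `|expR x - 1 - x| <= e' * M by apply: dbl p _; rewrite ler_pM2l.
have e'M : e' * M <= M by rewrite ler_piMl.
have p1 : `|expR x - 1| <= 2 * M.
  rewrite -(subrK x (expR x - 1)); apply: le_trans (ler_normD _ _) _; lra.
have p2 : `|expR x| <= 3.
  rewrite -(subrK 1 (expR x)); apply: le_trans (ler_normD _ _) _; rewrite normr1; lra.
apply: le_trans (normc_le_ReIm _) _; rewrite /cexp /expi /=.
rewrite !mul0r subr0 addr0 oppr0.
have -> : expR x * cos y - 1 - x = expR x * (cos y - 1) + (expR x - 1 - x) by ring.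
have -> : expR x * sin y + 0 - y = expR x * (sin y - y) + (expR x - 1) * y by ring.
have q1 : `|expR x * (cos y - 1)| <= 3 * (e' * M).
  by rewrite normrM; apply: ler_pM.
have q2 : `|expR x * (sin y - y)| <= 3 * (e' * M).
  by rewrite normrM; apply: ler_pM.
have q3 : `|(expR x - 1) * y| <= 2 * M * e'.
  rewrite normrM; apply: ler_pM => //; apply: ltW; exact: le_lt_trans hy he'.
apply: le_trans (lerD (ler_normD _ _) (ler_normD _ _)) _.
apply: le_trans (lerD (lerD q1 p) (lerD q2 q3)) _.
have -> : 3 * (e' * M) + e' * M + (3 * (e' * M) + 2 * M * e') = 9 * e' * M by ring.
by rewrite ler_wpM2r//; move: e'8 e0; lra.
Qed.

Lemma cderiv_comp f g z l m :
  cderiv g z l -> cderiv f (g z) m -> cderiv (f \o g) z (m * l).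
Proof.
move=> gl fm e e0.
have K0 : 0 < N l + 1 + N m by rewrite ltr_wpDr ?normc_ge0// ltr_wpDl ?normc_ge0.
have [e' [e'0 e'1 e'e]] : exists e', [/\ 0 < e', e' <= 1 & e' <= e / (N l + 1 + N m)].
  exists (Order.min 1 (e / (N l + 1 + N m))).
  by rewrite lt_min !ge_min !lexx orbT ltr01 divr_gt0.
have [d1 d10 d1P] := gl _ e'0; have [d2 d20 d2P] := fm _ e'0.
have [d3 d30 d3P] := (continuous_normcP _ _).1 (cderiv_continuous gl) _ d20.
exists (Order.min d1 d3); first by rewrite lt_min d10.
move=> w; rewrite lt_min => /andP[/d1P h1 /d3P/d2P h2] /=.
have -> : f (g w) - f (g z) - m * l * (w - z) =
    (f (g w) - f (g z) - m * (g w - g z)) + m * (g w - g z - l * (w - z)) by ring.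
apply: le_trans (normc_triangle _ _) _; rewrite Normc.normcM.
have h3 : N (g w - g z) <= (N l + 1) * N (w - z).
  rewrite -(subrK (l * (w - z)) (g w - g z)).
  apply: le_trans (normc_triangle _ _) _; rewrite Normc.normcM mulrDl addrC lerD2l.
  by apply: le_trans h1 _; rewrite ler_wpM2r ?normc_ge0.
apply: (@le_trans _ _ (e' * ((N l + 1 + N m) * N (w - z)))).
  rewrite (mulrDl (N l + 1)) (mulrDr e'); apply: lerD; first by apply: le_trans h2 _; rewrite ler_pM2l.
  by rewrite mulrCA ler_wpM2l ?normc_ge0.
by rewrite mulrA ler_wpM2r ?normc_ge0// -ler_pdivlMr.
Qed.

(** [w * expi t] runs once through the circle of radius [N w]. *)
Definition circle_mean n h w := midmean n (fun t => h (w * expi t)) 0 (2 * pi).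

Let pi2_ge0 : 0 <= 2 * pi :> R. Proof. by rewrite mulr_ge0 ?pi_ge0. Qed.

Lemma normc_mul_expi w t : N (w * expi t) = N w.
Proof. by rewrite Normc.normcM normc_expi mulr1. Qed.

Lemma circle_mean_le n h w M :
  (forall t, 0 <= t <= 2 * pi -> N (h (w * expi t)) <= M) ->
  N (circle_mean n h w) <= M.
Proof. exact: midmean_le. Qed.

Lemma eq_circle_mean n h g w :
  (forall z, N z = N w -> h z = g z) -> circle_mean n h w = circle_mean n g w.
Proof.
move=> hg; apply: eq_midmean => // t _; apply: hg.
exact: normc_mul_expi.
Qed.

Lemma circle_meanB n h g w :
  circle_mean n (fun z => h z - g z) w = circle_mean n h w - circle_mean n g w.
Proof. exact: midmeanB. Qed.

Lemma circle_mean_cst n (k : R[i]) w : circle_mean n (fun=> k) w = k.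
Proof. exact: midmean_cst. Qed.

Lemma circle_meanZ n (k : R[i]) h w :
  circle_mean n (fun z => k * h z) w = k * circle_mean n h w.
Proof. exact: midmeanZ. Qed.

Lemma circle_mean_sum n I (s : seq I) (F : I -> R[i] -> R[i]) w :
  circle_mean n (fun z => \sum_(i <- s) F i z) w =
  \sum_(i <- s) circle_mean n (F i) w.
Proof. exact: midmean_sum. Qed.

Lemma circle_mean_rotate n h (k w : R[i]) :
  circle_mean n (fun z => h (k * z)) w = circle_mean n h (k * w).
Proof. by rewrite /circle_mean; congr midmean; apply/funext => t; rewrite mulrA. Qed.

(** [E] stands for [expi] or its inverse.  For odd [m] the two halves of the
    circle cancel; for even [m] the doubling formula reduces to [m / 2] on a
    rule with half as many points. *)
Lemma midmean_alternating (E : R -> R[i]) m n :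
  (forall t, E (t + pi) = - E t) -> (forall t, E (2 * t) = E t ^+ 2) ->
  (0 < m < 2 ^ n)%N -> midmean n (fun t => E t ^+ m) 0 (2 * pi) = 0.
Proof.
move=> Epi E2; elim: n m => [|n ih] m; first by rewrite expn0 ltnS leqn0; case: m.
move=> /andP[m0 mn] /=.
have -> : (0 + 2 * pi) / 2 = pi :> R by field.
have -> : midmean n (fun t => E t ^+ m) pi (2 * pi) =
    (-1) ^+ m * midmean n (fun t => E t ^+ m) 0 pi.
  rewrite -midmeanZ.
  have -> : (fun t => (-1) ^+ m * E t ^+ m) = (fun t => E (1 * t + pi) ^+ m).
    by apply/funext => t; rewrite mul1r Epi [RHS]exprNn.
  rewrite (midmean_comp_affine n (fun t => E t ^+ m)).
  by congr midmean; ring.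
have [mo|] := boolP (odd m); first by rewrite -signr_odd mo expr1 mulN1r subrr mul0r.
move=> me; rewrite -signr_odd (negbTE me) expr0 mul1r.
have mE : m = (2 * m./2)%N by rewrite mul2n even_halfK.
suff -> : midmean n (fun t => E t ^+ m) 0 pi = 0 by rewrite addr0 mul0r.
have -> : midmean n (fun t => E t ^+ m) 0 pi =
    midmean n (fun t => E (2 * t + 0) ^+ m./2) 0 pi.
  by congr midmean; apply/funext => t; rewrite addr0 E2 -exprM -mE.
rewrite (midmean_comp_affine n (fun t => E t ^+ m./2)) mulr0 !addr0.
apply: ih; apply/andP; split.
  by rewrite -(@ltn_pmul2l 2)// muln0 -mE.
by rewrite -(@ltn_pmul2l 2)// -mE -expnS.
Qed.

Lemma circle_mean_expr n m w : (0 < m < 2 ^ n)%N ->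
  circle_mean n (fun z => z ^+ m) w = 0.
Proof.
move=> mn; rewrite /circle_mean.
rewrite (_ : (fun t => _) = (fun t => w ^+ m * expi t ^+ m)); last first.
  by apply/funext => t; rewrite exprMn.
rewrite midmeanZ midmean_alternating ?mulr0//; first exact: expiDpi.
by move=> t; rewrite mulrDl !mul1r expiD expr2.
Qed.

Lemma circle_mean_exprV n m w : (0 < m < 2 ^ n)%N ->
  circle_mean n (fun z => z ^- m) w = 0.
Proof.
move=> mn; rewrite /circle_mean.
rewrite (_ : (fun t => _) = (fun t => w ^- m * (expi t)^-1 ^+ m)); last first.
  by apply/funext => t; rewrite exprMn invfM exprVn.
rewrite midmeanZ (@midmean_alternating (fun t => (expi t)^-1)) ?mulr0//.
  by move=> t; rewrite expiDpi invrN.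
by move=> t; rewrite mulrDl !mul1r expiD invfM expr2.
Qed.

End circle.

Section mean_value.
Variable R : realType.
Implicit Types (f g h : R[i] -> R[i]) (t r : R) (w z u : R[i]) (n : nat).

(** In the coordinate [log z] the annulus becomes a rectangle whose two
    horizontal sides carry the same values and cancel. *)
Lemma circle_mean_annulus h r1 r2 : 0 < r1 -> r1 <= r2 ->
  (forall z, r1 <= N z <= r2 -> derivable h z 1) ->
  (fun n => circle_mean n h r2%:C - circle_mean n h r1%:C) @ \oo --> (0 : R[i]).
Proof.
move=> r10 r12 dh.
have r20 : 0 < r2 by exact: lt_le_trans r12.
have lnr : ln r1 <= ln r2 by rewrite ler_ln.
have pi0 : 0 <= 2 * pi :> R by rewrite mulr_ge0 ?pi_ge0.
have G : (fun n => rect_sum (h \o @cexp R) n (ln r1) (ln r2) 0 (2 * pi))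
    @ \oo --> (0 : R[i]).
  apply: goursat => // x y /andP[x1 x2] _.
  have /dh/derivable_cderiv hz : r1 <= N (cexp (x +i* y)) <= r2.
    by rewrite normc_cexp /= -(lnK r10) -(lnK r20) !ler_expR x1.
  eexists; exact: (cderiv_comp (cderiv_cexp _) hz).
have pi2 : (2 * pi)%:C != 0 :> R[i].
  by rewrite -normc_gt0 normc_real ger0_norm// mulr_gt0 ?pi_gt0.
have i0 : 'i != 0 :> R[i] by rewrite -normc_gt0 normc_i.
have E n : circle_mean n h r2%:C - circle_mean n h r1%:C =
    ('i * (2 * pi)%:C)^-1 *
      rect_sum (h \o @cexp R) n (ln r1) (ln r2) 0 (2 * pi).
  rewrite /rect_sum /= subr0.
  have -> : (fun x => h (cexp (x +i* (2 * pi)))) = (fun x => h (cexp (x +i* 0))).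
    apply/funext => x; congr h; rewrite /cexp /=.
    by rewrite -[in LHS](add0r (2 * pi)) expiD2pi.
  rewrite subrr mulr0 add0r mulKf; last by rewrite mulf_neq0.
  by rewrite /circle_mean /cexp /= !lnK.
have -> : 0 = ('i * (2 * pi)%:C)^-1 * 0 :> R[i] by rewrite mulr0.
by rewrite (eq_cvg _ _ E); exact: cvg_complexZ.
Qed.

End mean_value.

Section cauchy.
Variable R : realType.
Implicit Types (f g h F : R[i] -> R[i]) (t r e : R) (a b w z u : R[i]) (n j : nat).

Let polar (p : R * R) : R[i] := p.2%:C * expi p.1.

Let continuous_polar : continuous polar.
Proof.
move=> [t r].
have -> : polar = @complex_of R \o (fun p => (p.2 * cos p.1, p.2 * sin p.1)).
  by apply/funext => -[s q]; rewrite /polar /complex_of /expi /=; simpc.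
apply: continuous_comp; last exact: continuous_complex_of.
have cos1 : (fun p : R * R => cos p.1) @ (t, r) --> cos t.
  by apply: (continuous_cvg _ (@continuous_cos R t)); exact: cvg_fst.
have sin1 : (fun p : R * R => sin p.1) @ (t, r) --> sin t.
  by apply: (continuous_cvg _ (@continuous_sin R t)); exact: cvg_fst.
have snd1 : (fun p : R * R => p.2) @ (t, r) --> r by exact: cvg_snd.
exact: cvg_pair (cvgM snd1 cos1) (cvgM snd1 sin1).
Qed.

Let pi2_ge0 : 0 <= 2 * pi :> R. Proof. by rewrite mulr_ge0 ?pi_ge0. Qed.

(** Uniformity in the angle comes from the compactness of [0, 2 pi]. *)
Lemma circle_mean_continuous h r : (forall z, N z = `|r| -> {for z, continuous h}) ->
  forall e, 0 < e -> \forall s \near r,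
    forall n, N (circle_mean n h s%:C - circle_mean n h r%:C) <= e.
Proof.
move=> hc e e0.
have cov : near_covering `[0, 2 * pi : R]%classic.
  by apply/compact_near_coveringP; exact: segment_compact.
have := cov R (nbhs r) (fun s t => N (h (s%:C * expi t) - h (r%:C * expi t)) < e)
  (nbhs_filter r).
have H t : `[0, 2 * pi]%classic t -> \forall t' \near t & s \near r,
    N (h (s%:C * expi t') - h (r%:C * expi t')) < e.
  move=> _; have hz : {for polar (t, r), continuous h}.
    by apply: hc; rewrite /polar normc_mul_expi normc_real.
  have c1 : h \o polar @ (t, r) --> h (polar (t, r)).
    by apply: (continuous_cvg _ hz); exact: continuous_polar.
  have c2 : h \o polar \o (fun p => (p.1, r)) @ (t, r) --> h (polar (t, r)).
    apply: (continuous_cvg _ hz); apply: (continuous_cvg _ (@continuous_polar (t, r))).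
    have fst1 : (fun p : R * R => p.1) @ (t, r) --> t by exact: cvg_fst.
    exact: (cvg_pair fst1 (cvg_cst r)).
  have e2 : 0 < e / 2 by rewrite divr_gt0.
  have n1 := (cvg_normcP (FF := nbhs_filter (t, r)) _ _).1 c1 _ e2.
  have n2 := (cvg_normcP (FF := nbhs_filter (t, r)) _ _).1 c2 _ e2.
  apply: filterS2 n1 n2 => -[t' s] /= h1 h2.
  apply: le_lt_trans (normc_triangleBr _ _ (h (polar (t, r)))) _.
  by rewrite (splitr e) ltrD// normcB.
move=> /(_ H); apply: filterS => s sP n.
by rewrite -midmeanB; apply: midmean_le => // t ht; apply: ltW; apply: sP.
Qed.

Lemma bounded_on_circle h w : (forall z, N z = N w -> {for z, continuous h}) ->
  exists2 M, 0 < M & forall t, 0 <= t <= 2 * pi -> N (h (w * expi t)) <= M.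
Proof.
move=> hc.
have cov : near_covering `[0, 2 * pi : R]%classic.
  by apply/compact_near_coveringP; exact: segment_compact.
have := cov R +oo (fun M t => N (h (w * expi t)) <= M) _.
have H t : `[0, 2 * pi]%classic t -> \forall t' \near t & M \near +oo,
    N (h (w * expi t')) <= M.
  move=> _; have hz : {for w * expi t, continuous h}.
    by apply: hc; rewrite normc_mul_expi.
  have c1 : (fun t => h (w * expi t)) @ t --> h (w * expi t).
    apply: (continuous_cvg _ hz).
    by apply: cvg_complexZ; exact: continuous_expi.
  have n1 := (cvg_normcP (FF := nbhs_filter t) _ _).1 c1 _ ltr01.
  exists ([set t' | N (h (w * expi t') - h (w * expi t)) < 1],
    [set M | N (h (w * expi t)) + 1 <= M]).
    by split => //=; apply: nbhs_pinfty_ge; rewrite num_real.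
  move=> [t' M] /= [h1 h2]; apply: le_trans h2.
  rewrite -(subrK (h (w * expi t)) (h (w * expi t'))) addrC.
  by apply: le_trans (normc_triangle _ _) _; rewrite lerD2l ltW.
move=> /(_ _ H) K.
have [M [M0 MP]] : exists M, 0 < M /\ (`[0, 2 * pi]%classic `<=`
    (fun t => N (h (w * expi t)) <= M)).
  near +oo_R => M; exists M; split; near: M; last exact: K.
  by apply: nbhs_pinfty_gt; rewrite num_real.
by exists M => // t ht; apply: MP.
Unshelve. all: by end_near. Qed.

Lemma derivable_mulZ h u z : derivable h (u * z) 1 -> derivable (fun z => h (u * z)) z 1.
Proof.
move=> /derivable_cderiv hd.
have lin : cderiv (fun z => u * z) z u.
  move=> e e0; exists 1 => // w _.
  by rewrite -!mulrBr subrr mulr0 Normc.normc0 mulr_ge0 ?normc_ge0 ?ltW.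
exact: (cderiv_derivable (cderiv_comp lin hd)).1.
Qed.

Lemma derivable_continuous h z : derivable h z 1 -> {for z, continuous h}.
Proof. by move=> /derivable_cderiv/cderiv_continuous. Qed.

Let polar_factor w : w != 0 -> exists2 u, N u = 1 & w = u * (N w)%:C.
Proof.
move=> w0; have nw0 : N w != 0 by rewrite normc_eq0.
exists (w / (N w)%:C).
  by rewrite Normc.normcM Normc.normcV normc_real ger0_norm ?normc_ge0// divff.
by rewrite divfK// -normc_eq0 normc_real normr_eq0.
Qed.

(** The mean value property.  Differentiability at the centre is not assumed,
    so it applies to difference quotients. *)
Lemma mean_value h (r : R) w : {for 0, continuous h} ->
  (forall z, 0 < N z < r -> derivable h z 1) -> N w < r ->
  (fun n => circle_mean n h w) @ \oo --> h 0.
Proof.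
move=> h0 dh wr.
have [->|w0] := eqVneq w 0.
  rewrite (_ : (fun n => _) = (fun=> h 0)); first exact: cvg_cst.
  apply/funext => n; rewrite /circle_mean -[RHS](midmean_cst n _ 0 (2 * pi)).
  by congr midmean; apply/funext => t; rewrite mul0r.
have [u u1 wE] := polar_factor w0.
pose G z := h (u * z).
have Nu z : N (u * z) = N z by rewrite Normc.normcM u1 mul1r.
have wE' n : circle_mean n h w = circle_mean n G (N w)%:C.
  by rewrite circle_mean_rotate -wE.
apply/cvg_normcP => e e0.
have [d d0 dP] := (continuous_normcP _ _).1 h0 _ (divr_gt0 e0 (ltr0Sn _ 1)).
have nw : 0 < N w by rewrite normc_gt0.
have [r1 [r10 r1w r1d]] : exists r1, [/\ 0 < r1, r1 <= N w & r1 < d].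
  exists (Order.min (N w) (d / 2)).
  rewrite lt_min nw divr_gt0// ge_min lexx gt_min; split => //.
  by rewrite [X in _ || X]ltr_pdivrMr// ltr_pMr// ltr1n orbT.
have dG z : r1 <= N z <= N w -> derivable G z 1.
  move=> /andP[z1 z2]; apply: derivable_mulZ; apply: dh.
  by rewrite Nu (lt_le_trans r10 z1) (le_lt_trans z2 wr).
have /cvg_normcP/(_ _ (divr_gt0 e0 (ltr0Sn _ 1))) := circle_mean_annulus r10 r1w dG.
apply: filterS => n; rewrite subr0 -wE' => hn.
have : N (circle_mean n G r1%:C - h 0) <= e / 2.
  rewrite -{1}(circle_mean_cst n (h 0) r1%:C) -circle_meanB.
  apply: circle_mean_le => t _; apply/ltW/dP.
  by rewrite subr0 Nu normc_mul_expi normc_real gtr0_norm.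
move=> h1; apply: le_lt_trans (normc_triangleBr _ _ (circle_mean n G r1%:C)) _.
by rewrite (splitr e); apply: ltr_leD.
Qed.

(** One exceptional point is allowed: the means do not change along either of
    the two annuli which its circle separates, and they depend continuously on
    the radius. *)
Lemma mean_value_punctured F a w : a != 0 ->
  (forall z, N z < 1 -> {for z, continuous F}) ->
  (forall z, N z < 1 -> z != a -> derivable F z 1) -> N a < N w < 1 ->
  (fun n => circle_mean n F w) @ \oo --> F 0.
Proof.
move=> a0 Fc dF /andP[aw w1].
have na : 0 < N a by rewrite normc_gt0.
have w0 : w != 0 by rewrite -normc_gt0 (lt_trans na).
have [u u1 wE] := polar_factor w0.
pose G z := F (u * z).
have Nu z : N (u * z) = N z by rewrite Normc.normcM u1 mul1r.
have wE' n : circle_mean n F w = circle_mean n G (N w)%:C.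
  by rewrite circle_mean_rotate -wE.
have Gc z : N z < 1 -> {for z, continuous G}.
  move=> z1; have Fuz : {for u * z, continuous F} by apply: Fc; rewrite Nu.
  exact: (continuous_cvg _ Fuz (@mulrl_continuous _ u z)).
have dG z : N z < 1 -> N z != N a -> derivable G z 1.
  move=> z1 za; apply: derivable_mulZ; apply: dF; rewrite ?Nu//.
  by apply/eqP => E; move: za; rewrite -Nu E eqxx.
apply/cvg_normcP => e e0; have e4 : 0 < e / 4 by rewrite divr_gt0.
have Gca z : N z = `|N a| -> {for z, continuous G}.
  by rewrite ger0_norm ?normc_ge0// => zE; apply: Gc; rewrite zE (lt_trans aw).
have /nbhs_ballP[d /= d0 dP] := circle_mean_continuous Gca e4.
have [r1 [r10 r1a r1d]] : exists r1, [/\ 0 < r1, r1 < N a & `|N a - r1| < d].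
  exists (Order.max (N a / 2) (N a - d / 2)).
  have h1 : N a / 2 < N a by rewrite ltr_pdivrMr// ltr_pMr// ltr1n.
  have h2 : N a - d / 2 < N a by rewrite ltrBlDr ltrDl divr_gt0.
  rewrite lt_max divr_gt0// gt_max h1 h2; split => //.
  rewrite ger0_norm ?subr_ge0 ?ge_max ?(ltW h1) ?(ltW h2)//.
  rewrite ltrBlDr -ltrBlDl lt_max; apply/orP; right.
  by rewrite ltrD2l ltrN2 ltr_pdivrMr// ltr_pMr// ltr1n.
have [r2 [r2w r2a r2d]] : exists r2, [/\ r2 <= N w, N a < r2 & `|N a - r2| < d].
  exists (Order.min (N w) (N a + d / 2)).
  have h2 : N a < N a + d / 2 by rewrite ltrDl divr_gt0.
  rewrite ge_min lexx lt_min aw h2; split => //.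
  rewrite distrC ger0_norm ?subr_ge0 ?le_min ?(ltW aw) ?(ltW h2)//.
  rewrite ltrBlDl gt_min; apply/orP; right.
  by rewrite ltrD2l ltr_pdivrMr// ltr_pMr// ltr1n.
have /circle_mean_annulus : forall z, r2 <= N z <= N w -> derivable G z 1.
  move=> z /andP[z1 z2]; apply: dG; first exact: le_lt_trans w1.
  by rewrite gt_eqF// (lt_le_trans r2a).
move=> /(_ (lt_trans na r2a) r2w)/cvg_normcP/(_ _ e4) A.
have : (fun n => circle_mean n G r1%:C) @ \oo --> G 0.
  apply: (@mean_value _ (N a)).
  - by apply: Gc; rewrite Normc.normc0 ltr01.
  - move=> z /andP[_ za]; apply: dG; first by rewrite (lt_trans za)// (lt_trans aw).
    by rewrite lt_eqF.
  - by rewrite normc_real gtr0_norm.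
move=> /cvg_normcP/(_ _ e4) B.
apply: filterS2 A B => n; rewrite subr0 -wE' => A B.
have C1 := dP r1 r1d n; have C2 := dP r2 r2d n.
move: B; rewrite {2}/G mulr0 => B.
apply: le_lt_trans (normc_triangleBr _ _ (circle_mean n G r2%:C)) _.
have := normc_triangleBr (circle_mean n G r2%:C) (F 0) (circle_mean n G (N a)%:C).
have := normc_triangleBr (circle_mean n G (N a)%:C) (F 0) (circle_mean n G r1%:C).
rewrite (normcB (circle_mean n G (N a)%:C) (circle_mean n G r1%:C)).
move: A B C1 C2; set x1 := N _; set x2 := N _; set x3 := N _; set x4 := N _.
by set x5 := N _; set x6 := N _; lra.
Qed.

End cauchy.

(** * Cauchy's formula and Taylor sums *)

Section taylor.
Variable R : realType.
Implicit Types (f g h F : R[i] -> R[i]) (t r e : R) (a b w z u v : R[i]) (n m j k : nat).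

Lemma geometric_remainder (z a : R[i]) K : z != 0 -> z != a ->
  z / (z - a) = \sum_(k < K) a ^+ k * z ^- k + (a / z) ^+ K * (z / (z - a)).
Proof.
move=> z0 za; have za0 : z - a != 0 by rewrite subr_eq0.
elim: K => [|K ih]; first by rewrite big_ord0 expr0 mul1r add0r.
rewrite big_ord_recr /= [LHS]ih -!addrA; congr (_ + _).
rewrite exprS -exprVn -exprMn.
have E : z / (z - a) = 1 + a / z * (z / (z - a)) by field; rewrite z0 za0.
by rewrite {1}E; ring.
Qed.

Lemma circle_neq w a z : N a < N w -> N z = N w -> z != 0 /\ z != a.
Proof.
move=> aw zw; split.
  by rewrite -normc_gt0 zw (le_lt_trans (normc_ge0 a)).
by apply/eqP => E; move: aw; rewrite -zw E ltxx.
Qed.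

Lemma circle_dist w a z : N z = N w -> N w - N a <= N (z - a).
Proof. by move=> <-; exact: normc_subl. Qed.

(** In the geometric expansion of the kernel only the constant term has a
    nonzero mean.  The midpoint rule with [2 ^ n] points is exact on the first
    [2 ^ n] terms, and the remainder is geometrically small. *)
Lemma circle_mean_cauchy_kernel a w : N a < N w ->
  (fun n => circle_mean n (fun z => z / (z - a)) w) @ \oo --> (1 : R[i]).
Proof.
move=> aw; have w0 : 0 < N w by exact: le_lt_trans (normc_ge0 a) aw.
have awd : 0 < N w - N a by rewrite subr_gt0.
apply/cvg_normcP => e e0.
have q1 : 0 <= N a / N w < 1.
  by rewrite divr_ge0 ?normc_ge0//= ltr_pdivrMr// mul1r.
have [K0 _ KP] := near_mul_expr_lt (N w / (N w - N a)) q1 e0.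
exists K0 => // n /= nK.
have := KP (2 ^ n)%N (leq_trans nK (ltnW (ltn_expl n (ltnSn 1)))).
apply: le_lt_trans.
have -> : circle_mean n (fun z => z / (z - a)) w - 1 =
    circle_mean n (fun z => (a / z) ^+ (2 ^ n) * (z / (z - a))) w.
  rewrite (@eq_circle_mean _ n (fun z => z / (z - a)) (fun z =>
     \sum_(k < 2 ^ n) a ^+ k * z ^- k - (- (a / z) ^+ (2 ^ n)) * (z / (z - a)))); last first.
    move=> z zw; have [z0 za] := circle_neq aw zw.
    by rewrite [LHS](geometric_remainder (2 ^ n) z0 za) mulNr opprK.
  rewrite circle_meanB circle_mean_sum.
  have p : (0 < 2 ^ n)%N by rewrite expn_gt0.
  rewrite -(prednK p) big_ord_recl /= big1 => [|i _]; last first.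
    rewrite circle_meanZ circle_mean_exprV ?mulr0//.
    by rewrite /bump /= add1n; have := ltn_ord i; rewrite -ltnS (prednK p).
  have -> : circle_mean n (fun z => a ^+ 0 * z ^- 0) w = 1.
    rewrite -[RHS](circle_mean_cst n 1 w); apply: eq_circle_mean => z _.
    by rewrite !expr0 invr1 mulr1.
  rewrite addr0 (prednK p).
  rewrite (@eq_circle_mean _ n (fun z => - (a / z) ^+ (2 ^ n) * (z / (z - a)))
    (fun z => -1 * ((a / z) ^+ (2 ^ n) * (z / (z - a))))) ?circle_meanZ; last first.
    by move=> z _; rewrite mulN1r mulNr.
  by ring.
apply: circle_mean_le => t _; move: (w * expi t) (normc_mul_expi w t) => z zw.
rewrite Normc.normcM normcX !Normc.normcM !Normc.normcV zw mulrC.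
apply: ler_wpM2r; first by rewrite exprn_ge0// divr_ge0 ?normc_ge0.
apply: ler_wpM2l; first exact: ltW.
by rewrite lef_pV2 ?posrE ?circle_dist// (lt_le_trans awd)// circle_dist.
Qed.

(** The function [z (f z - f a) / (z - a)] vanishes at [0], so its means over
    circles tend to [0] by the mean value property. *)
Lemma cauchy_formula f a w : holomorphic_on (@unit_disc R) f -> N a < N w < 1 ->
  (fun n => circle_mean n (fun z => f z * (z / (z - a))) w) @ \oo --> f a.
Proof.
move=> hf /andP[aw w1]; have a1 : N a < 1 by exact: lt_trans w1.
have df z : N z < 1 -> derivable f z 1 by move=> /unit_discE/hf.
have fc z : N z < 1 -> {for z, continuous f} by move=> /df/derivable_continuous.
have fal := derivable_cderiv (df _ a1); set l := derive1 f a in fal.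
(* The value at [a] makes [F] continuous there. *)
pose F z := if z == a then a * l else z * ((f z - f a) / (z - a)).
have dF z : N z < 1 -> z != a -> derivable F z 1.
  move=> z1 za.
  have [m dm] := cderiv_inv_sub za.
  have dn := cderivD (derivable_cderiv (df z z1)) (cderiv_cst (- f a) z).
  have := cderivM (cderiv_id z) (cderivM dn dm); move=> /(@cderiv_eq _ _ F) H.
  apply: (cderiv_derivable (H _)).1.
  apply/near_normcP; exists (N (z - a)); first by rewrite normc_gt0 subr_eq0.
  move=> y yz; rewrite /F ifN//; apply/eqP => E; move: yz.
  by rewrite E normcB ltxx.
have Fa : {for a, continuous F}.
  apply/continuous_normcP => e e0.
  have e2 : 0 < e / 2 by rewrite divr_gt0.
  have [d1 d10 d1P] := fal _ e2.
  have [d2 d20 d2P] : exists2 d, 0 < d & d * (N l + 1) < e / 2.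
    have p : 0 < N l + 1 by rewrite ltr_wpDl ?normc_ge0.
    exists (e / 4 / (N l + 1)); first by rewrite !divr_gt0.
    by rewrite divfK ?gt_eqF//; lra.
  exists (Order.min d1 (Order.min d2 (1 - N a))).
    by rewrite !lt_min d10 d20 subr_gt0.
  move=> z; rewrite !lt_min => /and3P[h1 h2 h3]; rewrite /F eqxx.
  have [_|za] := eqVneq z a; first by rewrite subrr Normc.normc0.
  have za0 : 0 < N (z - a) by rewrite normc_gt0 subr_eq0.
  have -> : z * ((f z - f a) / (z - a)) - a * l =
      z * ((f z - f a - l * (z - a)) / (z - a)) + (z - a) * l.
    by field; rewrite subr_eq0.
  apply: le_lt_trans (normc_triangle _ _) _.
  rewrite (splitr e); apply: ler_ltD; last first.
    rewrite Normc.normcM; apply: le_lt_trans d2P.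
    apply: ler_pM; rewrite ?normc_ge0 ?ltW//.
    by rewrite ltrDl.
  rewrite !Normc.normcM Normc.normcV -[leRHS]mul1r.
  apply: ler_pM; rewrite ?normc_ge0 ?mulr_ge0 ?invr_ge0 ?normc_ge0//.
    have := normc_triangle (z - a) a; rewrite subrK; lra.
  by rewrite ler_pdivrMr//; exact: d1P.
have Fc z : N z < 1 -> {for z, continuous F}.
  move=> z1; have [->//|za] := eqVneq z a.
  by apply: derivable_continuous; exact: dF.
have F0 : F 0 = 0 by rewrite /F; case: eqVneq => [<-|_]; rewrite mul0r.
have : (fun n => circle_mean n F w) @ \oo --> F 0.
  have [az|a0] := eqVneq a 0.
    have F0c : {for 0, continuous F} by apply: Fc; rewrite Normc.normc0.
    apply: (mean_value F0c _ w1) => z /andP[z0 z1]; apply: dF z1 _.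
    by rewrite az -normc_gt0.
  by apply: (mean_value_punctured a0 Fc dF); rewrite aw.
rewrite F0 => lim0.
have E n : circle_mean n (fun z => f z * (z / (z - a))) w =
    circle_mean n F w + f a * circle_mean n (fun z => z / (z - a)) w.
  rewrite -circle_meanZ; apply/eqP.
  rewrite -subr_eq -circle_meanB; apply/eqP/eq_circle_mean => z zw.
  have [z0 za] := circle_neq aw zw.
  by rewrite /F ifN//; field; rewrite subr_eq0.
suff : (fun n => circle_mean n F w + f a * circle_mean n (fun z => z / (z - a)) w)
    @ \oo --> 0 + f a * 1 by rewrite (eq_cvg _ _ E) add0r mulr1.
exact: cvg_complexD lim0 (cvg_complexZ (circle_mean_cauchy_kernel aw)).
Qed.

(** Used with [u = (z - b)^-1], [v = (z - a)^-1] and [k = b - a]: the expansion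
    to first order in [b - a] of the Cauchy kernels, with an error term uniform
    on the circle. *)
Lemma kernel_expand (B : R) m : 0 < B -> exists2 C, 0 <= C &
  forall u v k : R[i], N u <= B -> N v <= B -> u - v = k * u * v ->
    N (u ^+ m - v ^+ m - k * m%:R * v ^+ m.+1) <= C * N k ^+ 2.
Proof.
move=> B0; elim: m => [|m [C C0 ih]].
  exists 0 => // u v k _ _ _.
  by rewrite !expr0 subrr mulr0 mul0r subr0 Normc.normc0 mul0r.
exists (B * C + m%:R * B ^+ m.+1 * (B * B) + B ^+ m * (B * B * B)).
  by rewrite !addr_ge0// ?mulr_ge0 ?exprn_ge0// ltW.
move=> u v k uB vB uv.
have -> : u ^+ m.+1 - v ^+ m.+1 - k * m.+1%:R * v ^+ m.+2 =
   u * (u ^+ m - v ^+ m - k * m%:R * v ^+ m.+1)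
   + k * (m%:R * v ^+ m.+1) * (u - v) + v ^+ m * (u - v - k * v * v).
  by rewrite !exprS -natr1; ring.
have -> : u - v - k * v * v = k * k * (u * v * v).
  have -> : u - v - k * v * v = k * (u - v) * v + (u - v - k * u * v) by ring.
  by rewrite uv subrr addr0; ring.
rewrite uv.
have -> : k * (m%:R * v ^+ m.+1) * (k * u * v) =
   (m%:R * v ^+ m.+1 * (u * v)) * (k * k) by ring.
have -> : v ^+ m * (k * k * (u * v * v)) = v ^+ m * (u * v * v) * (k * k) by ring.
rewrite !mulrDl.
have Np : 0 <= N k ^+ 2 by rewrite exprn_ge0 ?normc_ge0.
apply: le_trans (normc_triangle _ _) _; apply: lerD.
  apply: le_trans (normc_triangle _ _) _; apply: lerD.
    rewrite Normc.normcM -(mulrA B); apply: ler_pM; rewrite ?normc_ge0//.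
    exact: ih.
  rewrite !Normc.normcM normc_nat normcX -expr2; apply: ler_wpM2r => //.
  apply: ler_pM; rewrite ?mulr_ge0 ?exprn_ge0 ?normc_ge0//.
    by rewrite ler_wpM2l//; apply: lerXn2r; rewrite ?nnegrE ?normc_ge0 ?(ltW B0).
  by apply: ler_pM; rewrite ?normc_ge0.
rewrite !Normc.normcM normcX -expr2; apply: ler_wpM2r => //.
apply: ler_pM; rewrite ?mulr_ge0 ?exprn_ge0 ?normc_ge0//.
  by apply: lerXn2r; rewrite ?nnegrE ?normc_ge0 ?(ltW B0).
by apply: ler_pM; rewrite ?mulr_ge0 ?normc_ge0//; apply: ler_pM; rewrite ?normc_ge0.
Qed.

(** Differentiation under the mean.  By the uniform expansion of the kernels,
    the means of the derived kernel stay close to the difference quotients of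
    [D] at all small increments, so they converge, to the derivative of [D]. *)
Lemma cauchy_integral_cderiv f (D : R[i] -> R[i]) m a w :
  (forall z, N z = N w -> {for z, continuous f}) -> N a < N w ->
  (forall b, N b < N w ->
     (fun n => circle_mean n (fun z => f z * (z / (z - b) ^+ m)) w) @ \oo --> D b) ->
  exists2 l, cderiv D a l &
    (fun n => m%:R * circle_mean n (fun z => f z * (z / (z - a) ^+ m.+1)) w)
      @ \oo --> l.
Proof.
move=> fc aw DP.
have [M M0 MP] := bounded_on_circle fc.
have [d0 d0E] : exists d0, d0 = (N w - N a) / 2 by eexists.
have d00 : 0 < d0 by rewrite d0E divr_gt0// subr_gt0.
have w0 : 0 <= N w by exact: normc_ge0.
have [C C0 CP] := @kernel_expand d0^-1 m (ltac:(by rewrite invr_gt0)).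
pose T b n := circle_mean n (fun z => f z * (z / (z - b) ^+ m)) w.
pose S n := m%:R * circle_mean n (fun z => f z * (z / (z - a) ^+ m.+1)) w.
pose K := M * N w * C + 1.
have K0 : 0 < K by rewrite ltr_wpDl// !mulr_ge0// ltW.
have est b n : N (b - a) < d0 ->
    N (T b n - T a n - (b - a) * S n) <= K * N (b - a) ^+ 2.
  move=> bd; rewrite /T /S mulrA -circle_meanZ -!circle_meanB.
  apply: circle_mean_le => t /MP.
  move: (w * expi t) (normc_mul_expi w t) => z zw fM.
  have za : d0 <= N (z - a).
    apply: le_trans (circle_dist a zw); rewrite d0E ler_pdivrMr//.
    by rewrite ler_pMr ?subr_gt0// ler1n.
  have zb : d0 <= N (z - b).
    have := normc_triangleBr z a b; have := circle_dist a zw.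
    by move: bd; rewrite d0E; lra.
  have za0 : z - a != 0 by rewrite -normc_gt0 (lt_le_trans d00).
  have zb0 : z - b != 0 by rewrite -normc_gt0 (lt_le_trans d00).
  have -> : f z * (z / (z - b) ^+ m) - f z * (z / (z - a) ^+ m) -
      (b - a) * m%:R * (f z * (z / (z - a) ^+ m.+1)) =
    f z * z * ((z - b)^-1 ^+ m - (z - a)^-1 ^+ m -
      (b - a) * m%:R * (z - a)^-1 ^+ m.+1).
    by rewrite !exprVn; ring.
  have -> : K * N (b - a) ^+ 2 = M * N w * (C * N (b - a) ^+ 2) + N (b - a) ^+ 2.
    by rewrite /K; ring.
  rewrite Normc.normcM -[leLHS]addr0.
  apply: lerD; last by rewrite exprn_ge0 ?normc_ge0.
  apply: ler_pM; rewrite ?normc_ge0//.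
    rewrite Normc.normcM zw; exact: ler_wpM2r.
  apply: CP; rewrite ?Normc.normcV ?lef_pV2 ?posrE ?(lt_le_trans d00)//.
  by field; rewrite za0.
have near_b b : N (b - a) < d0 -> N b < N w.
  by have := normc_triangle (b - a) a; rewrite subrK d0E; lra.
(* A single increment [s] is enough for each [e]: the difference quotient of
   [D] at [s] is a number within [e] of almost all [S n]. *)
have cvgS : cvg (S @ \oo).
  apply: approx_cvg => e e0.
  have [s [s0 sd se]] : exists s, [/\ 0 < s, s < d0 & K * s < e / 2].
    exists (Order.min (d0 / 2) (e / (4 * K))).
    rewrite lt_min !divr_gt0 ?mulr_gt0//; split => //.
      by rewrite gt_min ltr_pdivrMr// ltr_pMr// ltr1n.
    rewrite mulrC -ltr_pdivlMr// gt_min; apply/orP; right.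
    by rewrite invfM mulrA ltr_pM2r ?invr_gt0// ltr_pM2l// ltf_pV2 ?posrE// ltr_nat.
  pose b := a + s%:C.
  have bas : b - a = s%:C by rewrite /b addrC addKr.
  have Nba : N (b - a) = s by rewrite bas normc_real gtr0_norm.
  have ba0 : b - a != 0 by rewrite -normc_gt0 Nba.
  exists ((D b - D a) / (b - a)).
  have Tb := DP b (near_b b (ltac:(by rewrite Nba))); have Ta := DP a aw.
  have : (fun n => T b n - T a n) @ \oo --> D b - D a.
    exact: cvg_complexB Tb Ta.
  move=> /cvg_normcP/(_ _ (mulr_gt0 s0 (divr_gt0 e0 (ltr0Sn _ 1)))).
  apply: filterS => n /= hn.
  have := est b n (ltac:(by rewrite Nba)); rewrite Nba => h.
  rewrite -(ltr_pM2l s0) -{1}Nba -Normc.normcM.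
  have -> : (b - a) * (S n - (D b - D a) / (b - a)) =
    - (T b n - T a n - (b - a) * S n) + (T b n - T a n - (D b - D a)).
    by move: (S n) (T b n) (T a n) => x y z; field.
  apply: le_lt_trans (normc_triangle _ _) _; rewrite normc_opp.
  rewrite (splitr e) mulrDr; apply: ler_ltD hn; apply: le_trans h _.
  by rewrite expr2 mulrCA ler_pM2l// ltW.
have [l lP] := (cvg_ex _).1 cvgS; exists l => // e e0.
exists (Order.min d0 (e / K)); first by rewrite lt_min d00 divr_gt0.
move=> b; rewrite lt_min => /andP[bd be].
have lim : (fun n => T b n - T a n - (b - a) * S n) @ \oo -->
    D b - D a - (b - a) * l.
  exact: cvg_complexB (cvg_complexB (DP b (near_b b bd)) (DP a aw)) (cvg_complexZ lP).
rewrite (mulrC l); apply: (cvg_normc_le lim); apply: nearW => n.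
apply: le_trans (est b n bd) _; rewrite expr2 mulrA ler_wpM2r ?normc_ge0//.
by rewrite mulrC -ler_pdivlMr// ltW.
Qed.

Lemma cauchy_derivatives f j a w : holomorphic_on (@unit_disc R) f ->
  N a < N w < 1 ->
  (fun n => circle_mean n (fun z => f z * (z / (z - a) ^+ j.+1)) w) @ \oo -->
    derive1n j f a / j`!%:R.
Proof.
move=> hf; elim: j a => [|j ih] a /andP[aw w1].
  rewrite fact0 divr1; under eq_fun do under eq_fun do rewrite expr1.
  by apply: cauchy_formula => //; rewrite aw.
have fc z : N z = N w -> {for z, continuous f}.
  move=> zw; apply/derivable_continuous/hf/unit_discE; by rewrite zw.
have [l Dl Sl] := @cauchy_integral_cderiv f (fun b => derive1n j f b / j`!%:R)
   j.+1 a w fc aw (fun b bw => ih b (ltac:(by rewrite bw))).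
have j0 : j`!%:R != 0 :> R[i] by rewrite pnatr_eq0 -lt0n fact_gt0.
have jS : j.+1%:R != 0 :> R[i] by rewrite pnatr_eq0.
have dl : cderiv (derive1n j f) a (l * j`!%:R).
  have lin : cderiv (fun z => z * j`!%:R) (derive1n j f a / j`!%:R) (j`!%:R : R[i]).
    move=> e e0; exists 1 => // y _.
    rewrite -mulrBl (mulrC _ (y - _)) subrr Normc.normc0.
    by rewrite mulr_ge0 ?normc_ge0 ?ltW.
  have := cderiv_comp Dl lin; rewrite mulrC; apply: cderiv_eq.
  by apply/near_normcP; exists 1 => // z _ /=; rewrite divfK.
rewrite derive1nS (cderiv_derivable dl).2.
have -> : l * j`!%:R / j.+1`!%:R = j.+1%:R^-1 * l.
  by rewrite factS natrM invfM mulrCA mulfK.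
apply: eq_cvg_complex (cvg_complexZ (c := j.+1%:R^-1) Sl) => n.
by rewrite mulKf.
Qed.

Definition taylor_coef f k : R[i] := derive1n k f 0 / k`!%:R.

Lemma taylor_coef_mean f k w : holomorphic_on (@unit_disc R) f -> 0 < N w < 1 ->
  (fun n => circle_mean n (fun z => f z * z ^- k) w) @ \oo --> taylor_coef f k.
Proof.
move=> hf w01; have := @cauchy_derivatives f k 0 w hf.
rewrite Normc.normc0 => /(_ w01); apply: eq_cvg_complex => n.
apply: eq_circle_mean => z zw.
have z0 : z != 0 by rewrite -normc_gt0 zw; case/andP: w01.
by rewrite subr0 exprS invfM mulVKf.
Qed.

Lemma taylor_sumE f n z : taylor_sum f n z = \sum_(k < n.+1) taylor_coef f k * z ^+ k.
Proof. by rewrite /taylor_sum big_mkord. Qed.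

(** The remainder of the geometric series of the Cauchy kernel is uniformly
    small on a circle of radius strictly between [r] and [1]. *)
Lemma taylor_sum_cvg f r : holomorphic_on (@unit_disc R) f -> r < 1 ->
  forall e, 0 < e -> \forall n \near \oo,
    forall z, N z <= r -> N (taylor_sum f n z - f z) <= e.
Proof.
move=> hf r1 e e0.
have [r0|r0] := ltP r 0.
  by apply: nearW => n z zr; have := le_lt_trans zr r0; rewrite ltNge normc_ge0.
have [s [rs s1]] : exists s, r < s /\ s < 1 by exists ((r + 1) / 2); split; lra.
have s0 : 0 < s by exact: le_lt_trans rs.
have Ns : N s%:C = s by rewrite normc_real gtr0_norm.
have fc z : N z = N s%:C -> {for z, continuous f}.
  by move=> zw; apply/derivable_continuous/hf/unit_discE; rewrite zw Ns.
have [M M0 MP] := bounded_on_circle fc.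
have q1 : 0 <= r / s < 1 by rewrite divr_ge0 ?(ltW s0)//= ltr_pdivrMr// mul1r.
have [K0 _ KP] := near_mul_expr_lt (M * (s / (s - r))) q1 e0.
exists K0 => // n /= nK a ar; rewrite normcB.
have as_ : N a < N s%:C by rewrite Ns (le_lt_trans ar).
have lim : (fun m => circle_mean m (fun z => f z * (z / (z - a))) s%:C -
     \sum_(k < n.+1) circle_mean m (fun z => f z * z ^- k) s%:C * a ^+ k)
     @ \oo --> f a - taylor_sum f n a.
  rewrite taylor_sumE; apply: cvg_complexB; first by apply: cauchy_formula; rewrite // as_ Ns.
  have L (k : 'I_n.+1) : (fun m => circle_mean m (fun z => f z * z ^- k) s%:C * a ^+ k)
      @ \oo --> taylor_coef f k * a ^+ k.
    have s01 : 0 < N s%:C < 1 by rewrite Ns s0.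
    exact: cvg_complexZr (taylor_coef_mean (k := k) hf s01).
  exact: (cvg_complex_sum (s := index_enum _) L).
apply: (cvg_normc_le lim); apply: nearW => m.
have -> : circle_mean m (fun z => f z * (z / (z - a))) s%:C -
     \sum_(k < n.+1) circle_mean m (fun z => f z * z ^- k) s%:C * a ^+ k =
   circle_mean m (fun z => f z * ((a / z) ^+ n.+1 * (z / (z - a)))) s%:C.
  apply/eqP; rewrite subr_eq; apply/eqP.
  rewrite (eq_bigr (fun k : 'I_n.+1 =>
     circle_mean m (fun z => f z * (a ^+ k * z ^- k)) s%:C)); last first.
    move=> k _; rewrite mulrC -circle_meanZ; apply: eq_circle_mean => z _.
    by rewrite mulrCA.
  rewrite -circle_mean_sum.
  rewrite -[X in _ + X]opprK -[- circle_mean _ _ _]mulN1r -circle_meanZ -circle_meanB.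
  apply: eq_circle_mean => z zs; have [z0 za] := circle_neq as_ zs.
  rewrite mulN1r opprK -mulr_sumr -mulrDr; congr (_ * _).
  by rewrite [RHS]addrC; exact: geometric_remainder.
apply: (@le_trans _ _ (M * ((r / s) ^+ n.+1 * (s / (s - r))))); last first.
  by rewrite mulrCA mulrC; apply: ltW; apply: KP; rewrite /= (leq_trans nK).
apply: circle_mean_le => t /MP.
move: (s%:C * expi t) (normc_mul_expi s%:C t) => z; rewrite Ns => zs fM.
rewrite Normc.normcM; apply: ler_pM; rewrite ?normc_ge0//.
rewrite Normc.normcM normcX !Normc.normcM !Normc.normcV zs.
apply: ler_pM; rewrite ?exprn_ge0 ?mulr_ge0 ?invr_ge0 ?normc_ge0 ?(ltW s0)//.
  apply: lerXn2r; rewrite ?nnegrE ?mulr_ge0 ?invr_ge0 ?normc_ge0 ?(ltW s0)//.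
  by rewrite ler_wpM2r// invr_ge0 ltW.
rewrite ler_pM2l// lef_pV2 ?posrE ?subr_gt0//.
  by have := @circle_dist s%:C a z; rewrite Ns zs => /(_ erefl); lra.
by rewrite (lt_le_trans _ (@circle_dist s%:C a z _)) ?Ns ?zs// subr_gt0 (le_lt_trans ar).
Qed.

End taylor.

(** * Planar Lebesgue measure under complex multiplication *)

Section planar_measure.
Variable R : realType.
Local Notation R1 := (measurableTypeR R).
Local Notation R2 := (measurableTypeR R * measurableTypeR R)%type.
Local Notation leb := (@lebesgue_measure R).
Local Notation leb2 := (leb \x leb)%E.
Implicit Types (a b : R) (c : R[i]).

Local Open Scope ereal_scope.

(** Two measures which agree on intervals are equal. *)
Lemma lebesgue_measure_affine a b (A : set R1) : (a != 0)%R -> measurable A ->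
  leb ((fun y => a * y + b)%R @^-1` A) = (`|a|^-1)%:E * leb A.
Proof.
move=> a0 mA.
have mphi : measurable_fun [set: R1] (fun y : R1 => (a * y + b)%R : R1).
  apply: measurable_funD => //; exact: measurable_funM.
have na : (0 <= `|a|)%R by [].
pose psi : {measure set R1 -> \bar R} :=
  pushforward leb (fun y : R1 => (a * y + b)%R : R1).
pose mu : {measure set R1 -> \bar R} := mscale (NngNum na) (psi mphi).
suff muE : leb A = mu A.
  rewrite muE /mu /= /mscale/= /pushforward muleA -EFinM mulVf ?normr_eq0//.
  by rewrite mul1e.
apply: lebesgue_measure_unique => // X [[s t] _ <-] /=.
rewrite /mu /= /mscale /= /pushforward /=.
have E : (fun y : R1 => a * y + b)%R @^-1` `]s, t] =
    [set` Interval (if (0 < a)%R then BRight ((s - b) / a)%R else BLeft ((t - b) / a)%R)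
                   (if (0 < a)%R then BRight ((t - b) / a)%R else BLeft ((s - b) / a)%R)].
  have [a1|a1|a1] := ltgtP 0%R a; last by rewrite -a1 eqxx in a0.
    apply/seteqP; split => y /=; rewrite !in_itv/= ltr_pdivrMr// ler_pdivlMr//;
      by rewrite ltrBlDr lerBrDr mulrC.
  apply/seteqP; split => y /=; rewrite !in_itv/= ler_ndivrMr// ltr_ndivlMr//;
    by rewrite lerBrDr ltrBlDr mulrC andbC.
rewrite E !lebesgue_measure_itv /=.
have [a1|a1|a1] := ltgtP 0%R a; last by rewrite -a1 eqxx in a0.
  rewrite !lte_fin ltr_pM2r ?invr_gt0// ltrD2r; case: ifPn => // _; last by rewrite mule0.
  by rewrite -!EFinB -EFinM gtr0_norm//; congr EFin; field.
rewrite !lte_fin ltr_nM2r ?invr_lt0// ltrD2r; case: ifPn => // _; last by rewrite mule0.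
by rewrite -!EFinB -EFinM ltr0_norm//; congr EFin; field.
Qed.

Lemma measurable_linear (a b : R) :
  measurable_fun [set: R2] (fun w : R2 => a * w.1 + b * w.2 : R)%R.
Proof.
by apply: measurable_funD; apply: measurable_funM.
Qed.

(** By Fubini: the map acts on each vertical section as an affine map. *)
Lemma leb2_shear_snd a b (A : set R2) : (a != 0)%R -> measurable A ->
  leb2 ((fun w : R2 => (w.1, b * w.1 + a * w.2)%R) @^-1` A) = (`|a|^-1)%:E * leb2 A.
Proof.
move=> a0 mA; rewrite /= /product_measure1 /=.
rewrite -ge0_integralZl//.
- apply: eq_integral => x _ /=.
  rewrite -(lebesgue_measure_affine (b * x)); [|exact: a0|exact: measurable_xsection].
  congr (leb _); rewrite !xsectionE; apply/seteqP; split => y /=; by rewrite addrC.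
- exact: measurable_fun_xsection.
Qed.

Let swap (w : R2) : R2 := (w.2, w.1).

Let measurable_swap : measurable_fun setT swap.
Proof. exact: measurable_fun_pair. Qed.

Lemma leb2_swap (A : set R2) : measurable A -> leb2 (swap @^-1` A) = leb2 A.
Proof.
move=> mA.
pose psi : {measure set R2 -> \bar R} := pushforward leb2 (swap).
pose mu := psi measurable_swap.
apply/esym; apply: (@product_measure_unique _ _ _ _ _ _ _ mu) => // B C mB mC.
rewrite /mu /= /pushforward /= (_ : _ @^-1` _ = C `*` B).
  by rewrite product_measure1E// muleC.
by apply/seteqP; split => -[x y] [].
Qed.

Lemma leb2_shear_fst a b (A : set R2) : (a != 0)%R -> measurable A ->
  leb2 ((fun w : R2 => (a * w.1 + b * w.2, w.2)%R) @^-1` A) = (`|a|^-1)%:E * leb2 A.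
Proof.
move=> a0 mA.
have mS : measurable (swap @^-1` A).
  by rewrite -[_ @^-1` _]setTI; exact: measurable_swap.
rewrite -(leb2_swap mA) -(leb2_shear_snd b a0 mS) -leb2_swap.
  by congr (leb2 _); apply/seteqP; split => -[x y]; rewrite /= /swap/= addrC.
rewrite -[X in measurable X]setTI.
by apply: measurable_fun_pair => //; exact: measurable_linear.
Qed.

(** Multiplication by a complex number, in real coordinates. *)
Definition cmul c (w : R * R) : R * R :=
  ((complex.Re c * w.1 - complex.Im c * w.2)%R,
   (complex.Im c * w.1 + complex.Re c * w.2)%R).

Lemma complex_of_cmul c w : complex_of (cmul c w) = (c * complex_of w)%R.
Proof.
by case: c w => [a b] [x y]; apply/eqP; rewrite eq_complex /= eqxx addrC eqxx.
Qed.

Lemma cmulM c d w : cmul (c * d)%R w = cmul c (cmul d w).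
Proof.
by case: c d w => [a b] [s t] [x y]; rewrite /cmul /=; congr pair; ring.
Qed.

Lemma measurable_cmul c : measurable_fun [set: R2] (cmul c : R2 -> R2).
Proof.
apply: measurable_fun_pair; last exact: measurable_linear.
by have := measurable_linear (complex.Re c) (- complex.Im c);
  apply: eq_measurable_fun => w _; rewrite mulNr.
Qed.

Lemma measurable_preimage_cmul c (A : set R2) : measurable A -> measurable (cmul c @^-1` A).
Proof. by move=> mA; rewrite -[X in measurable X]setTI; exact: measurable_cmul. Qed.

(** When [Re c != 0] the matrix of the multiplication is a product of two shears.
    A purely imaginary [c] is [(1 + i) * (c / (1 + i))], with two factors of
    nonzero real part. *)
Lemma leb2_cmul c (A : set R2) : (c != 0)%R -> measurable A ->
  leb2 (cmul c @^-1` A) = (((N c) ^+ 2)^-1)%:E * leb2 A.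
Proof.
have gen d (B : set R2) : (complex.Re d != 0)%R -> measurable B ->
    leb2 (cmul d @^-1` B) = (((N d) ^+ 2)^-1)%:E * leb2 B.
  case: d => a b /= a0 mB.
  pose k := ((a ^+ 2 + b ^+ 2) / a)%R.
  have ab0 : (0 < a ^+ 2 + b ^+ 2)%R.
    by rewrite ltr_wpDr ?sqr_ge0// lt_def sqr_ge0 expf_eq0 a0.
  have k0 : (k != 0)%R by rewrite /k mulf_neq0 ?invr_eq0// gt_eqF.
  have mS : measurable ((fun w : R2 => (k * w.1 + - (b / a) * w.2, w.2)%R) @^-1` B).
    rewrite -[X in measurable X]setTI.
    by apply: measurable_fun_pair => //; exact: measurable_linear.
  rewrite (_ : _ @^-1` B = (fun w : R2 => (w.1, b * w.1 + a * w.2)%R) @^-1`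
      ((fun w : R2 => (k * w.1 + - (b / a) * w.2, w.2)%R) @^-1` B)).
    rewrite leb2_shear_snd// leb2_shear_fst// muleA -EFinM.
    congr (_%:E * _); rewrite -invfM -normrM /k mulrC divfK//.
    by rewrite gtr0_norm// sqr_sqrtr// ltW.
  apply/seteqP; split => -[x y]; rewrite /= /cmul/=;
    by rewrite (_ : k * x + - (b / a) * (b * x + a * y) = a * x - b * y)%R//; rewrite /k; field.
move=> c0 mA; have [cR|] := eqVneq (complex.Re c) 0%R; last by move=> ?; exact: gen.
pose u : R[i] := 1%R +i* 1%R; pose v := (c / u)%R.
have u0 : (u != 0)%R by rewrite eq_complex /= oner_eq0.
have cE : c = (u * v)%R by rewrite /v mulrCA divff// mulr1.
have vR : (complex.Re v != 0)%R.
  have : (complex.Im c != 0)%R by apply: contra c0; rewrite eq_complex cR eqxx.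
  apply: contra => /eqP h; move: cR; rewrite cE.
  by case: (v) h => s t /= ->; rewrite !mul1r sub0r => /eqP; rewrite oppr_eq0 => /eqP ->; rewrite addr0.
have uR : (complex.Re u != 0)%R by rewrite /= oner_eq0.
rewrite (_ : cmul c @^-1` A = cmul v @^-1` (cmul u @^-1` A)); last first.
  by apply/seteqP; split => w /=; rewrite -cmulM cE.
rewrite gen//; last exact: measurable_preimage_cmul.
rewrite gen// muleA -EFinM; congr (_%:E * _).
by rewrite -invfM -exprMn -Normc.normcM mulrC -cE.
Qed.

Lemma integral_cmul c (H : R2 -> \bar R) : (c != 0)%R ->
  measurable_fun setT H -> (forall w, 0 <= H w) ->
  \int[leb2]_w H (cmul c w) = (((N c) ^+ 2)^-1)%:E * \int[leb2]_w H w.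
Proof.
move=> c0 mH H0.
have n0 : (0 <= ((N c) ^+ 2)^-1)%R by rewrite invr_ge0 exprn_ge0 ?normc_ge0.
rewrite -(ge0_integral_mscale leb2 measurableT (NngNum n0))//.
have mc : measurable_fun [set: R2] (cmul c : R2 -> R2) := @measurable_cmul c.
have := ge0_integral_pushforward mc leb2 (D := setT)
  measurableT mH (fun w _ => H0 w).
rewrite preimage_setT => <-.
by apply: (eq_measure_integral (mscale (NngNum n0) leb2)) => A mA _; exact: leb2_cmul.
Qed.

Lemma integral_area_measure (H : R2 -> \bar R) :
  measurable_fun setT H -> (forall w, 0 <= H w) ->
  (forall w, ~ disc_coord w -> H w = 0) ->
  \int[area_measure R]_w H w = (pi^-1)%:E * \int[leb2]_w H w.
Proof.
move=> mH H0 HD.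
have mD : measurable (@disc_coord R : set R2) by exact: measurable_disc_coord.
have restr (m : {measure set R2 -> \bar R}) :
    \int[m]_w H w = \int[m]_(w in @disc_coord R) H w.
  rewrite [RHS]integral_mkcond; congr integral; apply/funext => w.
  by rewrite patchE; case: ifPn => // /negP wD; rewrite HD// => h; apply: wD; rewrite inE.
have n0 : (0 <= pi^-1 :> R)%R by exact: invr_pi_ge0.
rewrite (restr (area_measure R)) (restr leb2).
have mHD : measurable_fun (@disc_coord R : set R2) H by exact: measurable_funTS.
have /= <- := ge0_integral_mscale leb2 mD (NngNum n0) mHD (fun w _ => H0 w).
apply: eq_measure_integral => A mA AD.
rewrite /area_measure /= /mscale /= /mrestr setIidl//.
Qed.

End planar_measure.

(** * Bergman norm and Taylor coefficients *)

Section energy.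
Variable R : realType.
Local Notation R1 := (measurableTypeR R).
Local Notation R2 := (measurableTypeR R * measurableTypeR R)%type.
Local Notation leb := (@lebesgue_measure R).
Local Notation leb2 := (leb \x leb)%E.
Implicit Types (f h : R[i] -> R[i]) (p : R).

(** Continuous in the disc and extended by zero: the functions on which the
    Bergman norm is computed. *)
Definition disc_function f := (forall z, @unit_disc R z -> {for z, continuous f}) /\
  (forall z, ~ unit_disc z -> f z = 0).

Definition modulus f (w : R2) : R := N (f (complex_of w)).

Lemma modulus_ge0 f w : 0 <= modulus f w.
Proof. exact: normc_ge0. Qed.

Lemma measurable_modulusT f : disc_function f -> measurable_fun [set: R2] (modulus f).
Proof. by move=> [fc f0]; exact: measurable_modulus. Qed.

Lemma modulus_out f w : disc_function f -> ~ disc_coord w -> modulus f w = 0.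
Proof. by move=> [_ f0] Dw; rewrite /modulus f0// Normc.normc0. Qed.

Local Open Scope ereal_scope.

(** The [p]-th power of the Bergman norm, up to the factor [pi].  It is an
    integral over the whole plane because dilations do not preserve the disc. *)
Definition energy p f : \bar R := \int[leb2]_w (modulus f w `^ p)%:E.

Lemma measurable_modulus_powR p f : disc_function f ->
  measurable_fun [set: R2] (fun w => (modulus f w `^ p)%:E).
Proof.
move=> df; apply/measurable_EFinP.
exact: (measurableT_comp (measurable_powR p) (measurable_modulusT df)).
Qed.

Lemma bergman_norm_energy p f : (0 < p)%R -> disc_function f ->
  bergman_norm p f `^ p = (pi^-1)%:E * energy p f.
Proof.
move=> p0 df; rewrite /bergman_norm poweR_Lnorm ?gt_eqF//.
rewrite -(@integral_area_measure R (fun w => (modulus f w `^ p)%:E)).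
- apply: eq_integral => w _.
  by rewrite /= ger0_norm ?normc_ge0.
- exact: measurable_modulus_powR.
- by move=> w; rewrite lee_fin powR_ge0.
- by move=> w Dw; rewrite modulus_out// powR0// gt_eqF.
Qed.

Lemma bergman_norm_lt p f e : (0 < p)%R -> (0 < e)%R -> disc_function f ->
  energy p f < (pi * e `^ p)%:E -> bergman_norm p f < e%:E.
Proof.
move=> p0 e0 df H; rewrite ltNge; apply/negP => le_e.
have : (e `^ p)%:E <= bergman_norm p f `^ p.
  rewrite -poweR_EFin; apply: gt0_ler_poweR => //; rewrite ?in_itv/= ?leey ?andbT.
  - exact: ltW.
  - by rewrite lee_fin ltW.
  - exact: Lnorm_ge0.
rewrite bergman_norm_energy//; apply/negP; rewrite -ltNge.
rewrite muleC -lte_pdivlMr ?invr_gt0 ?pi_gt0//.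
by rewrite invrK -EFinM mulrC.
Qed.

Lemma energy_le p f e : (0 < p)%R -> (0 < e)%R -> disc_function f ->
  bergman_norm p f <= e%:E -> energy p f <= (pi * e `^ p)%:E.
Proof.
move=> p0 e0 df H.
have : bergman_norm p f `^ p <= (e `^ p)%:E.
  rewrite -poweR_EFin; apply: gt0_ler_poweR => //; rewrite ?in_itv/= ?leey ?andbT.
  - exact: ltW.
  - exact: Lnorm_ge0.
  - by rewrite lee_fin ltW.
rewrite bergman_norm_energy// muleC -lee_pdivlMr ?invr_gt0 ?pi_gt0//.
by rewrite invrK -EFinM mulrC.
Qed.

Lemma energy_fin p f : (0 < p)%R -> disc_function f ->
  bergman_norm p f < +oo -> energy p f < +oo.
Proof.
move=> p0 df H; pose e := (1 + fine (bergman_norm p f))%R.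
have e0 : (0 < e)%R by rewrite ltr_pwDl// fine_ge0// Lnorm_ge0.
have /(energy_le p0 e0 df)/le_lt_trans : bergman_norm p f <= e%:E.
  rewrite -[leLHS]fineK; last by rewrite ge0_fin_numE ?Lnorm_ge0.
  by rewrite lee_fin lerDr.
by apply; exact: ltry.
Qed.

(** The disc lies in a square of side [2]. *)
Lemma leb2_disc : leb2 (@disc_coord R) <= 4%:E.
Proof.
pose I : set R1 := `[(-1)%R, 1%R]%classic.
have mI : measurable I by exact: measurable_itv.
have -> : 4%:E = leb2 (I `*` I) :> \bar R.
  rewrite product_measure1E//= !lebesgue_measure_itv/= lte_fin.
  have -> : ((-1 : R) < 1)%R by rewrite (lt_trans (ltrN10 _)).
  by rewrite -!EFinB -EFinM; congr EFin; ring.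
apply: le_measure; rewrite ?inE; [exact: measurable_disc_coord|exact: measurableX|].
move=> [x y] /unit_discE h.
have hx := normc_Re (complex_of (x, y)); have hy := normc_Im (complex_of (x, y)).
split; rewrite /I /= in_itv /= -ler_norml; [exact: le_trans hx (ltW h)|exact: le_trans hy (ltW h)].
Qed.

(** Where [modulus f w] is at least [d] it is at most [d `^ (1 - p)] times its
    power [p], and elsewhere the area of the disc bounds the integral.  This
    replaces Hoelder's inequality. *)
Lemma energy1_le p f (d : R) : (1 <= p)%R -> (0 < d)%R -> disc_function f ->
  \int[leb2]_w (modulus f w)%:E <= (4 * d)%:E + (d `^ (1 - p))%:E * energy p f.
Proof.
move=> p1 d0 df; have p0 : (0 < p)%R by exact: lt_le_trans p1.
have mD := @measurable_disc_coord R.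
have young x : (0 <= x -> x <= d + d `^ (1 - p) * x `^ p)%R.
  move=> x0; have [xd|dx] := lerP x d.
    by rewrite ler_wpDr// mulr_ge0 ?powR_ge0.
  rewrite ler_wpDl ?(ltW d0)//.
  have -> : (d `^ (1 - p) * x `^ p = x * ((x / d) `^ (p - 1)))%R.
    have -> : (x `^ p = x * x `^ (p - 1))%R.
      have x1 : (0 < x)%R by exact: lt_trans dx.
      rewrite -[X in (_ = X * _)%R](powRr1 x0) -powRD; last by rewrite (gt_eqF x1) implybT.
      by rewrite addrC subrK.
    rewrite powRM ?invr_ge0 ?(ltW d0)// -(powR_inv1 (ltW d0)) -powRrM mulN1r opprB.
    by rewrite mulrC mulrA.
  rewrite ler_peMr// -[leLHS](powRr0 (x / d)); apply: ler_powR.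
    by rewrite ler_pdivlMr// mul1r ltW.
  by rewrite subr_ge0.
have -> : \int[leb2]_w (modulus f w)%:E = \int[leb2]_(w in @disc_coord R) (modulus f w)%:E.
  rewrite [RHS]integral_mkcond; apply: eq_integral => w _.
  rewrite patchE; case: ifPn => // /negP wD; rewrite modulus_out// => h.
  by apply: wD; rewrite inE.
have mp := measurable_modulus_powR p df.
apply: (@le_trans _ _ (\int[leb2]_(w in @disc_coord R)
    (d%:E + (d `^ (1 - p))%:E * (modulus f w `^ p)%:E))).
  apply: ge0_le_integral => //.
  - by move=> w _; rewrite lee_fin modulus_ge0.
  - apply: measurable_funTS; apply/measurable_EFinP; exact: measurable_modulusT.
  - apply: emeasurable_funD => //; apply: measurable_funeM; exact: measurable_funTS.
  - by move=> w _; rewrite -EFinM -EFinD lee_fin young// modulus_ge0.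
rewrite ge0_integralD//; last 3 first.
- by move=> w _; rewrite lee_fin ltW.
- by move=> w _; rewrite mule_ge0// lee_fin powR_ge0.
- apply: measurable_funeM; exact: measurable_funTS.
apply: leeD.
  rewrite integral_cst// muleC EFinM; apply: lee_wpmul2r; first by rewrite lee_fin ltW.
  exact: leb2_disc.
rewrite ge0_integralZl//; last 3 first.
- exact: measurable_funTS.
- by move=> w _; rewrite lee_fin powR_ge0.
- by rewrite lee_fin powR_ge0.
apply: lee_wpmul2l; first by rewrite lee_fin powR_ge0.
by apply: ge0_subset_integral => // w _; rewrite lee_fin powR_ge0.
Qed.

End energy.

Section coefficients.
Variable R : realType.
Local Notation R1 := (measurableTypeR R).
Local Notation R2 := (measurableTypeR R * measurableTypeR R)%type.
Local Notation leb := (@lebesgue_measure R).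
Local Notation leb2 := (leb \x leb)%E.
Implicit Types (f h : R[i] -> R[i]) (p : R) (n : nat).

(** [midmean] for real functions, to which moduli are compared. *)
Fixpoint rmidmean n (f : R -> R) (a b : R) : R :=
  if n is n'.+1 then
    (rmidmean n' f a ((a + b) / 2) + rmidmean n' f ((a + b) / 2) b) / 2
  else f ((a + b) / 2).

Lemma normc_midmean n (f : R -> R[i]) a b :
  N (midmean n f a b) <= rmidmean n (fun t => N (f t)) a b.
Proof.
elim: n a b => [|n ih] a b //=.
rewrite Normc.normcM Normc.normcV normc_nat ler_pM2r ?invr_gt0//.
by apply: le_trans (normc_triangle _ _) _; apply: lerD.
Qed.

Lemma rmidmean_ge0 n (f : R -> R) a b : (forall t, 0 <= f t) -> 0 <= rmidmean n f a b.
Proof.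
by move=> f0; elim: n a b => [|n ih] a b //=; rewrite divr_ge0// addr_ge0.
Qed.

Lemma rmidmean_le n (f : R -> R) (c : R) (g : R -> R) a b :
  (forall t, f t <= c * g t) -> rmidmean n f a b <= c * rmidmean n g a b.
Proof.
move=> fg; elim: n a b => [|n ih] a b //=.
by rewrite mulrA ler_pM2r ?invr_gt0// mulrDr lerD.
Qed.

(** Rotations preserve Lebesgue measure, so averaging over them does not
    change the integral. *)
Lemma integral_rmidmean (H : R2 -> R) n a b : measurable_fun setT H ->
  (forall w, 0 <= H w) ->
  let K (w : R2) := rmidmean n (fun t => H (cmul (expi t) w)) a b in
  measurable_fun setT K /\
  (\int[leb2]_w (K w)%:E = \int[leb2]_w (H w)%:E)%E.
Proof.
move=> mH H0; elim: n a b => [|n ih] a b /=.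
  split; first exact: (measurableT_comp mH (@measurable_cmul R _)).
  rewrite (@integral_cmul R _ (fun w => (H w)%:E)) ?expi_neq0//.
  - by rewrite normc_expi expr1n invr1 mul1e.
  - exact/measurable_EFinP.
have [m1 i1] := ih a ((a + b) / 2); have [m2 i2] := ih ((a + b) / 2) b.
have K0 c d w : (0 <= (rmidmean n (fun t => H (cmul (expi t) w)) c d)%:E)%E.
  by rewrite lee_fin rmidmean_ge0.
split; first by apply: measurable_funM => //; exact: measurable_funD.
under eq_integral => w _ do rewrite mulrC EFinM EFinD.
rewrite ge0_integralZl//; last 2 first.
- by apply: emeasurable_funD; exact/measurable_EFinP.
- by move=> w _; rewrite adde_ge0.
rewrite ge0_integralD//; [|exact/measurable_EFinP|exact/measurable_EFinP].
rewrite i1 i2; set I := (\int[_]_w _)%E.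
have : (0 <= I)%E by apply: integral_ge0 => w _; rewrite lee_fin.
case: I => [r| |] // _; last by rewrite addye// gt0_muley.
by rewrite -EFinD -EFinM; congr EFin; field.
Qed.

Lemma limn_einf_ge (u : nat -> \bar R) (a : \bar R) :
  (\forall n \near \oo, (a <= u n)%E) -> (a <= limn_einf u)%E.
Proof.
move=> [n0 _ ua]; rewrite limn_einf_lim; apply: lime_ge.
  exact: is_cvg_einfs.
exists n0 => // n /= n0n; apply: le_ereal_inf_tmp => _ [k /= nk <-].
by apply: ua; rewrite /= (leq_trans n0n).
Qed.

(** The [k]-th coefficient is a limit of means of [h z * z ^- k] over circles,
    hence bounded by averages of [N (h z)] over rotations.  Integrating these
    over a fixed square away from [0] gives a bound by the planar integral,
    with Fatou's lemma to exchange limit and integral. *)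
Lemma taylor_coef_le_integral h k : disc_function h ->
  holomorphic_on (@unit_disc R) h ->
  ((N (taylor_coef h k) / (32 * 4 ^+ k))%:E <= \int[leb2]_w (modulus h w)%:E)%E.
Proof.
move=> dh hh; set c := N _.
have mM := measurable_modulusT dh.
have M0 w : (0 <= (modulus h w)%:E)%E by rewrite lee_fin modulus_ge0.
have [c0|c0] := leP c 0.
  have -> : c = 0 by apply/eqP; rewrite eq_le c0 normc_ge0.
  by rewrite mul0r; apply: integral_ge0 => w _; exact: M0.
pose K n (w : R2) := rmidmean n (fun t => modulus h (cmul (expi t) w)) 0 (2 * pi).
have KP n := integral_rmidmean n 0 (2 * pi) mM (fun w => modulus_ge0 h w).
have K0 n w : (0 <= (K n w)%:E)%E by rewrite lee_fin rmidmean_ge0// => t; exact: modulus_ge0.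
(* The square [B] of area [1 / 16] lies in the annulus [4^-1 <= N z < 1]. *)
pose Bx : set R1 := `[4^-1, 2^-1]%classic; pose By : set R1 := `[0, 4^-1]%classic.
pose B : set R2 := Bx `*` By.
have mBx : measurable Bx by exact: measurable_itv.
have mBy : measurable By by exact: measurable_itv.
have mB : measurable B by exact: measurableX.
have lB : leb2 B = (16^-1)%:E.
  rewrite /B product_measure1E//= !lebesgue_measure_itv/= !lte_fin invr_gt0 ltr0n.
  by rewrite ltf_pV2 ?posrE// ltr_nat/= -!EFinB -EFinM; congr EFin; field.
have BN w : B w -> 4^-1 <= N (complex_of w) < 1.
  have hR : `|w.1| <= N (complex_of w) := normc_Re (complex_of w).
  have hN : N (complex_of w) <= `|w.1| + `|w.2| := normc_complex_of w.
  move: (N (complex_of w)) hR hN => X hR hN [].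
  rewrite /Bx /By /= !in_itv/= => /andP[x1 x2] /andP[y1 y2].
  have p4 : 0 < 4^-1 :> R by rewrite invr_gt0.
  have px : 0 <= w.1 by lra.
  rewrite (ger0_norm px) in hR; rewrite (ger0_norm px) (ger0_norm y1) in hN.
  by apply/andP; split; lra.
have lim w : B w -> \forall n \near \oo, c / 2 <= 4 ^+ k * K n w.
  move=> /BN/andP[w4 w1]; have p4 : 0 < 4^-1 :> R by rewrite invr_gt0.
  have w0 : 0 < N (complex_of w) by exact: lt_le_trans w4.
  have w01 : 0 < N (complex_of w) < 1 by rewrite w0.
  have := taylor_coef_mean (k := k) hh w01.
  have c2 : 0 < c / 2 by rewrite divr_gt0.
  move=> /cvg_normcP/(_ _ c2); apply: filterS => n hn.
  have : c / 2 <= N (circle_mean n (fun z => h z * z ^- k) (complex_of w)).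
    have := normc_subl (taylor_coef h k)
      (circle_mean n (fun z => h z * z ^- k) (complex_of w)).
    by rewrite normcB in hn; move: hn; rewrite -/c; lra.
  move=> /le_trans; apply; apply: le_trans (normc_midmean _ _ _ _) _.
  apply: rmidmean_le => t; rewrite Normc.normcM Normc.normcV normcX normc_mul_expi.
  rewrite /modulus complex_of_cmul (mulrC (expi t)) [leLHS]mulrC ler_wpM2r ?normc_ge0//.
  rewrite -exprVn; apply: lerXn2r; rewrite ?nnegrE ?invr_ge0 ?(ltW w0)//.
  by rewrite -(invrK 4) lef_pV2 ?posrE ?invrK.
have pk : 0 < 4 ^+ k :> R by rewrite exprn_gt0.
have mK n : measurable_fun B (fun w => (4 ^+ k * K n w)%:E).
  apply: measurable_funTS; apply/measurable_EFinP.
  by apply: measurable_funM => //; exact: (KP n).1.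
have KB0 n w : B w -> (0 <= (4 ^+ k * K n w)%:E)%E.
  by move=> _; rewrite EFinM mule_ge0// lee_fin ltW.
have F := @fatou _ _ _ leb2 B mB (fun n w => (4 ^+ k * K n w)%:E) mK KB0.
have I0 : (0 <= \int[leb2]_w (modulus h w)%:E)%E by apply: integral_ge0 => w _; exact: M0.
have low : ((c / 32)%:E <= \int[leb2]_(w in B) limn_einf (fun n => (4 ^+ k * K n w)%:E))%E.
  apply: (@le_trans _ _ (\int[leb2]_(w in B) cst (c / 2)%:E w)%E).
    rewrite integral_cst// [leRHS](_ : _ = (c / 2 * 16^-1)%:E).
      by rewrite lee_fin; lra.
    by rewrite [RHS]EFinM; congr (_ * _)%E; exact: lB.
  apply: ge0_le_integral => //.
  - by move=> w _; rewrite lee_fin divr_ge0// ltW.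
  - rewrite (_ : (fun w => _) = (fun w => - limn_esup (fun n => - (4 ^+ k * K n w)%:E)))%E.
      apply: measurableT_comp => //; apply: measurable_fun_limn_esup => n.
      exact: measurableT_comp.
    apply/funext => w; rewrite -limn_einfN; congr limn_einf.
    by apply/funext => n /=; rewrite opprK.
  - move=> w /lim Bw; apply: limn_einf_ge; apply: filterS Bw => n h'.
    by rewrite lee_fin.
have up n : (\int[leb2]_(w in B) (4 ^+ k * K n w)%:E <=
    (4 ^+ k)%:E * \int[leb2]_w (modulus h w)%:E)%E.
  rewrite -(KP n).2 -ge0_integralZl//; last 2 first.
  - by apply/measurable_EFinP; exact: (KP n).1.
  - by move=> w _; exact: K0.
  under [leRHS]eq_integral => w _ do rewrite -EFinM.
  apply: ge0_subset_integral => //.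
    apply/measurable_EFinP; apply: measurable_funM => //; exact: (KP n).1.
  by move=> w _; rewrite EFinM mule_ge0// lee_fin ltW.
have {up} : ((c / 32)%:E <= (4 ^+ k)%:E * \int[leb2]_w (modulus h w)%:E)%E.
  apply: le_trans low (le_trans F _); rewrite limn_einf_lim.
  apply: lime_le; first exact: is_cvg_einfs.
  apply: nearW => n; apply: le_trans (up n); apply: ereal_inf_lbound.
  by exists n => /=.
have : (0 <= \int[leb2]_w (modulus h w)%:E)%E by apply: integral_ge0 => w _; exact: M0.
case: (\int[leb2]_w (modulus h w)%:E)%E => [r| |] // _; last by rewrite leey.
rewrite -EFinM !lee_fin => H; rewrite invfM mulrA ler_pdivrMr//.
by rewrite (mulrC r).
Qed.

(** Bergman norm convergence implies convergence of each Taylor coefficient: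
    the coefficient is bounded by the first power integral, and that one by an
    arbitrarily small constant plus a multiple of the [p]-th power integral. *)
Lemma taylor_coef_continuous p k e : 1 <= p -> 0 < e -> exists2 d, 0 < d &
  forall h, disc_function h -> holomorphic_on (@unit_disc R) h ->
    (bergman_norm p h < d%:E)%E -> N (taylor_coef h k) < e.
Proof.
move=> p1 e0; have p0 : 0 < p by exact: lt_le_trans p1.
pose A : R := 32 * 4 ^+ k; have A0 : 0 < A by rewrite /A mulr_gt0// exprn_gt0.
have [s sE] : exists s, s = e / (6 * A) by eexists.
have s0 : 0 < s by rewrite sE divr_gt0// mulr_gt0.
pose q := s / s `^ (1 - p) / pi.
have q0 : 0 < q by rewrite /q !divr_gt0// ?powR_gt0// pi_gt0.
exists (q `^ p^-1); first exact: powR_gt0.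
move=> h dh hh /ltW /(energy_le p0 (powR_gt0 _ q0) dh) E.
have := le_trans (taylor_coef_le_integral k dh hh) (energy1_le p1 s0 dh).
rewrite -powRrM mulVf ?gt_eqF// powRr1 ?(ltW q0)// in E.
move=> /le_trans => /(_ ((4 * s)%:E + (s `^ (1 - p))%:E * (pi * q)%:E)%E) H.
have : ((N (taylor_coef h k) / (32 * 4 ^+ k))%:E <=
    (4 * s)%:E + (s `^ (1 - p))%:E * (pi * q)%:E)%E.
  by apply: H; apply: leeD2l; apply: lee_wpmul2l => //; rewrite lee_fin powR_ge0.
rewrite -EFinM -EFinD lee_fin -/A ler_pdivrMr// => /le_lt_trans; apply.
have sp : 0 < s `^ (1 - p) by exact: powR_gt0.
have -> : s `^ (1 - p) * (pi * q) = s.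
  have pn : pi != 0 :> R by rewrite gt_eqF ?pi_gt0.
  by rewrite /q (mulrC pi) divfK// mulrC divfK// gt_eqF.
have -> : (4 * s + s) * A = 5 / 6 * e by rewrite sE; field; rewrite gt_eqF.
by lra.
Qed.

End coefficients.

(** * Polynomials in Bergman spaces *)

Section disc_polynomials.
Variable R : realType.
Implicit Types (P Q : {poly R[i]}) (z w : R[i]) (p : R).

Lemma horner_cderiv P z : exists l, cderiv (horner P) z l.
Proof.
elim/poly_ind: P => [|P c [l ih]].
  exists 0; apply: cderiv_eq (cderiv_cst 0 z).
  by apply/near_normcP; exists 1 => // w _; rewrite horner0.
eexists; apply: cderiv_eq (cderivD (cderivM ih (cderiv_id z)) (cderiv_cst c z)).
by apply/near_normcP; exists 1 => // w _; rewrite hornerMXaddC.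
Qed.

(** The element of the Bergman space defined by a polynomial, extended by zero
    like all elements. *)
Definition disc_poly P z : R[i] := if N z < 1 then P.[z] else 0.

Lemma disc_poly_holomorphic P : holomorphic_on (@unit_disc R) (disc_poly P).
Proof.
move=> z /unit_discE z1; have [l Pl] := horner_cderiv P z.
apply: (cderiv_derivable (cderiv_eq _ Pl)).1.
apply/near_normcP; exists (1 - N z); first by rewrite subr_gt0.
move=> w wz; rewrite /disc_poly ifT//.
by have := normc_triangle (w - z) z; rewrite subrK; lra.
Qed.

Lemma disc_poly_out P z : ~ unit_disc z -> disc_poly P z = 0.
Proof. by move=> /unit_discE/negP z1; rewrite /disc_poly (negbTE z1). Qed.

Lemma disc_poly_disc_function P : disc_function (disc_poly P).
Proof.
split; last exact: disc_poly_out.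
by move=> z Dz; apply/derivable_continuous/disc_poly_holomorphic.
Qed.

Lemma disc_polyB P Q z : disc_poly (P - Q) z = disc_poly P z - disc_poly Q z.
Proof. by rewrite /disc_poly; case: ifP => _; rewrite ?hornerD ?hornerN ?subr0. Qed.

Lemma taylor_coef_disc_poly P k : taylor_coef (disc_poly P) k = P`_k.
Proof.
pose w : R[i] := (2^-1)%:C.
have Nw : N w = 2^-1 by rewrite normc_real ger0_norm.
have w01 : 0 < N w < 1 by rewrite Nw invr_gt0 invf_lt1 ?ltr0n ?ltr1n.
have lim := taylor_coef_mean (k := k) (@disc_poly_holomorphic P) w01.
pose m := maxn (size P) k.+1.
have PE z : P.[z] = \sum_(j < m) P`_j * z ^+ j.
  by apply: horner_coef_wide; exact: leq_maxl.
suff E : \forall n \near \oo,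
    circle_mean n (fun z => disc_poly P z * z ^- k) w = P`_k.
  apply/eqP; rewrite -subr_eq0 -normc_eq0; apply/eqP/le_anti; rewrite normc_ge0 andbT.
  apply: (cvg_normc_le (cvg_complexB lim (cvg_cst P`_k))).
  by apply: filterS E => n ->; rewrite subrr Normc.normc0.
exists m => // n /= mn.
have small i : (i < m)%N -> (i < 2 ^ n)%N.
  move=> im; apply: leq_trans im (leq_trans mn _); exact: ltnW (ltn_expl _ _).
rewrite (@eq_circle_mean _ n _ (fun z => \sum_(j < m) P`_j * (z ^+ j * z ^- k))); last first.
  move=> z zw; rewrite /disc_poly zw (andP w01).2 PE mulr_suml.
  by apply: eq_bigr => j _; rewrite mulrA.
have km : (k < m)%N by exact: leq_maxr.
rewrite circle_mean_sum (bigD1 (Ordinal km)) //= big1 ?addr0 => [|j jk].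
  rewrite circle_meanZ -[RHS]mulr1; congr (_ * _).
  rewrite -[RHS](circle_mean_cst n 1 w); apply: eq_circle_mean => z zw.
  by rewrite divff// expf_neq0// -normc_gt0 zw; case/andP: w01.
rewrite circle_meanZ; have {}jk : (j != k :> nat) by [].
have z0 z : N z = N w -> z != 0 by move=> zw; rewrite -normc_gt0 zw; case/andP: w01.
have [kj|jk'] := ltnP k j.
  rewrite (@eq_circle_mean _ n _ (fun z => z ^+ (j - k))); last first.
    by move=> z /z0 z0'; rewrite expfB.
  rewrite circle_mean_expr ?mulr0// subn_gt0 kj small//.
  by apply: leq_ltn_trans (leq_subr _ _) _.
have {jk jk'} jk : (j < k)%N by rewrite ltn_neqAle jk.
rewrite (@eq_circle_mean _ n _ (fun z => z ^- (k - j))); last first.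
  by move=> z /z0 z0'; rewrite expfB// invfM invrK mulrC.
rewrite circle_mean_exprV ?mulr0// subn_gt0 jk small//.
by apply: leq_ltn_trans (leq_subr _ _) _.
Qed.

Lemma taylor_sum_disc_poly P n z : (size P <= n.+1)%N ->
  taylor_sum (disc_poly P) n z = P.[z].
Proof.
move=> Pn; rewrite taylor_sumE (horner_coef_wide z Pn).
by apply: eq_bigr => k _; rewrite taylor_coef_disc_poly.
Qed.

Lemma normc_horner_le P z r : N z <= r ->
  N P.[z] <= \sum_(j < size P) N P`_j * r ^+ j.
Proof.
move=> zr; rewrite horner_coef; apply: le_trans (normc_sum _ _) _.
apply: ler_sum => j _; rewrite Normc.normcM normcX ler_wpM2l ?normc_ge0//.
by apply: lerXn2r; rewrite ?nnegrE ?normc_ge0 ?(le_trans (normc_ge0 z)).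
Qed.

End disc_polynomials.

Section polynomials_dense.
Variable R : realType.
Local Notation R1 := (measurableTypeR R).
Local Notation R2 := (measurableTypeR R * measurableTypeR R)%type.
Local Notation leb := (@lebesgue_measure R).
Local Notation leb2 := (leb \x leb)%E.
Implicit Types (f h : R[i] -> R[i]) (p r : R) (n : nat) (V : R2 -> R).

Definition outside r : set R2 := [set w | r < N (complex_of w)].

Lemma measurable_outside r : measurable (outside r).
Proof.
apply: open_measurable_prod.
have -> : outside r = @complex_of R @^-1` [set z | r < N z] by [].
apply: (proj1 (continuousP _) (@continuous_complex_of R)).
rewrite openE => z /= rz; apply/near_normcP; exists (N z - r); first by rewrite subr_gt0.
move=> w /=; rewrite normcB => h; have := normc_subl z (z - w).
by rewrite opprB addrCA subrr addr0; lra.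
Qed.

(** Dominated convergence: no point of the disc remains outside all smaller
    concentric discs. *)
Lemma near_boundary_small V e : measurable_fun setT V -> (forall w, 0 <= V w) ->
  (forall w, ~ disc_coord w -> V w = 0) ->
  (\int[leb2]_w (V w)%:E < +oo)%E -> 0 < e ->
  exists2 r, 0 < r < 1 & (\int[leb2]_w (V w * \1_(outside r) w)%:E < e%:E)%E.
Proof.
move=> mV V0 VD Vfin e0.
pose s n : R := 1 - n.+2%:R^-1.
have s01 n : 0 < s n < 1.
  rewrite /s subr_gt0 invf_lt1 ?ltr1n// ltrBlDr ltrDl invr_gt0 ltr0n.
  by [].
have mC n : measurable_fun setT (fun w => (V w * \1_(outside (s n)) w)%:E).
  apply/measurable_EFinP; apply: measurable_funM => //.
  exact: measurable_indic (measurable_outside _).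
have := @dominated_cvg _ _ _ leb2 setT measurableT
  (fun n w => (V w * \1_(outside (s n)) w)%:E) (cst 0%E) (fun w => (V w)%:E) mC.
move=> H; have {H} : (\int[leb2]_w (V w * \1_(outside (s n)) w)%:E @[n --> \oo] -->
    \int[leb2]_w (cst 0 w))%E.
  apply: H => //.
  - move=> w _; have [Dw|Dw] := pselect (disc_coord w); last first.
      by under eq_fun do rewrite VD// mul0r; exact: cvg_cst.
    apply: cvg_near_cst; have /unit_discE w1 := Dw.
    have p : 0 < 1 - N (complex_of w) by rewrite subr_gt0.
    have [k _ kP] := near_infty_natSinv_lt (PosNum p).
    exists k => // n /= kn; rewrite indicE memNset ?mulr0// /outside /= => h.
    have h1 : n.+2%:R^-1 <= n.+1%:R^-1 :> R by rewrite lef_pV2 ?posrE// ler_nat.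
    have := le_lt_trans h1 (kP n kn).
    by rewrite /= ltrBrDl -ltrBrDr ltNge (ltW h).
  - apply/integrableP; split; first exact/measurable_EFinP.
    by under eq_integral => w _ do rewrite gee0_abs ?lee_fin//.
  - move=> n w _; rewrite gee0_abs ?lee_fin ?mulr_ge0 ?V0//.
    by rewrite ler_piMr// indicE; case: (_ \in _); rewrite ?ler01.
rewrite integral0 => /fine_cvgP[fin /cvgr_lt/(_ _ e0) lim].
have [n [fn ln]] : exists n, (\int[leb2]_w (V w * \1_(outside (s n)) w)%:E)%E \is a fin_num
    /\ fine (\int[leb2]_w (V w * \1_(outside (s n)) w)%:E)%E < e.
  by near \oo => n; exists n; split; near: n; [exact: fin|exact: lim].
exists (s n); first exact: s01.
by rewrite -(fineK fn) lte_fin.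
Unshelve. all: by end_near. Qed.

Lemma energy_bounded p f (M : R) : disc_function f -> 0 < p ->
  (forall w, modulus f w <= M) -> (energy p f <= (4 * M `^ p)%:E)%E.
Proof.
move=> df p0 fM; have M0 : 0 <= M := le_trans (normc_ge0 _) (fM (0, 0)).
rewrite /energy; have mD := @measurable_disc_coord R.
rewrite (_ : (\int[_]_w _)%E = (\int[leb2]_(w in @disc_coord R) (modulus f w `^ p)%:E)%E).
  apply: (@le_trans _ _ (\int[leb2]_(w in @disc_coord R) cst (M `^ p)%:E w)%E).
    apply: ge0_le_integral => //.
    - by move=> w _; rewrite lee_fin powR_ge0.
    - by apply: measurable_funTS; exact: measurable_modulus_powR.
    - by move=> w _; rewrite lee_fin ge0_ler_powR ?nnegrE ?modulus_ge0 ?(ltW p0).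
  rewrite integral_cst// muleC EFinM; apply: lee_wpmul2r; last exact: leb2_disc.
  by rewrite lee_fin powR_ge0.
rewrite [RHS]integral_mkcond; apply: eq_integral => w _.
rewrite patchE; case: ifPn => // /negP wD; rewrite modulus_out ?powR0 ?gt_eqF// => h.
by apply: wD; rewrite inE.
Qed.

Lemma bergman_norm_bounded p f (M : R) : disc_function f -> 0 < p ->
  (forall w, modulus f w <= M) -> (bergman_norm p f < +oo)%E.
Proof.
move=> df p0 fM; have M0 : 0 <= M := le_trans (normc_ge0 _) (fM (0, 0)).
pose e := (4 * M `^ p + 1) `^ p^-1.
have q0 : 0 < 4 * M `^ p + 1 by rewrite ltr_wpDl// mulr_ge0 ?powR_ge0.
have e0 : 0 < e by exact: powR_gt0.
apply: (@lt_trans _ _ e%:E); last exact: ltry.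
apply: bergman_norm_lt => //; apply: le_lt_trans (energy_bounded df p0 fM) _.
rewrite lte_fin /e -powRrM mulVf ?gt_eqF// powRr1 ?(ltW q0)//.
apply: (@lt_le_trans _ _ (4 * M `^ p + 1)); first by rewrite ltrDl.
by rewrite ler_peMl ?(ltW q0)//; have := @pi_ge2 R; lra.
Qed.

Lemma disc_poly_bounded (P : {poly R[i]}) : exists M, forall z, N (disc_poly P z) <= M.
Proof.
exists (\sum_(j < size P) N P`_j * 1 ^+ j) => z; rewrite /disc_poly.
case: ifPn => [/ltW|_]; first exact: normc_horner_le.
by rewrite Normc.normc0; apply: sumr_ge0 => j _; rewrite expr1n mulr1 normc_ge0.
Qed.

Lemma disc_poly_finite p (P : {poly R[i]}) : 0 < p -> (bergman_norm p (disc_poly P) < +oo)%E.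
Proof.
move=> p0; have [M MP] := disc_poly_bounded P.
exact: (bergman_norm_bounded (disc_poly_disc_function P) p0 (fun w => MP (complex_of w))).
Qed.

End polynomials_dense.

Section density.
Variable R : realType.
Local Notation R1 := (measurableTypeR R).
Local Notation R2 := (measurableTypeR R * measurableTypeR R)%type.
Local Notation leb := (@lebesgue_measure R).
Local Notation leb2 := (leb \x leb)%E.
Implicit Types (f h : R[i] -> R[i]) (p r : R) (n : nat) (G : R2 -> R).

Lemma cderivB f h z l m :
  cderiv f z l -> cderiv h z m -> cderiv (fun w => f w - h w) z (l - m).
Proof.
move=> fl hm; have := cderivD fl (cderivM (cderiv_cst (-1) z) hm).
rewrite mul0r add0r mulN1r; apply: cderiv_eq.
by apply/near_normcP; exists 1 => // w _; rewrite mulN1r.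
Qed.

Lemma holomorphicB (f g : R[i] -> R[i]) : holomorphic_on (@unit_disc R) f ->
  holomorphic_on (@unit_disc R) g ->
  holomorphic_on (@unit_disc R) (fun z => f z - g z).
Proof.
move=> hf hg z Dz.
exact: (cderiv_derivable
  (cderivB (derivable_cderiv (hf z Dz)) (derivable_cderiv (hg z Dz)))).1.
Qed.

Lemma holomorphic_disc_function f : holomorphic_on (@unit_disc R) f ->
  (forall z, ~ unit_disc z -> f z = 0) -> disc_function f.
Proof.
move=> hf f0; split; last exact: f0.
move=> z Dz; exact: derivable_continuous (hf z Dz).
Qed.

(** The constant [4] is the bound for the area of the disc. *)
Lemma energy_split p f G A B : disc_function f -> 0 <= A -> 0 <= B ->
  measurable_fun setT G -> (forall w, 0 <= G w) ->
  (forall w, modulus f w `^ p <= A * \1_(@disc_coord R) w + B * G w) ->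
  (energy p f <= (4 * A)%:E + B%:E * \int[leb2]_w (G w)%:E)%E.
Proof.
move=> df A0 B0 mG G0 fG; have mD := @measurable_disc_coord R.
have mI : measurable_fun [set: R2] (fun w => (\1_(@disc_coord R) w)%:E : \bar R).
  by apply/measurable_EFinP; exact: measurable_indic.
have mGE : measurable_fun [set: R2] (fun w => (G w)%:E) by exact/measurable_EFinP.
have I0 w : (0 <= (\1_(@disc_coord R) w)%:E :> \bar R)%E by rewrite lee_fin.
apply: (@le_trans _ _ (\int[leb2]_w (A%:E * (\1_(@disc_coord R) w)%:E + B%:E * (G w)%:E))%E).
  apply: ge0_le_integral => //.
  - by move=> w _; rewrite lee_fin powR_ge0.
  - exact: measurable_modulus_powR.
  - by apply: emeasurable_funD; apply: measurable_funeM.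
  - by move=> w _; rewrite -!EFinM -EFinD lee_fin.
rewrite ge0_integralD//; last 4 first.
- by move=> w _; rewrite mule_ge0.
- exact: measurable_funeM.
- by move=> w _; rewrite mule_ge0 ?lee_fin.
- exact: measurable_funeM.
rewrite ge0_integralZl// ge0_integralZl//; last first.
  by move=> w _; rewrite lee_fin.
apply: leeD2r; rewrite integral_indic// setIT muleC EFinM.
by apply: lee_wpmul2r; rewrite ?lee_fin//; exact: leb2_disc.
Qed.

Lemma indic_disc w : \1_(@disc_coord R) w = (N (complex_of w) < 1)%R%:R :> R.
Proof.
rewrite indicE; congr (_%:R); congr nat_of_bool; apply/idP/idP; rewrite inE.
  by move/unit_discE.
by move=> h; apply/unit_discE.
Qed.

(** Such an [h] is bounded by [C] on a thin annulus at the unit circle, which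
    has small area, and for large [L] it is uniformly small inside. *)
Lemma bergman_norm_expr_small p C e : 1 <= p -> 0 < C -> 0 < e ->
  \forall L \near \oo, forall h, disc_function h ->
    (forall z, N z < 1 -> N (h z) <= C * N z ^+ L) -> (bergman_norm p h < e%:E)%E.
Proof.
move=> p1 C0 e0; have p0 : 0 < p by exact: lt_le_trans p1.
have mD := @measurable_disc_coord R.
have [T [T0 TE]] : exists T, 0 < T /\ T = pi * e `^ p.
  by eexists; split; last reflexivity; rewrite mulr_gt0 ?pi_gt0 ?powR_gt0.
have [r /andP[r0 r1]] : exists2 r, 0 < r < 1 &
    (\int[leb2]_w (\1_(@disc_coord R) w * \1_(outside r) w)%:E < (T / (2 * C `^ p))%:E)%E.
  apply: near_boundary_small => //.
  - by move=> w Dw; rewrite indicE memNset.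
  - by rewrite integral_indic// setIT (le_lt_trans (leb2_disc _))// ltry.
  - by rewrite divr_gt0// mulr_gt0// powR_gt0.
set I := (\int[_]_w _)%E => It.
have q1 : 0 <= r < 1 by rewrite ltW.
have s0 : 0 < (T / 16) `^ p^-1 by rewrite powR_gt0// divr_gt0.
have := near_mul_expr_lt C q1 s0; apply: filterS => L hL h dh hz.
apply: (bergman_norm_lt p0 e0 dh); rewrite -TE.
pose G (w : R2) := \1_(@disc_coord R) w * \1_(outside r) w : R.
have mG : measurable_fun setT G.
  by apply: measurable_funM; apply: measurable_indic => //; exact: measurable_outside.
have G0 w : 0 <= G w by rewrite mulr_ge0.
have := @energy_split p h G (T / 16) (C `^ p) dh _ (powR_ge0 _ _) mG G0.
move=> H; apply: le_lt_trans (H _ _) _.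
- by rewrite divr_ge0// ltW.
- move=> w; rewrite /G indic_disc; case: ltP => [w1|w1]; last first.
    rewrite !mul0r !mulr0 addr0 /modulus dh.2 ?Normc.normc0 ?powR0 ?gt_eqF//.
    by move/unit_discE; rewrite ltNge w1.
  rewrite mul1r mulr1 indicE /modulus.
  have [wr|wr] := leP (N (complex_of w)) r.
    rewrite memNset /=; last by rewrite /outside /= => /lt_le_trans => /(_ _ wr); rewrite ltxx.
    rewrite mulr0 addr0.
    have -> : T / 16 = ((T / 16) `^ p^-1) `^ p.
      by rewrite -powRrM mulVf ?gt_eqF// powRr1// divr_ge0// ltW.
    apply: ge0_ler_powR; rewrite ?nnegrE ?normc_ge0 ?powR_ge0 ?(ltW p0)//.
    apply: le_trans (hz _ w1) (le_trans _ (ltW hL)); rewrite ler_pM2l//.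
    by apply: lerXn2r; rewrite ?nnegrE ?normc_ge0 ?(ltW r0).
  rewrite mem_set//= mulr1 ler_wpDl ?divr_ge0 ?(ltW T0)//.
  apply: ge0_ler_powR; rewrite ?nnegrE ?normc_ge0 ?(ltW p0) ?(ltW C0)//.
  apply: le_trans (hz _ w1) _; rewrite ler_piMr ?(ltW C0)//.
  by rewrite exprn_ile1 ?normc_ge0 ?(ltW w1).
have Cp : 0 < C `^ p by exact: powR_gt0.
have I0 : (0 <= I)%E by apply: integral_ge0 => w _; rewrite lee_fin G0.
rewrite -/I; case: I It I0 => // x; rewrite lte_fin => xT _.
rewrite -EFinM -EFinD lte_fin.
have : C `^ p * x < T / 2.
  by rewrite mulrC -ltr_pdivlMr// -mulrA -invfM.
by move: T0; lra.
Qed.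

Lemma powR_sum3 p (a b c : R) : 0 <= p -> 0 <= a -> 0 <= b -> 0 <= c ->
  (a + b + c) `^ p <= 4 `^ p * (a `^ p + b `^ p + c `^ p).
Proof.
move=> p0 a0 b0 c0.
have [m [m0 mab mle]] : exists m, [/\ 0 <= m, a + b + c <= 4 * m &
    m `^ p <= a `^ p + b `^ p + c `^ p].
  have pa := powR_ge0 a p; have pb := powR_ge0 b p; have pc := powR_ge0 c p.
  have [ab|ba] := leP a b; [have [bc|cb] := leP b c|have [ac|ca] := leP a c].
  - by exists c; split; lra.
  - by exists b; split; lra.
  - by exists c; split; lra.
  - by exists a; split; lra.
apply: (@le_trans _ _ ((4 * m) `^ p)).
  by apply: ge0_ler_powR; rewrite ?nnegrE ?addr_ge0 ?mulr_ge0.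
by rewrite powRM// ler_wpM2l// powR_ge0.
Qed.

Lemma one_sub_expr_le (r : R) n : 0 <= r <= 1 -> 1 - r ^+ n <= n%:R * (1 - r).
Proof.
move=> /andP[r0 r1]; elim: n => [|n ih]; first by rewrite expr0 subrr mul0r.
have rn : r ^+ n <= 1 by rewrite exprn_ile1.
have rn0 : 0 <= r ^+ n by rewrite exprn_ge0.
rewrite exprS -natr1 mulrDl mul1r.
have -> : 1 - r * r ^+ n = (1 - r ^+ n) + r ^+ n * (1 - r) by ring.
by apply: lerD => //; rewrite ler_piMl// subr_ge0.
Qed.

Lemma horner_dilation (P : {poly R[i]}) e : 0 < e -> exists2 d, 0 < d < 1 &
  forall r z, d <= r <= 1 -> N z <= 1 -> N (P.[z] - P.[r%:C * z]) <= e.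
Proof.
move=> e0; pose K := \sum_(k < size P) N P`_k * k%:R + 1.
have K0 : 0 < K.
  by rewrite ltr_wpDl//; apply: sumr_ge0 => k _; rewrite mulr_ge0 ?normc_ge0.
have [s [s0 s1 sK]] : exists s, [/\ 0 < s, s < 1 & s * K <= e].
  exists (Order.min (1 / 2) (e / K)).
  rewrite lt_min !divr_gt0// gt_min -ler_pdivlMr// ge_min lexx orbT; split => //.
  by apply/orP; left; lra.
exists (1 - s); first by apply/andP; split; lra.
move=> r z /andP[sr r1] z1; have r0 : 0 <= r by lra.
rewrite !horner_coef -sumrB; apply: le_trans (normc_sum _ _) _.
apply: (@le_trans _ _ (\sum_(k < size P) N P`_k * k%:R * s)).
  apply: ler_sum => k _; rewrite exprMn -rmorphXn/= -mulrBr Normc.normcM.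
  have -> : z ^+ k - (r ^+ k)%:C * z ^+ k = (1 - r ^+ k)%:C * z ^+ k.
    by rewrite rmorphB rmorph1; ring.
  have rk : r ^+ k <= 1 by rewrite exprn_ile1.
  rewrite -mulrA ler_wpM2l ?normc_ge0// Normc.normcM normc_real ger0_norm ?subr_ge0//.
  apply: (@le_trans _ _ (1 - r ^+ k)).
    by rewrite ler_piMr ?subr_ge0// normcX exprn_ile1 ?normc_ge0.
  apply: le_trans (one_sub_expr_le _ _) _; first by rewrite r0.
  by apply: ler_wpM2l => //; lra.
rewrite -mulr_suml; apply: le_trans sK; rewrite mulrC ler_wpM2l ?(ltW s0)//.
by rewrite lerDl.
Qed.

Definition taylor_poly f n : {poly R[i]} := \poly_(k < n.+1) taylor_coef f k.

Lemma horner_taylor_poly f n z : (taylor_poly f n).[z] = taylor_sum f n z.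
Proof. by rewrite horner_poly taylor_sumE. Qed.

Lemma normc_triangle4 (x y u v s : R[i]) :
  N (x - y) <= N (u - x) + N (u - v) + N (v - s) + N (y - s).
Proof.
rewrite (normcB u x) (normcB y s).
apply: le_trans (normc_triangleBr x y u) _; rewrite -!addrA lerD2l.
apply: le_trans (normc_triangleBr u y v) _; rewrite lerD2l.
exact: normc_triangleBr.
Qed.

Lemma normc_triangle3 (x y s : R[i]) : N (x - y) <= N x + N s + N (y - s).
Proof.
rewrite (normcB y s); apply: le_trans (normc_triangleBr x y s) _.
by rewrite lerD2r normc_triangleB.
Qed.

(** For [r] close to [1] the dilate [f (r z)] is close to [f]: uniformly on a
    smaller disc, and in norm near the circle because both functions have small
    integrals there.  The dilate is uniformly close to its Taylor sums. *)
Lemma polynomials_dense p f e : 1 <= p -> 0 < e -> disc_function f ->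
  holomorphic_on (@unit_disc R) f -> (bergman_norm p f < +oo)%E ->
  exists P, (bergman_norm p (fun z => (f z - disc_poly P z)%R) < e%:E)%E.
Proof.
move=> p1 e0 df hf ffin; have p0 : 0 < p by exact: lt_le_trans p1.
have [T [T0 TE]] : exists T, 0 < T /\ T = pi * e `^ p.
  by eexists; split; last reflexivity; rewrite mulr_gt0 ?pi_gt0 ?powR_gt0.
have [E [E0 EE]] : exists E, 0 < E /\ (4 * E) `^ p = T / 16.
  exists ((T / 16) `^ p^-1 / 4); rewrite divr_gt0 ?powR_gt0 ?divr_gt0//; split => //.
  rewrite mulrC divfK ?pnatr_eq0// -powRrM mulVf ?gt_eqF// powRr1//.
  by rewrite divr_ge0 ?(ltW T0).
pose V (w : R2) := modulus f w `^ p.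
have mV : measurable_fun setT V.
  by apply/measurable_EFinP; exact: measurable_modulus_powR.
have V0 w : 0 <= V w by exact: powR_ge0.
have B0 : 0 < 4 `^ p :> R by exact: powR_gt0.
have eta0 : 0 < T / (16 * 4 `^ p) by rewrite divr_gt0// mulr_gt0.
have VD w : ~ disc_coord w -> V w = 0.
  by move=> Dw; rewrite /V modulus_out// powR0// gt_eqF.
have [rho /andP[rho0 rho1] tail] :=
  near_boundary_small mV V0 VD (energy_fin p0 df ffin) eta0.
have [rho2 [r21 r2rho]] : exists r2, r2 < 1 /\ rho < r2.
  by exists ((1 + rho) / 2); split; lra.
have r20 : 0 < rho2 by lra.
(* Uniform continuity of [f] on the disc of radius [rho2] is borrowed from a
   Taylor polynomial, whose order [m] is fixed before [r]. *)
have [m mP] : exists m, forall z, N z <= rho2 -> N (taylor_sum f m z - f z) <= E.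
  have [m _ mP] := taylor_sum_cvg hf r21 E0.
  by exists m; exact: (mP m (leqnn m)).
have [d /andP[d0 d1] dP] := horner_dilation (taylor_poly f m) E0.
(* [rho <= r * rho2] makes [r z] lie outside the disc of radius [rho] when [z]
   is outside the disc of radius [rho2]; [1 / 2 <= r] bounds the Jacobian
   [r ^- 2] by [4]. *)
have [r [rd r12 rr r1]] : exists r, [/\ d <= r, 1 / 2 <= r, rho <= r * rho2 & r < 1].
  exists (Order.max d (Order.max (1 / 2) (rho / rho2))).
  split; rewrite ?le_max ?lexx ?orbT//.
    by rewrite -ler_pdivrMr// !le_max lexx !orbT.
  have q1 : rho / rho2 < 1 by rewrite ltr_pdivrMr// mul1r.
  have h1 : 1 / 2 < 1 :> R by lra.
  by rewrite !gt_max d1 q1 h1.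
have r0 : 0 < r by lra.
have [n nP] : exists n, forall z, N z <= r -> N (taylor_sum f n z - f z) <= E.
  have [n _ nP] := taylor_sum_cvg hf r1 E0.
  by exists n; exact: (nP n (leqnn n)).
pose P := taylor_poly f n \Po (r%:C *: 'X).
have PE z : P.[z] = taylor_sum f n (r%:C * z).
  by rewrite horner_comp hornerZ hornerX horner_taylor_poly.
have Nr z : N (r%:C * z) = r * N z.
  by rewrite Normc.normcM normc_real gtr0_norm.
exists P; set g := fun z => _.
have dg : disc_function g.
  apply: holomorphic_disc_function.
    exact: (holomorphicB hf (@disc_poly_holomorphic R P)).
  by move=> z Dz; rewrite /g df.2// disc_poly_out// subrr.
apply: (bergman_norm_lt p0 e0 dg); rewrite -TE.
pose C (w : R2) := V w * \1_(outside rho) w.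
have mC : measurable_fun setT C.
  by apply: measurable_funM => //; apply: measurable_indic; exact: measurable_outside.
have C0 w : 0 <= C w by rewrite mulr_ge0.
pose G (w : R2) := C w + C (cmul r%:C w).
have mCr : measurable_fun setT (fun w => C (cmul r%:C w)).
  exact: (measurableT_comp mC (@measurable_cmul R _)).
have mG : measurable_fun setT G by exact: measurable_funD.
have G0 w : 0 <= G w by rewrite addr_ge0.
have gG w : modulus g w `^ p <= (4 * E) `^ p * \1_(@disc_coord R) w + 4 `^ p * G w.
  rewrite indic_disc; case: ltP => [w1|w1]; last first.
    rewrite mulr0 add0r /modulus dg.2 ?Normc.normc0 ?powR0 ?gt_eqF//.
      by rewrite mulr_ge0// ltW.
    by move/unit_discE; rewrite ltNge w1.
  rewrite mulr1; set z := complex_of w in w1 *.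
  have gz : modulus g w = N (f z - taylor_sum f n (r%:C * z)).
    by rewrite /modulus /g /disc_poly -/z w1 PE.
  have rz : N (r%:C * z) <= r by rewrite Nr ler_piMr ?(ltW r0)// ltW.
  have fr := nP _ rz.
  have [zin|zout] := leP (N z) rho2.
    rewrite ler_wpDr ?mulr_ge0 ?powR_ge0//.
    apply: ge0_ler_powR; rewrite ?nnegrE ?modulus_ge0 ?mulr_ge0 ?(ltW E0) ?(ltW p0)//.
    have rzin : N (r%:C * z) <= rho2.
      rewrite Nr; apply: le_trans zin; rewrite ler_piMl ?normc_ge0//; exact: ltW.
    have := mP z zin; have := mP _ rzin.
    have := dP r z; rewrite rd (ltW r1) => /(_ isT (ltW w1)).
    rewrite !horner_taylor_poly gz.
    have := normc_triangle4 (f z) (taylor_sum f n (r%:C * z)) (taylor_sum f m z)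
      (taylor_sum f m (r%:C * z)) (f (r%:C * z)).
    move: fr; move: (N (taylor_sum f n _ - f _)) (N (f z - _)) (N (_ - f z)).
    move: (N (_ - f (r%:C * z))) (N (taylor_sum f m z - _)) => x1 x2 x3 x4 x5.
    by lra.
  have V1 : C w = V w.
    rewrite /C indicE mem_set ?mulr1//= /outside /= -/z; exact: lt_trans zout.
  have V2 : C (cmul r%:C w) = V (cmul r%:C w).
    have O : rho < N (complex_of (cmul r%:C w)).
      by rewrite complex_of_cmul -/z Nr; apply: le_lt_trans rr _; rewrite ltr_pM2l.
    by rewrite /C indicE mem_set ?mulr1.
  rewrite /G V1 V2 /V /modulus complex_of_cmul -/z -/(modulus g w) gz.
  have tri : N (f z - taylor_sum f n (r%:C * z)) <= E + N (f z) + N (f (r%:C * z)).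
    have := normc_triangle3 (f z) (taylor_sum f n (r%:C * z)) (f (r%:C * z)).
    move: fr; move: (N (taylor_sum f n _ - f _)) (N (f z - _)) => x1 x2.
    by lra.
  apply: (@le_trans _ _ ((E + N (f z) + N (f (r%:C * z))) `^ p)).
    apply: ge0_ler_powR; rewrite ?nnegrE ?addr_ge0 ?normc_ge0 ?(ltW p0) ?(ltW E0)//.
  apply: le_trans (powR_sum3 _ _ _ _) _; rewrite ?normc_ge0 ?(ltW p0) ?(ltW E0)//.
  by rewrite (powRM _ _ (ltW E0))// -mulrDr addrA.
have IC : (\int[leb2]_w (C (cmul r%:C w))%:E <= 4%:E * \int[leb2]_w (C w)%:E)%E.
  have rC0 : r%:C != 0 :> R[i] by rewrite -normc_gt0 normc_real gtr0_norm.
  rewrite (@integral_cmul R _ (fun w => (C w)%:E) rC0).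
  - apply: lee_wpmul2r; first by apply: integral_ge0 => w _; rewrite lee_fin.
    rewrite lee_fin normc_real gtr0_norm// -(invrK 4) lef_pV2 ?posrE ?exprn_gt0//.
    rewrite (_ : 4^-1 = (1 / 2) ^+ 2); last by field.
    by apply: lerXn2r; rewrite ?nnegrE ?(ltW r0)// divr_ge0.
  - exact/measurable_EFinP.
  - by move=> w; rewrite lee_fin.
apply: le_lt_trans (energy_split dg (powR_ge0 _ _) (ltW B0) mG G0 gG) _.
have -> : (\int[leb2]_w (G w)%:E = \int[leb2]_w (C w)%:E + \int[leb2]_w (C (cmul r%:C w))%:E)%E.
  under eq_integral => w _ do rewrite EFinD.
  rewrite ge0_integralD//.
  - by move=> w _; rewrite lee_fin.
  - exact/measurable_EFinP.
  - by move=> w _; rewrite lee_fin.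
  - exact/measurable_EFinP.
have IC0 : (0 <= \int[leb2]_w (C w)%:E)%E by apply: integral_ge0 => w _; rewrite lee_fin.
have ICr0 : (0 <= \int[leb2]_w (C (cmul r%:C w))%:E)%E.
  by apply: integral_ge0 => w _; rewrite lee_fin.
move: tail; rewrite -/(C _); move: IC0 ICr0 IC.
case: (\int[leb2]_w (C (cmul r%:C w))%:E)%E => [y| |] //;
  case: (\int[leb2]_w (C w)%:E)%E => [x| |] //.
rewrite -!EFinM -!EFinD !lee_fin !lte_fin => x0 y0 xy xT; rewrite EE.
have : 4 `^ p * x < T / 16.
  by rewrite mulrC -ltr_pdivlMr// -mulrA -invfM.
have : 4 `^ p * y <= 4 * (4 `^ p * x) by rewrite mulrCA ler_pM2l.
by rewrite mulrDr; move: T0; lra.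
Qed.

End density.

(** * Closeness in measure on the circle *)

Section measure_on_circle.
Variable R : realType.
Implicit Types (f g h : R -> R[i]) (e : R) (A B : set R).

(** The outer measure is defined for all sets, so exceptional sets need not be
    shown to be measurable. *)
Definition outer_leb : {outer_measure set (ocitv_type R) -> \bar R} :=
  ((@wlength R idfun)^*)%mu.

Lemma outer_lebE A : outer_leb A = lebesgue_measure (A : set (measurableTypeR R)).
Proof. by []. Qed.

Lemma le_outer_leb A B : A `<=` B -> (outer_leb A <= outer_leb B)%E.
Proof. exact: le_outer_measure. Qed.

Lemma outer_leb_ge0 A : (0 <= outer_leb A)%E.
Proof. exact: outer_measure_ge0. Qed.

Lemma outer_lebU A B : (outer_leb (A `|` B) <= outer_leb A + outer_leb B)%E.
Proof. exact: outer_measureU2. Qed.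

Lemma outer_leb_itv (x y : R) (b c : bool) : x <= y ->
  outer_leb [set` Interval (BSide b x) (BSide c y)] = (y - x)%:E.
Proof.
move=> xy; rewrite outer_lebE lebesgue_measure_itv /= lte_fin.
case: ltP => [//|yx]; congr EFin; apply/eqP; rewrite eq_sym subr_eq0.
by rewrite eq_le xy yx.
Qed.

Lemma outer_leb_bigU (F : nat -> set R) n :
  (outer_leb (\big[setU/set0]_(i < n) F i) <= \sum_(i < n) outer_leb (F i))%E.
Proof. exact: outer_measure_subadditive. Qed.

(** [expi] maps this interval bijectively onto the unit circle. *)
Definition arc : set R := `[0, 2 * pi[%classic.

Definition far f g e : set R := [set t | arc t /\ e <= N (f t - g t)].

(** Convergence in measure, with one parameter for the deviation and for the
    size of the exceptional set. *)
Definition close_in_measure f g e := (outer_leb (far f g e) < e%:E)%E.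

End measure_on_circle.
Arguments arc {R} _.

Section peak_polynomials.
Variable R : realType.
Implicit Types (z : R[i]) (n : nat).

(* [n] times the Cesaro mean of the first [n] Taylor sums of [1 / (1 - z)]. *)
Let cesaro n : {poly R[i]} := \sum_(k < n) \sum_(j < k.+1) 'X^j.

Let cesaroE n z : (1 - z) * (cesaro n).[z] = n%:R - z * \sum_(k < n) z ^+ k.
Proof.
rewrite /cesaro horner_sum mulr_sumr (eq_bigr (fun k : 'I_n => 1 - z ^+ k.+1)).
  rewrite sumrB sumr_const card_ord mulr_sumr; congr (_ - _).
  by apply: eq_bigr => k _; rewrite exprS.
move=> k _; rewrite horner_sum -[RHS]opprB subrX1 -mulNr opprB; congr (_ * _).
by apply: eq_bigr => j _; rewrite hornerXn.
Qed.

Let cesaro0 n : (cesaro n).[0] = n%:R.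
Proof.
rewrite /cesaro horner_sum (eq_bigr (fun=> 1)) ?sumr_const ?card_ord// => k _.
rewrite horner_sum big_ord_recl big1 ?addr0; first by rewrite expr0 hornerC.
by move=> j _; rewrite hornerXn lift0 expr0n.
Qed.

(** The function [1 - c + c / (1 - z)] has value [1] at the origin.  On the unit
    circle [Re (1 / (1 - z)) = 1 / 2], so away from [1] and for small [c] its
    modulus is smaller than [1].  Replacing [1 / (1 - z)] by a Cesaro mean of
    its Taylor sums gives a polynomial, and a high power of it is small. *)
Lemma peak_polynomial (eta sigma : R) : 0 < eta < 1 -> 0 < sigma ->
  exists2 s : {poly R[i]}, s.[0] = 1 &
    forall z, N z = 1 -> eta <= N (1 - z) -> N s.[z] <= sigma.
Proof.
move=> /andP[eta0 eta1] sigma0.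
(* With [2 * c = eta ^+ 2] the squared modulus of [1 - c + c / (1 - z)] is at
   most [1 - c / 2] where [eta <= N (1 - z)]. *)
have [c [c0 c1 cE]] : exists c, [/\ 0 < c, c < 1 & 2 * c = eta ^+ 2].
  exists (eta ^+ 2 / 2); rewrite divr_gt0 ?exprn_gt0//; split => //; last by field.
  by rewrite ltr_pdivrMr// mul1r expr2; nra.
have [n nP] : exists n, 8 / c < n%:R.
  by exists (Num.truncn (8 / c)).+1; exact: truncnS_gt.
have n0 : 0 < n%:R :> R by apply: lt_trans nP; rewrite divr_gt0.
have nC : n%:R != 0 :> R[i].
  by rewrite -normc_gt0 normc_nat.
pose A : {poly R[i]} := (1 - c%:C)%:P + (c%:C / n%:R) *: cesaro n.
have A0 : A.[0] = 1.
  by rewrite hornerD hornerC hornerZ cesaro0 divfK// subrK.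
(* Half of the gap [c / 4] absorbs the error of the Cesaro mean. *)
pose th := 1 - c / 8.
have th01 : 0 <= th < 1 by rewrite /th; apply/andP; split; lra.
have Ath z : N z = 1 -> eta <= N (1 - z) -> N A.[z] <= th.
  move=> z1 dz; have d0 : 0 < N (1 - z) by exact: lt_le_trans dz.
  have z10 : 1 - z != 0 by rewrite -normc_gt0.
  pose q := z * (\sum_(k < n) z ^+ k) / n%:R.
  have qle : N q <= 2 / (n%:R * eta).
    rewrite /q Normc.normcM Normc.normcV normc_nat Normc.normcM z1 mul1r.
    rewrite (mulrC n%:R) invfM mulrA ler_pM2r ?invr_gt0//.
    rewrite ler_pdivlMr//; apply: (@le_trans _ _ (N (1 - z ^+ n))).
      rewrite -[1 - z ^+ n]opprB subrX1 -mulNr opprB Normc.normcM mulrC.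
      by rewrite ler_wpM2r ?normc_ge0.
    apply: le_trans (normc_triangleB _ _) _.
    by rewrite Normc.normc1 normcX z1 expr1n.
  have AE : A.[z] = (1 - c%:C + c%:C / (1 - z)) - c%:C * q / (1 - z).
    rewrite hornerD hornerC hornerZ.
    have -> : (cesaro n).[z] = (n%:R - q * n%:R) / (1 - z).
      by rewrite /q divfK// -cesaroE mulrAC divff// mul1r.
    by field; rewrite nC z10.
  have B2 : N (1 - c%:C + c%:C / (1 - z)) <= 1 - c / 4.
    have -> : 1 - c%:C + c%:C / (1 - z) = (1 - (1 - c%:C) * z) / (1 - z) by field.
    rewrite Normc.normcM Normc.normcV ler_pdivrMr//.
    have p : 0 <= 1 - c / 4 by lra.
    rewrite -(ler_pXn2r (n := 2))// ?nnegrE ?normc_ge0 ?mulr_ge0 ?normc_ge0//.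
    rewrite exprMn !sqr_normcE.
    have : eta ^+ 2 <= N (1 - z) ^+ 2.
      by apply: lerXn2r; rewrite ?nnegrE ?(ltW eta0) ?normc_ge0.
    have : N z ^+ 2 = 1 by rewrite z1 expr1n.
    rewrite !sqr_normcE -cE; case: z {z1 dz d0 z10 q qle AE} => x y /= xy.
    rewrite !oppr0 !addr0 !mul0r !subr0 ?addr0 ?sub0r.
    move=> H; nra.
  rewrite AE; apply: le_trans (normc_triangleB _ _) _.
  have : N (c%:C * q / (1 - z)) <= c / 8.
    rewrite Normc.normcM Normc.normcV (Normc.normcM c%:C q) normc_real (gtr0_norm c0).
    apply: (@le_trans _ _ (c * (2 / (n%:R * eta)) / eta)).
      have cq : c * N q <= c * (2 / (n%:R * eta)) by apply: ler_wpM2l qle; exact: ltW.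
      apply: ler_pM cq _; [|by rewrite invr_ge0 normc_ge0|].
        by rewrite mulr_ge0 ?normc_ge0 ?(ltW c0).
      by rewrite lef_pV2 ?posrE.
    have -> : c * (2 / (n%:R * eta)) / eta = n%:R^-1.
      have -> : c * (2 / (n%:R * eta)) / eta = (2 * c) / (n%:R * eta ^+ 2).
        by field; rewrite (gt_eqF eta0) (gt_eqF n0).
      by rewrite cE invfM mulrCA divff ?mulr1// expf_neq0// (gt_eqF eta0).
    by rewrite -(invrK (c / 8)) lef_pV2 ?posrE ?invr_gt0 ?divr_gt0// invf_div ltW.
  by rewrite /th; lra.
have [M _ MP] := near_mul_expr_lt 1 th01 sigma0.
exists (A ^+ M); first by rewrite horner_exp A0 expr1n.
move=> z z1 dz; rewrite horner_exp normcX.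
apply: le_trans (_ : th ^+ M <= sigma).
  apply: lerXn2r; rewrite ?nnegrE ?normc_ge0 ?(andP th01).1//; exact: Ath.
by have := MP M (leqnn M); rewrite /= mul1r => /ltW.
Qed.

End peak_polynomials.

(** * Small polynomials with prescribed boundary values *)

Section near_roots_of_unity.
Variable R : realType.
Implicit Types (s t : R) (z : R[i]).

Lemma expi_natmul n t : expi (n%:R * t) = expi t ^+ n.
Proof.
elim: n => [|n IH]; first by rewrite mul0r expi0 expr0.
by rewrite -natr1 mulrDl mul1r expiD IH exprSr.
Qed.

Lemma expi_period n t : expi (t + n%:R * (2 * pi)) = expi t.
Proof.
elim: n => [|n IH]; first by rewrite mul0r addr0.
by rewrite -natr1 mulrDl mul1r addrA expiD2pi.
Qed.

Lemma cos_le_cos s d : 0 <= d <= pi -> d <= s <= 2 * pi - d -> cos s <= cos d :> R.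
Proof.
move=> d0 /andP[ds sd]; wlog spi : s ds sd / s <= pi => [H|].
  have [/H|sp] := leP s pi; first exact.
  have -> : cos s = cos (2 * pi - s).
    have -> : 2 * pi - s = - s + pi *+ 2 by rewrite addrC mulr2n mulrDl mul1r.
    by rewrite cosD2pi cosN.
  by apply: H; lra.
rewrite leNgt ltr_cos ?in_itv//= -?leNgt//.
by rewrite spi andbT; apply: le_trans ds; case/andP: d0.
Qed.

Lemma cos_lt_cos s d : 0 <= s -> s < d -> d <= pi -> cos d < cos s :> R.
Proof. by move=> s0 sd dpi; rewrite ltr_cos ?in_itv//=; apply/andP; split; lra. Qed.

Lemma sqr_dist1_expi s : N (1 - expi s) ^+ 2 = 2 - 2 * cos s.
Proof.
rewrite sqr_normcE /expi /= sub0r sqrrN.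
have := cos2Dsin2 s; lra.
Qed.

(** The points where [expi t ^+ n] is near [1] form [n] arcs of length
    proportional to [1 / n], so [eta] can be chosen before [n]. *)
Lemma near_roots_of_unity_small e : 0 < e -> exists2 eta, 0 < eta < 1 &
  forall n, (0 < n)%N ->
    (outer_leb R [set t | arc t /\ (N (1 - expi t ^+ n) < eta)%R] < e%:E)%E.
Proof.
move=> e0; have pi0 := pi_gt0 R.
have [d [d0 dpi de]] : exists d, [/\ 0 < d, d <= pi & 2 * d < e :> R].
  have [epi|pie] := leP (e / 3) pi; [exists (e / 3)|exists pi]; split => //; lra.
have cd : cos d < 1 by rewrite -[ltRHS](@cos0 R); exact: cos_lt_cos.
pose eta := Num.min (1 / 2) (2 - 2 * cos d).
have eta0 : 0 < eta < 1.
  rewrite lt_min gt_min; apply/andP; split; [apply/andP; split; lra|].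
  by apply/orP; left; lra.
have etaP s : 0 <= s < 2 * pi -> N (1 - expi s) < eta -> s < d \/ 2 * pi - d < s.
  move=> s0 h; have [|ds] := ltP s d; first by left.
  have [|sd] := ltP (2 * pi - d) s; first by right.
  have := @cos_le_cos s d; rewrite ds sd dpi (ltW d0) => /(_ isT isT) cs.
  have : N (1 - expi s) ^+ 2 < eta.
    apply: le_lt_trans (h); rewrite expr2 ler_piMl ?normc_ge0//.
    by have /andP[_ H] := eta0; apply/ltW/(lt_trans h H).
  by rewrite sqr_dist1_expi lt_min => /andP[_]; lra.
exists eta => // n n0; have nR : 0 < n%:R :> R by rewrite ltr0n.
pose F j : set R := `[j%:R * (2 * pi) / n%:R, (j%:R * (2 * pi) + d) / n%:R] `|`
  `[(j.+1%:R * (2 * pi) - d) / n%:R, j.+1%:R * (2 * pi) / n%:R].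
apply: (@le_lt_trans _ _ (outer_leb R (\big[setU/set0]_(j < n) F j))).
  apply: le_outer_leb => t [/=]; rewrite /arc /= in_itv /= => /andP[t0 t2] h.
  pose x := n%:R * t / (2 * pi).
  have x0 : 0 <= x by rewrite divr_ge0 ?mulr_ge0// ltW.
  have /andP[jx xj] := truncn_itv x0; set j := Num.trunc x in jx xj.
  rewrite -bigcup_mkord; exists j => /=.
    rewrite -(ltr_nat R); apply: le_lt_trans jx _.
    by rewrite ltr_pdivrMr ?mulr_gt0// ltr_pM2l.
  have pi20 : 0 < 2 * pi :> R by rewrite mulr_gt0.
  rewrite ler_pdivlMr// in jx; rewrite ltr_pdivrMr// in xj.
  rewrite -natr1 mulrDl mul1r in xj.
  pose s := n%:R * t - j%:R * (2 * pi).
  have ns : expi t ^+ n = expi s by rewrite -expi_natmul -(expi_period j s) subrK.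
  rewrite ns in h; have jS : j.+1%:R = j%:R + 1 :> R by rewrite natr1.
  have [|sd|ds] := etaP s _ h; first by rewrite /s; apply/andP; split; lra.
  - left; rewrite /= in_itv /= ler_pdivrMr// ler_pdivlMr//.
    by move: sd; rewrite /s (mulrC t) => ?; apply/andP; split; lra.
  - right; rewrite /= in_itv /= ler_pdivrMr// ler_pdivlMr// jS.
    by move: ds; rewrite /s (mulrC t) => ?; apply/andP; split; lra.
apply: le_lt_trans (outer_leb_bigU _ _) _.
apply: (@le_lt_trans _ _ (\sum_(j < n) (2 * d / n%:R)%:E)%E).
  apply: lee_sum => j _; apply: le_trans (outer_lebU _ _) _.
  rewrite !outer_leb_itv ?ler_pM2r ?invr_gt0//; [|lra..].
  by rewrite -EFinD lee_fin -!mulrBl -mulrDl ler_pM2r ?invr_gt0//; lra.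
rewrite sumEFin lte_fin sumr_const card_ord -[X in X < _]mulr_natr divfK//.
by rewrite gt_eqF.
Qed.

End near_roots_of_unity.

Section one_approximation_step.
Variable R : realType.
Implicit Types (P Q : {poly R[i]}).

Lemma horner_bounded P : exists2 M, 0 < M & forall z, N z <= 1 -> N P.[z] <= M.
Proof.
exists (1 + \sum_(j < size P) N P`_j * 1 ^+ j).
  by rewrite ltr_wpDr// sumr_ge0// => j _; rewrite expr1n mulr1 normc_ge0.
by move=> z z1; apply: le_trans (normc_horner_le P z1) _; rewrite lerDr.
Qed.

(** Smallness in the disc does not restrict boundary values, up to a small
    exceptional set: if [s] is a peak polynomial and
    [n] is large, [s (z ^+ n)] is small on most of the circle while
    [1 - s (z ^+ n)] vanishes to order [n] at the origin, which compensates the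
    pole of the Laurent polynomial and makes the product with it small in mean
    over the disc. *)
Lemma small_polynomial p m P e : 1 <= p -> 0 < e -> exists2 Q,
    (bergman_norm p (disc_poly Q) < e%:E)%E &
    close_in_measure (fun t => Q.[expi t]) (fun t => expi t ^- m * P.[expi t]) e.
Proof.
move=> p1 e0; have [M M0 MP] := horner_bounded P.
have [eta eta01 etaP] := near_roots_of_unity_small e0.
have sg0 : 0 < e / 2 / M by rewrite !divr_gt0.
have [s s0 sP] := peak_polynomial eta01 sg0.
have [r rE] : exists r, 1 - s = r * 'X.
  have /factor_theorem[r] : root (1 - s) 0 by rewrite /root hornerD hornerN hornerC s0 subrr.
  by rewrite subr0 => rE; exists r.
have [C C0 CP] := horner_bounded r.
have [L0 _ LP] := bergman_norm_expr_small p1 (mulr_gt0 C0 M0) e0.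
pose L := maxn L0 1; pose n := (m + L)%N.
have n0 : (0 < n)%N by exact: leq_trans (leq_maxr L0 1) (leq_addl _ _).
pose Q := 'X^L * (r \Po 'X^n) * P.
have QE z : Q.[z] = z ^+ L * r.[z ^+ n] * P.[z].
  by rewrite !hornerM horner_comp !hornerXn.
exists Q.
  have LL : (L0 <= L)%N by exact: leq_maxl.
  apply: (LP L LL _ (disc_poly_disc_function Q)) => z z1.
  rewrite /disc_poly z1 QE !Normc.normcM normcX (mulrC (_ ^+ L)) mulrAC.
  apply: ler_wpM2r; first by rewrite exprn_ge0 ?normc_ge0.
  apply: ler_pM; rewrite ?normc_ge0//; last exact/MP/ltW.
  apply: CP; rewrite normcX; apply: exprn_ile1; rewrite ?normc_ge0//.
  exact: ltW.
apply: le_lt_trans (etaP n n0); apply: le_outer_leb => t [/= ta h]; split => //.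
rewrite ltNge; apply/negP => he; move: h; rewrite leNgt => /negP; apply.
have -> : Q.[expi t] - expi t ^- m * P.[expi t] =
    - (expi t ^- m * s.[expi t ^+ n] * P.[expi t]).
  have -> : s = 1 - r * 'X by rewrite -rE opprB addrC subrK.
  rewrite QE hornerD hornerN hornerM hornerX hornerC exprD.
  have := expi_neq0 t; set w := expi t; move=> w0; rewrite -/w.
  have wm : w ^- m * w ^+ m = 1 by rewrite mulVf// expf_neq0.
  move: (w ^+ m) (w ^+ L) wm => b c; move: (b^-1) => a ab; move: r.[_] P.[_] => x y.
  have -> : c * x * y = a * b * (c * x * y) by rewrite ab mul1r.
  by ring.
rewrite normc_opp !Normc.normcM Normc.normcV normcX normc_expi expr1n invr1 mul1r.
apply: (@le_lt_trans _ _ (e / 2 / M * M)); last by rewrite divfK ?gt_eqF//; lra.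
apply: ler_pM; rewrite ?normc_ge0//; last by apply: MP; rewrite normc_expi.
by apply: sP => //; rewrite normcX normc_expi expr1n.
Qed.

End one_approximation_step.

(** * Laurent polynomials are dense in measure *)

Section laurent_polynomials.
Variable R : realType.
Implicit Types (f g h : R -> R[i]) (m : nat) (P Q : {poly R[i]}) (e : R).

(** The general form of a Laurent polynomial, restricted to the circle. *)
Definition laurent m P (t : R) : R[i] := expi t ^- m * P.[expi t].

Definition trigonometric f := exists m P, f =1 laurent m P.

Lemma trigonometric_cst c : trigonometric (fun=> c).
Proof. by exists 0, c%:P => t; rewrite /laurent expr0 invr1 mul1r hornerC. Qed.

Lemma trigonometricM f g : trigonometric f -> trigonometric g ->
  trigonometric (fun t => f t * g t).
Proof.
move=> [m [P fE]] [n [Q gE]]; exists (m + n), (P * Q) => t.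
by rewrite fE gE /laurent hornerM exprD invfM mulrACA.
Qed.

Lemma trigonometricD f g : trigonometric f -> trigonometric g ->
  trigonometric (fun t => f t + g t).
Proof.
move=> [m [P fE]] [n [Q gE]]; exists (m + n), ('X^n * P + 'X^m * Q) => t.
rewrite fE gE /laurent hornerD !hornerM !hornerXn exprD.
have w0 k : expi t ^+ k != 0 by rewrite expf_neq0// expi_neq0.
move: (_ ^+ m) (_ ^+ n) (w0 m) (w0 n) P.[_] Q.[_] => a b a0 b0 x y.
by field; rewrite ?a0 ?b0.
Qed.

Lemma trigonometric_cos s : trigonometric (fun t => (cos (t - s))%:C).
Proof.
exists 1%N, (2^-1 *: (expi (- s) *: 'X^2 + (expi s)%:P)) => t.
rewrite /laurent expr1 hornerZ hornerD hornerZ hornerXn hornerC mulrCA mulrDr.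
have -> : (expi t)^-1 * (expi (- s) * expi t ^+ 2) = expi (t - s).
  by rewrite expr2 mulrCA mulKf ?expi_neq0// expiD mulrC.
have -> : (expi t)^-1 * expi s = expi (- (t - s)).
  have E : expi t * expi (- (t - s)) = expi s by rewrite -expiD; congr expi; ring.
  by rewrite -E mulKf// expi_neq0.
have -> : expi (t - s) + expi (- (t - s)) = 2 * (cos (t - s))%:C.
  rewrite mulrDl mul1r /expi cosN sinN.
  by apply/eqP; rewrite eq_complex /= subrr addr0 !eqxx.
by rewrite mulKf// -normc_gt0 normc_nat.
Qed.

(** The closure of the trigonometric polynomials under convergence in measure. *)
Definition approximable f := forall e, 0 < e ->
  exists2 g, trigonometric g & close_in_measure f g e.

Lemma far_triangle f g h (a b : R) : far f h (a + b) `<=` far f g a `|` far g h b.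
Proof.
move=> t [ta H]; have [|h1] := leP a (N (f t - g t)); first by left.
have [|h2] := leP b (N (g t - h t)); first by right.
have := normc_triangleBr (f t) (h t) (g t); lra.
Qed.

Lemma le_far f g (a b : R) : a <= b -> far f g b `<=` far f g a.
Proof. by move=> ab t [ta H]; split=> //; exact: le_trans H. Qed.

Lemma close_triangle f g h (a b : R) : close_in_measure f g a ->
  close_in_measure g h b -> close_in_measure f h (a + b).
Proof.
move=> fg gh; apply: le_lt_trans (le_outer_leb (@far_triangle f g h a b)) _.
by apply: le_lt_trans (outer_lebU _ _) _; rewrite EFinD; exact: lteD.
Qed.

Lemma close_sub f g e (A : set R) :
  (forall t, arc t -> ~ A t -> N (f t - g t) < e) -> (outer_leb R A < e%:E)%E ->
  close_in_measure f g e.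
Proof.
move=> H; apply: le_lt_trans; apply: le_outer_leb => t [ta ft].
by apply: contrapT => /(H _ ta); rewrite ltNge ft.
Qed.

Lemma far_in f g e t : arc t -> ~ far f g e t -> N (f t - g t) < e.
Proof. by move=> ta H; rewrite ltNge; apply/negP => h; apply: H. Qed.

Lemma approximable_lim f :
  (forall e, 0 < e -> exists2 g, approximable g & close_in_measure f g e) ->
  approximable f.
Proof.
move=> H e e0; have e2 : 0 < e / 2 by rewrite divr_gt0.
have [g ag fg] := H _ e2; have [h th gh] := ag _ e2; exists h => //.
by rewrite (splitr e); exact: close_triangle fg gh.
Qed.

Lemma trigonometric_approximable f : trigonometric f -> approximable f.
Proof.
move=> tf e e0; exists f => //; apply: (close_sub (A := set0)); last first.
  by rewrite outer_measure0.
by move=> t _ _; rewrite subrr Normc.normc0.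
Qed.

Lemma approximable_mono f g : approximable f -> (forall t, arc t -> g t = f t) -> approximable g.
Proof.
move=> af fg e e0; have [h th fh] := af _ e0; exists h => //.
apply: le_lt_trans fh; apply: le_outer_leb => t [ta]; rewrite fg//.
Qed.

Lemma close_pair f g u v e : 0 < e ->
  close_in_measure f u (e / 3) -> close_in_measure g v (e / 3) ->
  exists2 A, (outer_leb R A < e%:E)%E &
    forall t, arc t -> ~ A t -> N (f t - u t) < e / 3 /\ N (g t - v t) < e / 3.
Proof.
move=> e0 fu gv; exists (far f u (e / 3) `|` far g v (e / 3)).
  apply: le_lt_trans (outer_lebU _ _) _.
  apply: lt_le_trans (lteD fu gv) _; rewrite -EFinD lee_fin; lra.
by move=> t ta /not_orP[h1 h2]; split; exact: far_in.
Qed.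

Lemma approximableD f g : approximable f -> approximable g ->
  approximable (fun t => f t + g t).
Proof.
move=> af ag e e0; have e3 : 0 < e / 3 by rewrite divr_gt0.
have [u tu fu] := af _ e3; have [v tv gv] := ag _ e3.
exists (fun t => u t + v t); first exact: trigonometricD.
have [A Ae H] := close_pair e0 fu gv; apply: close_sub Ae => t ta /(H t ta)[h1 h2].
have -> : f t + g t - (u t + v t) = (f t - u t) + (g t - v t) by ring.
by apply: le_lt_trans (normc_triangle _ _) _; lra.
Qed.

Lemma approximableM f g : (forall t, arc t -> N (f t) <= 1) ->
  (forall t, arc t -> N (g t) <= 1) -> approximable f -> approximable g ->
  approximable (fun t => f t * g t).
Proof.
move=> f1 g1 af ag e e0.
have [a [a0 a1 ae]] : exists a, [/\ 0 < a, a <= 1 & a <= e].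
  by have [e1|e1] := leP e 1; [exists e|exists 1]; split=> //; lra.
have a3 : 0 < a / 3 by rewrite divr_gt0.
have [u tu fu] := af _ a3; have [v tv gv] := ag _ a3.
exists (fun t => u t * v t); first exact: trigonometricM.
have [A Ae H] := close_pair a0 fu gv; apply: (@close_sub _ _ _ A); last first.
  by apply: lt_le_trans Ae _; rewrite lee_fin.
move=> t ta /(H t ta)[h1 h2].
have -> : f t * g t - u t * v t =
  (f t - u t) * g t + f t * (g t - v t) - (f t - u t) * (g t - v t) by ring.
apply: le_lt_trans (normc_triangleB _ _) _; rewrite Normc.normcM.
apply: (@le_lt_trans _ _ (N (f t - u t) + N (g t - v t) + N (f t - u t) * N (g t - v t))).
  rewrite lerD2r; apply: le_trans (normc_triangle _ _) _; rewrite !Normc.normcM.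
  by apply: lerD; [rewrite ler_piMr|rewrite ler_piMl]; rewrite ?normc_ge0 ?f1 ?g1.
have := normc_ge0 (f t - u t); have := normc_ge0 (g t - v t).
by move: (N _) (N _) h1 h2 => x y; nra.
Qed.

Lemma approximableZ c f : approximable f -> approximable (fun t => c * f t).
Proof.
move=> af e e0; have c1 : 0 < N c + 1 by rewrite ltr_wpDl ?normc_ge0.
have d0 : 0 < e / (N c + 1) by rewrite divr_gt0.
have [u tu fu] := af _ d0; exists (fun t => c * u t).
  by apply: trigonometricM tu; exact: trigonometric_cst.
apply: (@close_sub _ _ _ (far f u (e / (N c + 1)))).
  move=> t ta /(far_in ta) h; rewrite -mulrBr Normc.normcM.
  move: h; rewrite ltr_pdivlMr//; have := normc_ge0 (f t - u t).
  by move: (N (f t - u t)) (N c) c1 => x y; nra.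
apply: lt_le_trans fu _; rewrite lee_fin ler_pdivrMr// ler_peMr ?(ltW e0)//.
by rewrite lerDr normc_ge0.
Qed.

Lemma approximable_sum n (F : nat -> R -> R[i]) : (forall k, approximable (F k)) ->
  approximable (fun t => \sum_(k < n) F k t).
Proof.
move=> H; elim: n => [|n IH].
  apply: (approximable_mono (trigonometric_approximable (trigonometric_cst 0))).
  by move=> t _; rewrite big_ord0.
apply: (approximable_mono (approximableD IH (H n))) => t _.
by rewrite big_ord_recr.
Qed.

End laurent_polynomials.

Section approximable_sets.
Variable R : realType.
Implicit Types (A B : set R) (e : R).

Definition ind A (t : R) : R[i] := (t \in A)%:R.

Definition approximable_set A := approximable (ind A).

Lemma normc_ind A t : N (ind A t) <= 1.
Proof. by rewrite /ind normc_nat; case: (_ \in _). Qed.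

Lemma approximable_cst (c : R[i]) : approximable (fun=> c : R[i]) (R := R).
Proof. exact/trigonometric_approximable/trigonometric_cst. Qed.

Lemma approximable_setC A : approximable_set A -> approximable_set (~` A).
Proof.
move=> aA; have := approximableD (approximable_cst 1) (approximableZ (-1) aA).
move/approximable_mono; apply => t _; rewrite mulN1r /ind in_setC.
by case: (_ \in _); rewrite ?subrr ?subr0.
Qed.

Lemma approximable_setI A B :
  approximable_set A -> approximable_set B -> approximable_set (A `&` B).
Proof.
move=> aA aB; have := approximableM _ _ aA aB.
move=> /(_ (fun t _ => normc_ind A t) (fun t _ => normc_ind B t)).
by move/approximable_mono; apply => t _; rewrite /ind in_setI -natrM mulnb.
Qed.

Lemma approximable_setU A B :
  approximable_set A -> approximable_set B -> approximable_set (A `|` B).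
Proof.
move=> aA aB; rewrite -(setCK (A `|` B)) setCU.
by apply/approximable_setC/approximable_setI; exact: approximable_setC.
Qed.

Lemma approximable_set0 : approximable_set set0.
Proof.
by apply: (approximable_mono (approximable_cst 0)) => t _; rewrite /ind in_set0.
Qed.

Lemma approximable_bigU (F : nat -> set R) n :
  (forall k, approximable_set (F k)) -> approximable_set (\big[setU/set0]_(i < n) F i).
Proof.
by move=> H; elim/big_ind: _ => //;
  [exact: approximable_set0|exact: approximable_setU].
Qed.

Lemma approximable_set_lim A : (forall e, 0 < e -> exists2 B, approximable_set B &
    (outer_leb R (arc `&` ((A `\` B) `|` (B `\` A))) < e%:E)%E) -> approximable_set A.
Proof.
move=> H; apply: approximable_lim => e e0; have [B aB AB] := H _ e0.
exists (ind B) => //; apply: close_sub AB => t ta /not_andP[//|/not_orP[h1 h2]].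
suff -> : (ind A t = ind B t) by rewrite subrr Normc.normc0.
rewrite /ind; congr (_%:R); congr (nat_of_bool _); apply/idP/idP; rewrite !inE => h.
  by apply: contrapT => h'; apply: h1.
by apply: contrapT => h'; apply: h2.
Qed.

(** It fixes [0], [1 / 2] and [1]; [1 / 2] is repelling, the others attract. *)
Let step (y : R) := y ^+ 2 * (3 - 2 * y).

Let step_opp y : step (1 - y) = 1 - step y.
Proof. by rewrite /step; ring. Qed.

Let iter_step_opp n y : iter n step (1 - y) = 1 - iter n step y.
Proof. by elim: n => //= n ->; rewrite step_opp. Qed.

Let iter_step_low n y d : 0 < d -> 0 <= y <= 1 / 2 - d ->
  0 <= iter n step y <= (1 - d) ^+ n.
Proof.
move=> d0 y0; suff [H1 H2] : 0 <= iter n step y <= 1 / 2 - d /\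
    iter n step y <= (1 - d) ^+ n by rewrite H2 andbT; case/andP: H1.
elim: n => [|n [/andP[IH1 IH2] IH3]] /=.
  by rewrite expr0; split => //; case/andP: y0 => *; lra.
move: (iter n step y) IH1 IH2 IH3 => x x0 x1 x2.
have xs : x * (3 - 2 * x) <= 1 - d by nra.
have s1 : step x <= x * (1 - d).
  by rewrite /step expr2 -mulrA; apply: ler_wpM2l.
have s0 : 0 <= step x by rewrite /step mulr_ge0 ?sqr_ge0//; lra.
split; last by apply: le_trans s1 _; rewrite exprSr ler_wpM2r//; lra.
by rewrite s0/=; apply: le_trans s1 _; nra.
Qed.

Lemma trigonometric_iter_step (x : R -> R) n : trigonometric (fun t => (x t)%:C) ->
  trigonometric (fun t => (iter n step (x t))%:C).
Proof.
move=> tx; elim: n => //= n IH.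
have [m [P E]] := trigonometricM (trigonometricM IH IH)
  (trigonometricD (trigonometric_cst 3) (trigonometricM (trigonometric_cst (- 2)) IH)).
exists m, P => t; rewrite -E /step; move: (iter n _ _) => y.
by rewrite expr2 mulNr !(rmorphM, rmorphB, rmorph_nat).
Qed.

(** Iterating [step] pushes the values of [x] above [1 / 2] to [1] and those
    below to [0], uniformly away from [1 / 2], and [iter n step (x t)] remains
    a trigonometric polynomial. *)
Lemma approximable_superlevel (x : R -> R) A : trigonometric (fun t => (x t)%:C) ->
  (forall t, 0 <= x t <= 1) ->
  (forall e, 0 < e -> exists d B, [/\ 0 < d, (outer_leb R B < e%:E)%E &
    forall t, arc t -> ~ B t -> if t \in A then 1 / 2 + d <= x t else x t <= 1 / 2 - d]) ->
  approximable_set A.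
Proof.
move=> tx x01 H e e0; have [d [B [d0 Be BH]]] := H _ e0.
pose q := Num.max 0 (1 - d).
have q01 : 0 <= q < 1 by rewrite /q le_max lexx /= gt_max ltr01; lra.
have [n _ /(_ n (leqnn n))/=] := near_mul_expr_lt 1 q01 e0; rewrite mul1r => qe.
exists (fun t => (iter n step (x t))%:C); first exact: trigonometric_iter_step.
apply: close_sub Be => t ta nB; have := BH t ta nB.
have small y : 0 <= y <= 1 / 2 - d -> `|iter n step y| < e.
  move=> Hy; have /andP[a b] := iter_step_low n d0 Hy.
  rewrite ger0_norm//; apply: le_lt_trans b (le_lt_trans _ qe).
  by apply: lerXn2r; rewrite ?nnegrE /q ?le_max ?lexx ?orbT//; lra.
have /andP[x0 x1] := x01 t.
rewrite /ind; case: ifPn => _ h.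
  have -> : (true%:R - (iter n step (x t))%:C : R[i]) = (iter n step (1 - x t))%:C.
    by rewrite iter_step_opp rmorphB.
  by rewrite normc_real; apply: small; lra.
by rewrite sub0r normc_opp normc_real; apply: small; lra.
Qed.

Let cos_ge_cos (u v : R) : - v <= u <= v -> v <= pi -> cos v <= cos u.
Proof.
move=> /andP[vu uv] vp; have [u0|u0] := leP 0 u.
  by apply: cos_le_cos; apply/andP; split; lra.
by rewrite -(cosN u); apply: cos_le_cos; apply/andP; split; lra.
Qed.

(** On the circle a half-line is an arc ending at [1]; it is a superlevel set
    of a cosine centred at the middle of that arc. *)
Lemma approximable_half_line (a : R) : approximable_set [set t | a < t].
Proof.
have pi0 := pi_gt0 R; set A := [set t | a < t].
have inA t : (t \in A) = (a < t) by apply/idP/idP; rewrite inE.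
have [a0|a0] := ltP 0 a; last first.
  apply: approximable_set_lim => e e0; exists setT.
    by apply: (approximable_mono (approximable_cst 1)) => t _; rewrite /ind in_setT.
  have e0' : (0 <= e / 2) by rewrite ltW// divr_gt0.
  apply: (@le_lt_trans _ _ (outer_leb R `[0, e / 2]%classic)); last first.
    by rewrite outer_leb_itv// lte_fin subr0; lra.
  apply: le_outer_leb => t [/=]; rewrite /arc /= in_itv /= => /andP[t0 _].
  case=> [[_ []//]|[_ /negP]].
  rewrite -leNgt in_itv /= => ta; apply/andP; split; lra.
have [a2|a2] := ltP a (2 * pi); last first.
  apply: (approximable_mono approximable_set0) => t.
  rewrite /arc /= in_itv /= => /andP[_ t2]; rewrite /ind in_set0 inA.
  by rewrite ltNge (le_trans (ltW t2) a2).
pose w := pi - a / 2; pose th := pi + a / 2.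
pose x t := 1 / 2 + (cos (t - th) - cos w) / 4.
apply: (@approximable_superlevel x).
- have [m [P E]] := trigonometricD (trigonometric_cst (1 / 2 - cos w / 4)%:C)
    (trigonometricM (trigonometric_cst (1 / 4)%:C) (trigonometric_cos th)).
  exists m, P => t; rewrite -E -rmorphM -rmorphD /x; congr (_%:C); ring.
- move=> t; rewrite /x.
  have := cos_le1 (t - th); have := cos_geN1 (t - th).
  by have := cos_le1 w; have := cos_geN1 w; move=> *; apply/andP; split; lra.
move=> e e0.
(* The exceptional set: intervals of length proportional to [dl] at the ends of
   [arc] and at [a], where the cosine is close to [cos w]. *)
pose dl := Num.min (e / 8) (Num.min (a / 4) (w / 2)).
have [dl0 dle dla dlw] : [/\ 0 < dl, dl <= e / 8, dl <= a / 4 & dl <= w / 2].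
  rewrite /dl !lt_min !ge_min !lexx ?orbT /w; split=> //.
  by rewrite !divr_gt0//=; lra.
pose d := Num.min (cos (w - dl) - cos w) (cos w - cos (w + dl)) / 4.
have wE : w = pi - a / 2 by [].
have d0 : 0 < d.
  by rewrite divr_gt0// lt_min !subr_gt0 !cos_lt_cos//; lra.
have [d1 d2] : 4 * d <= cos (w - dl) - cos w /\ 4 * d <= cos w - cos (w + dl).
  by rewrite /d mulrC divfK//; split; rewrite ge_min lexx ?orbT.
exists d, (`[0, dl]%classic `|` (`[a - dl, a + dl]%classic `|`
  `[2 * pi - dl, 2 * pi]%classic)); split => //.
  apply: le_lt_trans (outer_lebU _ _) _.
  apply: le_lt_trans (leeD (lexx _) (outer_lebU _ _)) _.
  rewrite outer_leb_itv ?(ltW dl0)// outer_leb_itv; last lra.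
  rewrite outer_leb_itv; last lra.
  by rewrite -!EFinD lte_fin; lra.
move=> t; rewrite /arc /= !in_itv /= => /andP[t0 t2] /not_orP[B1 /not_orP[B2 B3]].
have {}B1 : dl < t by rewrite ltNge; apply/negP => h; apply: B1; rewrite t0.
have {}B3 : t < 2 * pi - dl.
  by rewrite ltNge; apply/negP => h; apply: B3; rewrite h ltW.
rewrite inA; case: ltP => at_.
  have {}B2 : a + dl < t.
    by rewrite ltNge; apply/negP => h; apply: B2; apply/andP; split; lra.
  have : cos (w - dl) <= cos (t - th).
    by apply: cos_ge_cos; rewrite /th; [apply/andP; split|]; lra.
  by rewrite /x; lra.
have {}B2 : t < a - dl.
  by rewrite ltNge; apply/negP => h; apply: B2; apply/andP; split; lra.
have : cos (t - th) <= cos (w + dl).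
  rewrite -cosN opprB; apply: cos_le_cos; rewrite /th; apply/andP; split; lra.
by rewrite /x; lra.
Qed.

Lemma approximable_ocitv (a b : R) : approximable_set `]a, b].
Proof.
have -> : `]a, b]%classic = [set t | a < t] `&` ~` [set t | b < t].
  apply/seteqP; split => t /=; rewrite in_itv /=.
    by move=> /andP[-> tb]; split => //; apply/negP; rewrite -leNgt.
  by move=> [-> /negP]; rewrite -leNgt.
by apply: approximable_setI; [|apply: approximable_setC]; exact: approximable_half_line.
Qed.

End approximable_sets.

Section measurable_functions.
Variable R : realType.
Implicit Types (A B E : set R) (e : R).

Lemma outer_leb_bigcup (F : nat -> set R) :
  (outer_leb R (\bigcup_k F k) <= \sum_(0 <= k <oo) outer_leb R (F k))%E.
Proof. exact: outer_measure_sigma_subadditive. Qed.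

Lemma outer_leb_tail (F : nat -> set R) e : 0 < e ->
  (\sum_(0 <= k <oo) outer_leb R (F k) < +oo)%E ->
  \forall n \near \oo, (outer_leb R (\bigcup_k F (k + n)%N) < e%:E)%E.
Proof.
move=> e0 Foo.
have /fine_cvgP[tf tc] := @nneseries_tail_cvg R (fun k => outer_leb R (F k)) xpredT
  Foo (fun k _ => outer_leb_ge0 (F k)).
move/cvgrPdist_lt/(_ _ e0): tc => tc.
near=> n.
have fn : (\sum_(n <= k <oo) outer_leb R (F k))%E \is a fin_num by near: n; exact: tf.
have : `|0 - fine (\sum_(n <= k <oo) outer_leb R (F k))%E| < e by near: n; exact: tc.
rewrite sub0r normrN ger0_norm ?fine_ge0 ?nneseries_ge0//.
rewrite -lte_fin fineK// => h; apply: le_lt_trans h.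
apply: le_trans (outer_leb_bigcup _) _.
by rewrite (nneseries_addn (f := fun k => outer_leb R (F k))).
Unshelve. all: by end_near. Qed.

Lemma outer_leb_cover A (x : \bar R) : (outer_leb R A < x)%E ->
  exists F : nat -> set R, [/\ forall k, exists a b, F k = `]a, b]%classic,
    A `<=` \bigcup_k F k & (\sum_(0 <= k <oo) outer_leb R (F k) < x)%E].
Proof.
move=> /ereal_inf_lt[_ [F [mF AF] <-] Fx]; exists F; split=> //.
  by move=> k; have [[a b] _ <-] := mF k; exists a, b.
apply: le_lt_trans Fx; apply: lee_nneseries => [k _ _|k _].
  exact: outer_leb_ge0.
by rewrite /outer_leb /= measurable_mu_extE.
Qed.

Lemma outer_leb_arc : (outer_leb R arc < +oo)%E.
Proof. by rewrite /arc outer_leb_itv ?ltry// mulr_ge0 ?pi_ge0. Qed.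

(** The intersection of countably many covers by intervals is a Borel null set. *)
Lemma outer_leb_negligible A : outer_leb R A = 0%E -> lebesgue_measure.-negligible A.
Proof.
move=> A0.
have cover n : exists F : nat -> set R, [/\ forall k, exists a b, F k = `]a, b]%classic,
    A `<=` \bigcup_k F k & (\sum_(0 <= k <oo) outer_leb R (F k) < (n.+1%:R^-1)%:E)%E].
  by apply: outer_leb_cover; rewrite A0 lte_fin invr_gt0.
have [F FP] := choice cover.
pose U n : set (measurableTypeR R) := \bigcup_k F n k.
have mU : measurable (\bigcap_n U n).
  apply: bigcapT_measurable => n; apply: bigcupT_measurable => k.
  by have [/(_ k)[a [b ->]] _ _] := FP n; exact: measurable_itv.
exists (\bigcap_n U n); split=> //; last first.
  by move=> t At n _; have [_ AF _] := FP n; exact: AF.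
apply/eqP; rewrite eq_le measure_ge0 andbT; apply/lee_addgt0Pr => e e0; rewrite add0e.
have [n ne] : exists n : nat, n.+1%:R^-1 < e.
  exists (Num.truncn e^-1).
  by rewrite -[ltRHS]invrK ltf_pV2 ?posrE ?invr_gt0// truncnS_gt.
apply: (@le_trans _ _ (outer_leb R (U n))).
  by apply: le_outer_leb => t; apply.
apply: le_trans (outer_leb_bigcup _) _; have [_ _ /ltW H] := FP n.
by apply: le_trans H _; rewrite lee_fin ltW.
Qed.

(** A set of finite outer measure is covered by intervals with hardly larger
    total length; Caratheodory's criterion says that the excess is small, and
    finitely many of the intervals already cover most of the set. *)
Lemma caratheodory_approximable E : E `<=` arc ->
  caratheodory_measurable (outer_leb R) E -> approximable_set E.
Proof.
move=> Earc cE; apply: approximable_set_lim => e e0.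
have e2 : 0 < e / 2 by rewrite divr_gt0.
have Efin : outer_leb R E \is a fin_num.
  rewrite ge0_fin_numE ?outer_leb_ge0//.
  by apply: le_lt_trans outer_leb_arc; exact: le_outer_leb.
have [F [mF EF Flt]] : exists F : nat -> set R,
    [/\ forall k, exists a b, F k = `]a, b]%classic, E `<=` \bigcup_k F k &
      (\sum_(0 <= k <oo) outer_leb R (F k) < outer_leb R E + (e / 2)%:E)%E].
  by apply: outer_leb_cover; rewrite lteDl// lte_fin.
have Foo : (\sum_(0 <= k <oo) outer_leb R (F k) < +oo)%E.
  by apply: lt_trans Flt _; rewrite lte_add_pinfty ?ltry// -ge0_fin_numE ?outer_leb_ge0.
have [n _ /(_ n (leqnn n))/= nP] := outer_leb_tail e2 Foo.
exists (\big[setU/set0]_(i < n) F i).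
  by apply: approximable_bigU => k; have [a [b ->]] := mF k; exact: approximable_ocitv.
pose U := \bigcup_k F k.
have UE : (outer_leb R (U `\` E) < (e / 2)%:E)%E.
  have := le_lt_trans (outer_leb_bigcup F) Flt; rewrite (cE (\bigcup_k F k)).
  have -> : \bigcup_k F k `&` E = E by apply/setIidPr.
  by rewrite lteD2lE.
apply: le_lt_trans (_ : (outer_leb R (\bigcup_k F (k + n)%N) + outer_leb R (U `\` E) < _)%E).
  apply: le_trans (outer_lebU _ _); apply: le_outer_leb => t [_ [[tE nF]|[tF tE]]].
    have [k _ Fk] := EF t tE; left; exists (k - n)%N => //.
    rewrite subnK// leqNgt; apply/negP => kn; apply: nF.
    by rewrite -bigcup_mkord; exists k.
  right; split=> //; move: tF; rewrite -bigcup_mkord => -[k _ Fk].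
  by exists k.
by rewrite [in ltRHS](splitr e) EFinD lteD.
Qed.

Let C := caratheodory_type (outer_leb R).

Lemma measurable_arc : measurable (arc : set C).
Proof. by apply: sub_caratheodory; exact: measurable_itv. Qed.

Lemma approximable_preimage (psi : R -> R) (Y : set R) :
  measurable_fun (arc : set C) (psi : C -> R) -> measurable Y ->
  approximable_set (arc `&` psi @^-1` Y).
Proof.
move=> mpsi mY; apply: caratheodory_approximable; first exact: subIsetl.
exact: (mpsi measurable_arc Y mY).
Qed.

(** Continuity from above of Lebesgue measure on the completed sigma-algebra. *)
Lemma unbounded_small (psi : R -> R) e : measurable_fun (arc : set C) (psi : C -> R) ->
  0 < e -> exists n : nat, (outer_leb R [set t | arc t /\ (n%:R <= `|psi t|)%R] < e%:E)%E.
Proof.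
move=> mpsi e0; pose B n : set C := [set t | arc t /\ (n%:R <= `|psi t|)%R].
have mB n : measurable (B n).
  have -> : B n = arc `&` (fun t => `|psi t|) @^-1` `[n%:R, +oo[%classic.
    by apply/seteqP; split => t /=; rewrite in_itv /= andbT.
  have mn : measurable_fun (arc : set C) (fun t : C => `|psi t| : R).
    exact: measurableT_comp mpsi.
  by apply: mn => //; exact: measurable_arc.
pose mu := @completed_lebesgue_measure R.
have : mu \o B @ \oo --> mu (\bigcap_n B n).
  apply: nonincreasing_cvg_mu => //.
  - by apply: le_lt_trans outer_leb_arc; apply: le_outer_leb => t [].
  - exact: bigcapT_measurable.
  - move=> m n mn; apply/subsetPset => t [ta h]; split=> //.
    by apply: le_trans h; rewrite ler_nat.
have -> : \bigcap_n B n = set0.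
  apply/seteqP; split=> // t H.
  have [_] := H (Num.truncn `|psi t|).+1 I.
  by rewrite leNgt truncnS_gt.
have -> : mu set0 = 0%E by exact: outer_measure0.
move=> /fine_cvgP[Bf /cvgrPdist_lt/(_ _ e0) Bc].
have [n _ /(_ n (leqnn n))/= [nf nb]] := filterI Bf Bc; exists n.
rewrite -[X in (X < _)%E]/(mu (B n)) -(fineK nf) lte_fin; move: nb.
by rewrite sub0r normrN; apply: le_lt_trans; exact: ler_norm.
Qed.

Lemma sum_nat_le (y : R) K : 0 <= y -> y < K%:R ->
  \sum_(k < K) ((k.+1%:R <= y)%R)%:R = (Num.truncn y)%:R :> R.
Proof.
move=> y0 yK; have /andP[jy yj] := truncn_itv y0; set j := Num.truncn y in jy yj *.
have jK : (j <= K)%N by rewrite -(ler_nat R) (le_trans jy) ?ltW.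
rewrite -(big_mkord xpredT (fun k => ((k.+1%:R <= y)%R)%:R)) (big_cat_nat (leq0n j) jK)/=.
rewrite [X in _ + X]big_nat_cond [X in _ + X]big1 ?addr0; last first.
  move=> k /andP[/andP[jk _] _]; rewrite leNgt (lt_le_trans yj)//.
  by rewrite ler_nat ltnS.
rewrite big_nat_cond (eq_bigr (fun=> 1)) => [|k /andP[/andP[_ kj] _]].
  by rewrite -big_nat_cond sumr_const_nat subn0.
by rewrite (le_trans _ jy)// ler_nat.
Qed.

(** Where [psi] lies between [- M] and [M], it differs by at most [1 / m] from
    [- M] plus [1 / m] times the number of [k] with [k / m <= psi + M]. *)
Lemma measurable_approximable (psi : R -> R) :
  measurable_fun (arc : set C) (psi : C -> R) -> approximable (fun t => (psi t)%:C).
Proof.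
move=> mpsi; apply: approximable_lim => e e0.
have [M MP] := unbounded_small mpsi e0.
have [m m0 me] : exists2 m : nat, (0 < m)%N & m%:R^-1 < e.
  exists (Num.truncn e^-1).+1 => //.
  by rewrite -[ltRHS]invrK ltf_pV2 ?posrE ?invr_gt0// truncnS_gt.
have mR : 0 < m%:R :> R by rewrite ltr0n.
pose A (k : nat) := arc `&` psi @^-1` `[k.+1%:R / m%:R - M%:R, +oo[%classic.
exists (fun t => - M%:R + m%:R^-1 * \sum_(k < 2 * M * m) ind (A k) t).
  apply: approximableD; first exact: approximable_cst.
  apply: (@approximableZ R _ (fun t => \sum_(k < 2 * M * m) ind (A k) t)).
  apply: (@approximable_sum R _ (fun k => ind (A k))) => k.
  exact: approximable_preimage.
apply: close_sub MP => t ta /not_andP[//|/negP]; rewrite -ltNge => tM.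
pose y := m%:R * (psi t + M%:R).
move: tM; rewrite ltr_norml => /andP[tM1 tM2].
have y0 : 0 <= y by rewrite mulr_ge0//; lra.
have yK : y < (2 * M * m)%N%:R.
  by rewrite /y !natrM mulrC ltr_pM2r//; lra.
have -> : \sum_(k < 2 * M * m) ind (A k) t = ((Num.truncn y)%:R : R)%:C.
  rewrite -(sum_nat_le y0 yK) rmorph_sum; apply: eq_bigr => k _.
  rewrite /ind; have -> : (t \in A k) = (k.+1%:R <= y).
    rewrite /y mulrC -ler_pdivrMr// -lerBlDr.
    apply/idP/idP; rewrite inE /A /= in_itv /= andbT; first by case.
    by move=> h; split.
  by rewrite rmorph_nat.
have -> : (psi t)%:C - (- M%:R + m%:R^-1 * (Num.truncn y)%:R%:C) =
    (m%:R^-1 * (y - (Num.truncn y)%:R))%:C :> R[i].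
  rewrite !(rmorphM, rmorphB, rmorphD, fmorphV, rmorph_nat) /=.
  have mC : m%:R != 0 :> R[i] by rewrite pnatr_eq0 -lt0n.
  by field.
rewrite normc_real ger0_norm; last first.
  by rewrite mulr_ge0 ?invr_ge0 ?(ltW mR)// subr_ge0 truncn_le.
apply: lt_trans me; rewrite gtr_pMr ?invr_gt0// ltrBlDr.
by rewrite addrC natr1 truncnS_gt.
Qed.

Lemma circle_measurable_approximable (g : R[i] -> R[i]) : circle_measurable g ->
  approximable (fun t => g (expi t)).
Proof.
move=> [mRe mIm].
apply: (approximable_mono (approximableD (measurable_approximable mRe)
  (approximableZ 'i (measurable_approximable mIm)))) => t _.
by rewrite {1}[g (expi t)]complexE.
Qed.

End measurable_functions.

(** * Universality *)

Section countable_family.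
Variable R : realType.
Implicit Types (P : {poly R[i]}) (s : seq (rat * rat)).

(** Rational coefficients leave countably many Laurent polynomials, as a
    meagre set is covered by countably many nowhere dense ones. *)
Definition gaussian (q : rat * rat) : R[i] := ratr q.1 +i* ratr q.2.

Lemma gaussian_dense (z : R[i]) e : 0 < e -> exists q, N (z - gaussian q) < e.
Proof.
move=> e0; case: z => x y.
have near_rat (u : R) : exists r : rat, `|u - ratr r| < e / 2.
  have /rat_in_itvoo[r] : u - e / 2 < u + e / 2.
    by rewrite ltrD2l gtrN// divr_gt0.
  rewrite in_itv /= => /andP[h1 h2]; exists r; rewrite ltr_norml.
  by apply/andP; split; lra.
have [r1 h1] := near_rat x; have [r2 h2] := near_rat y; exists (r1, r2).
apply: le_lt_trans (normc_le_ReIm _) _ => /=.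
by rewrite [ltRHS](splitr e) ltrD.
Qed.

Definition gaussian_poly s : {poly R[i]} := Poly (map gaussian s).

Lemma gaussian_poly_dense P e : 0 < e ->
  exists s, forall z, N z <= 1 -> N (P.[z] - (gaussian_poly s).[z]) < e.
Proof.
move=> e0; pose n := size P; have n1 : 0 < n.+1%:R :> R by [].
have e1 : 0 < e / n.+1%:R by rewrite divr_gt0.
have [q qP] := choice (fun k => gaussian_dense P`_k e1).
pose s := mkseq q n; exists s => z z1.
have sz : size s = n by rewrite size_mkseq.
have coefE k : (k < n)%N -> (gaussian_poly s)`_k = gaussian (q k).
  by move=> kn; rewrite coef_Poly (nth_map (0%Q, 0%Q)) ?sz// nth_mkseq.
have PE : P.[z] - (gaussian_poly s).[z] = \sum_(k < n) (P`_k - gaussian (q k)) * z ^+ k.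
  have le : (size (gaussian_poly s) <= n)%N.
    by apply: leq_trans (size_Poly _) _; rewrite size_map sz.
  rewrite horner_coef (horner_coef_wide _ le) -sumrB; apply: eq_bigr => k _.
  by rewrite coefE// mulrBl.
rewrite PE; apply: le_lt_trans (normc_sum _ _) _.
apply: (@le_lt_trans _ _ (\sum_(k < n) e / n.+1%:R)).
  apply: ler_sum => k _; rewrite Normc.normcM normcX -[leRHS]mulr1.
  apply: ler_pM; rewrite ?normc_ge0 ?exprn_ge0 ?normc_ge0 ?(ltW (qP k))//.
  by apply: exprn_ile1; rewrite ?normc_ge0.
rewrite sumr_const card_ord -[X in X < _]mulr_natr mulrAC ltr_pdivrMr//.
by rewrite ltr_pM2l// ltr_nat.
Qed.

Definition gaussian_laurent (x : nat * seq (rat * rat)) :=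
  laurent x.1 (gaussian_poly x.2).

Lemma gaussian_laurent_dense f e : approximable f -> 0 < e ->
  exists x, close_in_measure f (gaussian_laurent x) e.
Proof.
move=> af e0; have e2 : 0 < e / 2 by rewrite divr_gt0.
have [g [m [P gE]] fg] := af _ e2; have [s sP] := gaussian_poly_dense P e2.
exists (m, s); rewrite (splitr e); apply: close_triangle fg _.
apply: (@close_sub _ _ _ _ set0); last by rewrite outer_measure0 lte_fin.
move=> t _ _; rewrite gE /gaussian_laurent /laurent /= -mulrBr Normc.normcM.
rewrite Normc.normcV normcX normc_expi expr1n invr1 mul1r.
by apply: sP; rewrite normc_expi.
Qed.

End countable_family.

Section bergman_elements.
Variables (R : realType) (p : R) (p1 : 1 <= p).
Implicit Types (f h : bergman p1) (P Q : {poly R[i]}).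

Let p0 : 0 < p. Proof. exact: lt_le_trans p1. Qed.

Definition bergman_poly P : bergman p1 :=
  Bergman p1 (@disc_poly_holomorphic R P) (@disc_poly_out R P) (disc_poly_finite P p0).

Lemma bergman_disc_function f : disc_function f.
Proof. by split; [exact: bergman_continuous|exact: bergman_out]. Qed.

Lemma bergman_ballE f (r : R) : ball f r = [set h | bergman_dist f h < r].
Proof. exact: ballEmdist. Qed.

Lemma taylor_coefB f h k :
  taylor_coef (fun z => f z - h z) k = taylor_coef f k - taylor_coef h k.
Proof.
have w01 : 0 < N ((1 / 2 : R)%:C) < 1.
  by rewrite normc_real ger0_norm; [apply/andP; split|]; lra.
have hf := @bergman_holomorphic R p p1 f; have hh := @bergman_holomorphic R p p1 h.
have L := taylor_coef_mean (k := k) (holomorphicB hf hh) w01.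
have L' := cvg_complexB (taylor_coef_mean (k := k) hf w01) (taylor_coef_mean (k := k) hh w01).
have L2 : (fun n => circle_mean n (fun z => (f z - h z) * z ^- k) (1 / 2)%:C) @ \oo -->
    (taylor_coef f k - taylor_coef h k).
  have := L' (@eventually_filter); apply: eq_cvg_complex => n.
  by rewrite -circle_meanB; apply: eq_circle_mean => z _; rewrite mulrBl.
exact: (cvg_unique _ L L2).
Qed.

(** Only finitely many coefficients enter, and each is continuous. *)
Lemma taylor_sum_continuous n f e : 0 < e -> exists2 d, 0 < d &
  forall h, bergman_dist h f < d ->
    forall z, N z = 1 -> N (taylor_sum h n z - taylor_sum f n z) < e.
Proof.
move=> e0; have n1 : 0 < n.+1%:R :> R by [].
have e1 : 0 < e / n.+1%:R by rewrite divr_gt0.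
have H m : exists2 d, 0 < d & forall h, bergman_dist h f < d ->
    forall k, (k < m)%N -> N (taylor_coef h k - taylor_coef f k) < e / n.+1%:R.
  elim: m => [|m [d d0 dP]]; first by exists 1.
  have [d' d'0 d'P] := taylor_coef_continuous (p := p) m p1 e1.
  exists (Num.min d d') => [|h]; first by rewrite lt_min d0.
  rewrite lt_min => /andP[hd hd'] k; rewrite ltnS leq_eqVlt => /predU1P[->|km]; last exact: dP.
  rewrite -taylor_coefB; apply: d'P.
  - split; first exact: bergmanB_continuous.
    by move=> z; exact: bergmanB_out.
  - exact: holomorphicB (@bergman_holomorphic R p p1 h) (@bergman_holomorphic R p p1 f).
  - by move: hd'; rewrite /bergman_dist -lte_fin fineK ?bergman_normB_fin.
have [d d0 dP] := H n.+1; exists d => // h hd z z1.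
rewrite !taylor_sumE -sumrB; apply: le_lt_trans (normc_sum _ _) _.
apply: (@lt_le_trans _ _ (\sum_(k < n.+1) e / n.+1%:R)).
  apply: ltr_sum => [|k _]; last first.
    by rewrite -mulrBl Normc.normcM normcX z1 expr1n mulr1; exact: dP.
  by apply/hasP; exists ord0; rewrite ?mem_index_enum.
by rewrite sumr_const card_ord -[X in X <= _]mulr_natr divfK.
Qed.

(** An element outside these sets, for [L] in a dense family and [e] small, has
    partial sums of arbitrarily high order close to every target. *)
Definition avoiding (L : R -> R[i]) (e : R) (m : nat) : set (bergman p1) :=
  [set f | forall n, (m <= n)%N ->
     ~ close_in_measure (fun t => taylor_sum f n (expi t)) L e].

(** Near any element there is a polynomial [P]; adding to it a small polynomial
    which on the circle is close to [L - P] makes a partial sum close to [L],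
    and it remains so under small perturbations. *)
Lemma avoiding_nowhere_dense a P e m : 0 < e -> nowhere_dense (avoiding (laurent a P) e m).
Proof.
move=> e0; rewrite /nowhere_dense; apply/seteqP; split=> // f /nbhs_ballP[r /= r0 rf].
have r2 : 0 < r / 2 by rewrite divr_gt0.
have [S fS] := polynomials_dense p1 r2 (bergman_disc_function f) (@bergman_holomorphic R p p1 f)
  (bergman_finite f).
have e3 : 0 < Num.min (r / 2) (e / 2) by rewrite lt_min r2 divr_gt0.
have [Q Qr Qe] := small_polynomial a (P - 'X^a * S) p1 e3.
pose h := bergman_poly (S + Q).
have fh : bergman_dist f h < r.
  rewrite -lte_fin fineK ?bergman_normB_fin// (splitr r) EFinD.
  apply: le_lt_trans (bergman_normB_triangle f (bergman_poly S) h) _.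
  apply: lteD; first exact: fS.
  rewrite bergman_normN.
  have -> : (fun z => h z - bergman_poly S z) = disc_poly Q.
    by apply/funext => z; rewrite -disc_polyB addrAC subrr add0r.
  by apply: lt_le_trans Qr _; rewrite lee_fin ge_min lexx.
pose n := maxn m (size (S + Q)).
have e2 : 0 < e / 2 by rewrite divr_gt0.
have [d d0 dP] := taylor_sum_continuous n h e2.
have hL : close_in_measure (fun t => taylor_sum h n (expi t)) (laurent a P) (e / 2).
  have : close_in_measure (fun t => Q.[expi t]) (laurent a (P - 'X^a * S)) (e / 2).
    apply: le_lt_trans (lt_le_trans Qe _); last by rewrite lee_fin ge_min lexx orbT.
    by apply/le_outer_leb/le_far; rewrite ge_min lexx orbT.
  apply: le_lt_trans; apply: le_outer_leb => t [ta H]; split => //; apply: le_trans H _.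
  rewrite /laurent taylor_sum_disc_poly; last by rewrite (leq_trans (leq_maxr m _)).
  rewrite !(hornerD, hornerN, hornerM, hornerXn) mulrBr mulKf ?expf_neq0 ?expi_neq0//.
  by rewrite opprB addrCA addrA.
have [g [gA hg]] : exists g, avoiding (laurent a P) e m g /\ bergman_dist h g < d.
  have : closure (avoiding (laurent a P) e m) h by apply: rf; rewrite bergman_ballE.
  move=> /(_ _ (nbhsx_ballx h _ d0))[g [gA]]; rewrite bergman_ballE => hg.
  by exists g.
apply: (gA n (leq_maxl _ _)); rewrite (splitr e); apply: close_triangle hL.
apply: (@close_sub _ _ _ _ set0); last by rewrite outer_measure0 lte_fin.
move=> t _ _; apply: dP; rewrite ?normc_expi//.
by move: hg; rewrite /bergman_dist bergman_normN.
Qed.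

End bergman_elements.

Section universality.
Variable R : realType.

(** Borel-Cantelli: the exceptional sets have summable outer measures, so almost
    every point lies in finitely many of them. *)
Lemma ae_cvg_of_close (u : nat -> R[i] -> R[i]) (g : R[i] -> R[i]) :
  (forall n, close_in_measure (fun t => u n (expi t)) (fun t => g (expi t)) (2^-1 ^+ n)) ->
  ae_circle (fun z => u n z @[n --> \oo] --> g z).
Proof.
move=> ug; pose F n := far (fun t => u n (expi t)) (fun t => g (expi t)) (2^-1 ^+ n).
have half : 0 <= (2^-1 : R) < 1 by apply/andP; split; lra.
have Foo : (\sum_(0 <= k <oo) outer_leb R (F k) < +oo)%E.
  have H := @cvg_geometric_eseries_half R 2 0.
  apply: (@le_lt_trans _ _ (\sum_(0 <= k <oo) (2 / (2 ^ (k + 1))%:R)%:E)%E).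
    apply: lee_nneseries => [k _ _|k _]; first exact: outer_leb_ge0.
    apply/ltW/(lt_le_trans (ug k)); rewrite lee_fin addn1 expnS natrM invfM mulrA divff//.
    by rewrite mul1r natrX exprVn.
  have -> : (\sum_(0 <= k <oo) (2 / (2 ^ (k + 1))%:R)%:E = 2%:E :> \bar R)%E.
    by transitivity (2 / 2 ^+ 0 : R)%:E; [exact/cvg_lim|rewrite expr0 divr1].
  exact: ltry.
pose Z := \bigcap_n \bigcup_k F (k + n)%N.
have Z0 : outer_leb R Z = 0%E.
  apply/eqP; rewrite eq_le outer_leb_ge0 andbT; apply/lee_addgt0Pr => e e0.
  rewrite add0e; have [n _ /(_ n (leqnn n))/= H] := outer_leb_tail e0 Foo.
  by apply/ltW/(le_lt_trans _ H)/le_outer_leb => t; apply.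
apply: negligibleS (outer_leb_negligible Z0) => t /= /not_implyP[ta nc].
apply: contrapT => nZ; apply: nc.
have [n nF] : exists n, forall k, ~ F (k + n)%N t.
  apply: contrapT => H; apply: nZ => n _; apply: contrapT => H'; apply: H.
  by exists n => k Fk; apply: H'; exists k.
have b (k : nat) : (n <= k)%N -> N (u k (expi t) - g (expi t)) < 2^-1 ^+ k.
  move=> nk; apply: (@far_in R (fun t => u k (expi t)) (fun t => g (expi t)) _ t ta).
  by have := nF (k - n)%N; rewrite subnK.
apply/cvg_normcP => e e0.
have [m _ mP] := near_mul_expr_lt 1 half e0.
exists (maxn n m) => // k /=; rewrite geq_max => /andP[nk mk].
have := mP k mk; rewrite /= mul1r; apply: lt_trans.
by have := b k nk; rewrite -normc_opp opprB.
Qed.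

(** The [n]-th order is chosen above the previous one and with error [2 ^- n];
    the resulting subsequence converges in measure fast enough for
    Borel-Cantelli. *)
Lemma universal_of_close (f : R[i] -> R[i]) :
  (forall x e m, 0 < e -> exists2 n, (m <= n)%N &
     close_in_measure (fun t => taylor_sum f n (expi t)) (gaussian_laurent x) e) ->
  menshov_universal f.
Proof.
move=> H g mg; have ag := circle_measurable_approximable mg.
have step (x : nat * nat) : exists n, (x.2 <= n)%N /\
    close_in_measure (fun t => taylor_sum f n (expi t)) (fun t => g (expi t)) (2^-1 ^+ x.1).
  have e0 : 0 < 2^-1 ^+ x.1 / 2 :> R by rewrite divr_gt0 ?exprn_gt0.
  have [y gy] := gaussian_laurent_dense ag e0.
  have [n mn ny] := H y _ x.2 e0; exists n; split=> //.
  rewrite (splitr (2^-1 ^+ x.1)); apply: close_triangle ny _.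
  apply: le_lt_trans gy; apply: le_outer_leb => t [ta h]; split=> //.
  by rewrite -normc_opp opprB.
have [next nextP] := choice step.
(* [next (n, j)] is an order at least [j] with error [2 ^- n]. *)
pose k := fix k n := if n is n'.+1 then next (n, (k n').+1) else next (0, 0).
exists k; split.
  by apply: homo_ltn => [|n]; [exact: ltn_trans|exact: (nextP (n.+1, (k n).+1)).1].
apply: ae_cvg_of_close; case=> [|n].
  exact: (nextP (0, 0)).2.
exact: (nextP (n.+1, (k n).+1)).2.
Qed.

End universality.

Lemma comeagre_forall_countable (T : topologicalType) (I : countType) (A : I -> set T)
    (P : set T) : (forall i, nowhere_dense (A i)) ->
  (forall x, (forall i, ~ A i x) -> P x) -> comeagre P.
Proof.
move=> An AP; exists (fun n => if unpickle n is Some i then A i else set0).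
split=> [n|x nPx].
  by case: unpickle => [i|]; [exact: An|rewrite /nowhere_dense closure0 interior0].
apply: contrapT => nA; apply: nPx; apply: AP => i Ai; apply: nA.
by exists (pickle i) => //; rewrite pickleK.
Qed.

Theorem theorem1p3 (R : realType) (p : R) (p1 : 1 <= p) :
  comeagre [set f : bergman p1 | menshov_universal f].
Proof.
pose A (x : (nat * seq (rat * rat)) * (nat * nat)) :=
  avoiding (p1 := p1) (gaussian_laurent x.1) x.2.1.+1%:R^-1 x.2.2.
apply: (@comeagre_forall_countable _ _ A) => [x|f fA].
  by apply: avoiding_nowhere_dense; rewrite invr_gt0.
apply: universal_of_close => x e m e0.
have [i ie] : exists i : nat, i.+1%:R^-1 < e.
  exists (Num.truncn e^-1).
  by rewrite -[ltRHS]invrK ltf_pV2 ?posrE ?invr_gt0// truncnS_gt.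
apply: contrapT => H; apply: (fA (x, (i, m))) => n mn /= c; apply: H; exists n => //.
apply: le_lt_trans (lt_trans c _); last by rewrite lte_fin.
exact/le_outer_leb/le_far/ltW.
Qed.
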